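(* Let $(T_2(t))_{t\ge0}$ be the semigroup on $X_2$ associated with the form $\mathfrak{a}(f,g)=\sum_{j=1}^m\int_0^1\mu_jc_j(x)f_j'(x)\overline{g_j'(x)}\,dx$ with domain $V=\{f\in (H^1(0,1))^m:\exists d\in\mathbb{C}^n \text{ s.t. } (\Phi^+)^\top d=f(0)\text{ and }(\Phi^-)^\top d=f(1)\}$. Then $(T_2(t))_{t\ge0}$ is sub-Markovian, i.e., it is real, positive, and contractive on $X_\infty$.
   Context: $G$ is a finite connected simple graph (no loops, no multiple edges) with vertices $\mathsf{v}_1,\dots,\mathsf{v}_n$ and edges $\mathsf{e}_1,\dots,\mathsf{e}_m$, in which every vertex has degree at least 2. Each edge is parameterized on $[0,1]$, with endpoints $\mathsf{e}_j(0)$ and $\mathsf{e}_j(1)$. The $n\times m$ matrices $\Phi^{\pm}=(\phi^{\pm}_{ij})$ are: $\phi^+_{ij}=1$ if $\mathsf{e}_j(0)=\mathsf{v}_i$ and $0$ otherwise; $\phi^-_{ij}=1$ if $\mathsf{e}_j(1)=\mathsf{v}_i$ and $0$ otherwise. The constants $\mu_j$ are strictly positive and the coefficients $c_j\in C^1[0,1]$ are strictly positive on $[0,1]$. $X_p:=\prod_{j=1}^mL^p(0,1;\mu_jdx)$ (complex-valued), $X_2$ with inner product $(f,g)_{X_2}=\sum_j\int_0^1f_j\overline{g_j}\mu_jdx$, $\|f\|_{X_\infty}=\max_j\|f_j\|_{L^\infty}$. For $f=(f_1,\dots,f_m)^\top$, $f(0)=(f_1(0),\dots,f_m(0))^\top$,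 $f(1)=(f_1(1),\dots,f_m(1))^\top$. The operator $A$ associated with $\mathfrak{a}$ is $D(A)=\{f\in V:\exists g\in X_2\text{ s.t. }\mathfrak{a}(f,h)=(g,h)_{X_2}\ \forall h\in V\}$, $Af=-g$; it is self-adjoint and dissipative and $(T_2(t))_{t\ge0}$ is the $C_0$-semigroup it generates. Real: $T_2(t)$ maps real-valued functions to real-valued functions; positive: $f\ge0$ implies $T_2(t)f\ge0$; contractive on $X_\infty$: $\|T_2(t)f\|_{X_\infty}\le\|f\|_{X_\infty}$ for $f\in X_\infty$ and $t\geq 0$. *)

(* Defs.v *)
From HB Require Import structures.
From mathcomp Require Import all_boot all_order all_algebra.
From mathcomp Require Import complex.
From mathcomp Require Import all_classical all_reals all_analysis.

Set Implicit Arguments.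
Unset Strict Implicit.
Unset Printing Implicit Defensive.

Import Order.TTheory GRing.Theory Num.Theory.
Import ComplexField.Normc.
Import numFieldNormedType.Exports.

Local Open Scope classical_set_scope.
Local Open Scope ring_scope.
Local Open Scope complex_scope.

(* Vertices are 'I_n and edges are 'I_m; edge j runs from einit j = e_j(0) to
   eterm j = e_j(1). *)
Record edge_graph (n m : nat) := EdgeGraph {
  einit : 'I_m -> 'I_n;
  eterm : 'I_m -> 'I_n }.

Section Graph.
Context {n m : nat} (G : edge_graph n m).

Definition endpoints (j : 'I_m) : {set 'I_n} := [set einit G j; eterm G j]%SET.

Definition simple_graph : Prop :=
  (forall j, einit G j != eterm G j) /\ injective endpoints.

Definition adjacent : rel 'I_n :=
  fun v w => [exists j, endpoints j == [set v; w]%SET].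

Definition connected_graph : Prop :=
  (0 < n)%N /\ forall v w, connect adjacent v w.

(* the graphs considered have no loops, so no edge counts twice *)
Definition degree (v : 'I_n) : nat := #|[pred j | v \in endpoints j]|.

Definition Phi_plus (R : realType) : 'M[R[i]]_(n, m) :=
  \matrix_(i, j) (einit G j == i)%:R.
Definition Phi_minus (R : realType) : 'M[R[i]]_(n, m) :=
  \matrix_(i, j) (eterm G j == i)%:R.
End Graph.

Section OneEdge.
Context {R : realType}.
Implicit Types (f g u : R -> R[i]) (w : R).

(* Functions on (0, 1) are represented by total functions on R whose values
   outside ]0, 1[ are irrelevant. *)
Definition ae01 (P : R -> Prop) : Prop :=
  {ae (@lebesgue_measure R), forall x, x \in `]0, 1[ -> P x}.

Definition cint01 (f : R -> R[i]) : R[i] :=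
  Rintegral lebesgue_measure `]0, 1[ (fun x => complex.Re (f x)) +i*
  Rintegral lebesgue_measure `]0, 1[ (fun x => complex.Im (f x)).

Definition measurable01 f : Prop :=
  measurable_fun (`]0, 1[ : set R) (fun x => complex.Re (f x)) /\
  measurable_fun (`]0, 1[ : set R) (fun x => complex.Im (f x)).

(* representatives of elements of L^2(0, 1; w dx) *)
Definition inL2 w f : Prop := measurable01 f /\
  (@lebesgue_measure R).-integrable `]0, 1[
    (fun x => (normc (f x) ^+ 2 * w)%:E).

(* real-valued C^1 functions with compact support in (0, 1) *)
Definition test_function (phi : R -> R) : Prop :=
  [/\ forall x, derivable phi x 1, continuous (derive1 phi) &
      exists a b : R, [/\ 0 < a, b < 1 &
        forall x, x \notin `[a, b] -> phi x = 0]].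

Definition is_weak_derivative f g : Prop :=
  forall phi, test_function phi ->
    cint01 (fun x => f x * (derive1 phi x)%:C) =
    - cint01 (fun x => g x * (phi x)%:C).

Definition inH1 f : Prop :=
  inL2 1 f /\ exists g, inL2 1 g /\ is_weak_derivative f g.

Definition weak_derivative f : R -> R[i] :=
  xget (fun=> 0) [set g | inL2 1 g /\ is_weak_derivative f g].

(* the representative of f that is continuous on [0, 1], if there is one; it
   gives their meaning to the boundary values f(0) and f(1) for f in H^1 *)
Definition continuous_repr f : R -> R[i] :=
  xget (fun=> 0) [set u | {within `[0, 1], continuous (u : R -> R[i]^o)} /\
                          ae01 (fun x => u x = f x)].

(* f is extended by 0 outside (0, 1) *)
Definition normLoo f : \bar R :=
  'N[@lebesgue_measure R]_(+oo%E)[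
    (fun x : R => (normc (f x))%:E) \_ (`]0%R, 1%R[%classic : set R)]%E.
End OneEdge.

Section C1.
Context {R : realType}.

(* C^1[0, 1], with one-sided derivatives at the end points *)
Definition C1_01 (c : R -> R) : Prop :=
  exists2 c' : R -> R, {within `[0, 1], continuous c'} &
    forall x : R, x \in `[0, 1] ->
      (c y - c x) / (y - x) @[y --> within `[0, 1] x^'] --> c' x.
End C1.

Section ProductSpace.
Context {R : realType} {n m : nat}.
Variables (G : edge_graph n m) (mu : 'I_m -> R) (c : 'I_m -> R -> R).

Definition edge_fun : Type := 'I_m -> R -> R[i].
Implicit Types f g h k : edge_fun.

Definition eqX f g : Prop := forall j, ae01 (fun x => f j x = g j x).

(* representatives of elements of X_2 *)
Definition inX2 f : Prop := forall j, inL2 (mu j) (f j).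

Definition innerX2 f g : R[i] :=
  \sum_(j < m) cint01 (fun x => f j x * (g j x)^* * (mu j)%:C).

Definition normX2 f : R := Num.sqrt (complex.Re (innerX2 f f)).

Definition normXoo f : \bar R := \big[maxe/0%E]_(j < m) normLoo (f j).

Definition inXoo f : Prop :=
  (forall j, measurable01 (f j)) /\ (normXoo f < +oo)%E.

Definition domV f : Prop := (forall j, inH1 (f j)) /\
  exists d : 'cV[R[i]]_n,
    (Phi_plus G R)^T *m d = \col_(j < m) continuous_repr (f j) 0 /\
    (Phi_minus G R)^T *m d = \col_(j < m) continuous_repr (f j) 1.

Definition form_a f g : R[i] :=
  \sum_(j < m) cint01 (fun x => (mu j * c j x)%:C *
    weak_derivative (f j) x * (weak_derivative (g j) x)^* ).

(* the graph of A: f is in D(A) and A f = k *)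
Definition operator_A f k : Prop :=
  [/\ domV f, inX2 k & exists g : edge_fun,
    [/\ inX2 g, forall h, domV h -> form_a f h = innerX2 g h &
        eqX k (fun j x => - g j x)]].

(* A family of operators on X_2 acts on representatives, compatibly with
   equality almost everywhere; its values outside X_2 are irrelevant. *)
Record C0_semigroup (T : R -> edge_fun -> edge_fun) : Prop := C0Semigroup {
  semigroup_X2 : forall t f, 0 <= t -> inX2 f -> inX2 (T t f);
  semigroup_eqX : forall t f g, 0 <= t -> inX2 f -> inX2 g ->
    eqX f g -> eqX (T t f) (T t g);
  semigroup_linear : forall t (a : R[i]) f g, 0 <= t -> inX2 f -> inX2 g ->
    eqX (T t (fun j x => a * f j x + g j x))
        (fun j x => a * T t f j x + T t g j x);
  semigroup_bounded : forall t, 0 <= t ->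
    exists M : R, forall f, inX2 f -> normX2 (T t f) <= M * normX2 f;
  semigroup_0 : forall f, inX2 f -> eqX (T 0 f) f;
  semigroup_add : forall s t f, 0 <= s -> 0 <= t -> inX2 f ->
    eqX (T (s + t) f) (T s (T t f));
  semigroup_continuous : forall f, inX2 f ->
    normX2 (fun j x => T t f j x - f j x) @[t --> 0^'+] --> (0 : R) }.

(* the graph of the generator: f is in its domain, and is mapped to k *)
Definition generator (T : R -> edge_fun -> edge_fun) f k : Prop :=
  [/\ inX2 f, inX2 k &
    normX2 (fun j x => (t^-1)%:C * (T t f j x - f j x) - k j x)
      @[t --> 0^'+] --> (0 : R)].

Definition generated_by_A (T : R -> edge_fun -> edge_fun) : Prop :=
  C0_semigroup T /\ forall f k, generator T f k <-> operator_A f k.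

Definition real_valued f : Prop :=
  forall j, ae01 (fun x => complex.Im (f j x) = 0).

(* in R[i], 0 <= z means that z is real and nonnegative *)
Definition nonneg_valued f : Prop := forall j, ae01 (fun x => 0 <= f j x).

Definition real_semigroup (T : R -> edge_fun -> edge_fun) : Prop :=
  forall t f, 0 <= t -> inX2 f -> real_valued f -> real_valued (T t f).

Definition positive_semigroup (T : R -> edge_fun -> edge_fun) : Prop :=
  forall t f, 0 <= t -> inX2 f -> nonneg_valued f -> nonneg_valued (T t f).

Definition Xoo_contractive (T : R -> edge_fun -> edge_fun) : Prop :=
  forall t f, 0 <= t -> inXoo f -> (normXoo (T t f) <= normXoo f)%E.

Definition sub_markovian (T : R -> edge_fun -> edge_fun) : Prop :=
  [/\ real_semigroup T, positive_semigroup T & Xoo_contractive T].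
End ProductSpace.

(* Main.v *)
Require Import Defs.
From mathcomp Require Import all_boot all_order all_algebra.
From mathcomp Require Import complex.
From mathcomp Require Import all_classical all_reals all_analysis.
From mathcomp Require Import measurable_realfun ess_sup_inf.
From mathcomp Require Import ring lra.

Set Implicit Arguments.
Unset Strict Implicit.
Unset Printing Implicit Defensive.

Import Order.TTheory GRing.Theory Num.Theory.
Import numFieldNormedType.Exports.

Local Open Scope classical_set_scope.
Local Open Scope ring_scope.

(* Up to rotating f in the complex plane, all three properties say that T
   leaves invariant the functions with values in a half-plane Re z <= M, M >= 0:
   real functions take values in two opposite half-planes with M = 0, and discs
   are intersections of countably many half-planes.

   For such an M take a convex C^2 penalty J vanishing exactly on ]-oo, M], with
   Lipschitz derivative p = J', and phi(f) = sum_j mu_j int J(Re f_j). By the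
   chain rule in H^1, p(Re f) is in V whenever f is (continuity at the vertices
   is preserved by applying p), so that for f in D(A)
     d/dt phi(T f) = Re (A T f, p(Re T f)) = - Re a(T f, p(Re T f)) <= 0,
   because p' >= 0. C^2 functions with compact support inside the edges lie in
   D(A) and are dense in X_2, and T is locally bounded by the uniform boundedness
   principle, so phi decreases along every orbit; it vanishes exactly on the
   functions with values in the half-plane. *)

(** * Semi-inner product spaces *)

(** [T] is given only as a C0-semigroup whose generator is [A]. The generator is a limit from the
    right, so phi along an orbit is controlled by a one-sided Dini estimate completed by a
    semicontinuity condition from the left; that condition, and the passage from smooth data to all
    of [X_2], use the local bound on [T].

    The natural choice of p would be the positive part of s - M, which is merely Lipschitz. Rounding
    its corner makes p of class C^1, so the chain rule follows from the fundamental theorem of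
    calculus by approximating the derivative in L^1. Cutting the slope at 1 keeps p of linear
    growth, and J is then bounded by a square, hence integrable on [X_2].

    Elements of [X_2] are representatives, and functions outside [X_2] carry arbitrary values. The
    abstract part therefore works with a form that is constrained only on a subset [X] of a vector
    space and may have nonzero null vectors; identities between vectors are read through the
    seminorm. Real scalars are enough there: complex linearity enters only at the end, when f is
    rotated. *)

Record semi_inner_product {R : realType} {E : lmodType R} (X : set E)
    (ip : E -> E -> R) : Prop := SemiInnerProduct {
  sip_dom0 : X 0;
  sip_domP : forall a f g, X f -> X g -> X (a *: f + g);
  sip_sym : forall f g, X f -> X g -> ip f g = ip g f;
  sip_linear : forall a f g h, X f -> X g -> X h ->
    ip (a *: f + g) h = a * ip f h + ip g h;
  sip_ge0 : forall f, X f -> 0 <= ip f f }.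

Section SemiNorm.
Context {R : realType} {E : lmodType R} {X : set E} {ip : E -> E -> R}.
Hypothesis sip : semi_inner_product X ip.
Implicit Types (f g h : E) (a : R).

Definition sip_norm f : R := Num.sqrt (ip f f).
Local Notation N := sip_norm.

Lemma domD f g : X f -> X g -> X (f + g).
Proof. by move=> Xf Xg; rewrite -[f]scale1r; apply: (sip_domP sip). Qed.

Lemma domZ a f : X f -> X (a *: f).
Proof.
by move=> Xf; rewrite -[_ *: _]addr0; apply: (sip_domP sip) => //;
  apply: (sip_dom0 sip).
Qed.

Lemma domN f : X f -> X (- f).
Proof. by move=> Xf; rewrite -scaleN1r; apply: domZ. Qed.

Lemma domB f g : X f -> X g -> X (f - g).
Proof. by move=> Xf Xg; apply: domD => //; apply: domN. Qed.

Lemma ipDl f g h : X f -> X g -> X h -> ip (f + g) h = ip f h + ip g h.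
Proof.
by move=> Xf Xg Xh; rewrite -[f in LHS]scale1r (sip_linear sip)// mul1r.
Qed.

Lemma ip0l h : X h -> ip 0 h = 0.
Proof.
move=> Xh; have X0 := sip_dom0 sip.
by have := ipDl X0 X0 Xh; rewrite addr0 => /eqP; rewrite -subr_eq0 opprD addrA
  subrr sub0r oppr_eq0 => /eqP.
Qed.

Lemma ipZl a f h : X f -> X h -> ip (a *: f) h = a * ip f h.
Proof.
move=> Xf Xh; have X0 := sip_dom0 sip.
by rewrite -[_ *: _]addr0 (sip_linear sip)// ip0l// addr0.
Qed.

Lemma ipNl f h : X f -> X h -> ip (- f) h = - ip f h.
Proof. by move=> Xf Xh; rewrite -scaleN1r ipZl// mulN1r. Qed.

Lemma ipBl f g h : X f -> X g -> X h -> ip (f - g) h = ip f h - ip g h.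
Proof. by move=> Xf Xg Xh; rewrite ipDl ?ipNl//; apply: domN. Qed.

Lemma ipDr f g h : X f -> X g -> X h -> ip h (f + g) = ip h f + ip h g.
Proof.
move=> Xf Xg Xh; rewrite (sip_sym sip Xh (domD Xf Xg)) ipDl//.
by rewrite (sip_sym sip Xh Xf) (sip_sym sip Xh Xg).
Qed.

Lemma ipZr a f h : X f -> X h -> ip h (a *: f) = a * ip h f.
Proof.
by move=> Xf Xh; rewrite (sip_sym sip Xh (domZ a Xf)) ipZl// (sip_sym sip Xh Xf).
Qed.

Lemma sip_norm_ge0 f : 0 <= N f.
Proof. exact: sqrtr_ge0. Qed.

Lemma sqr_sip_norm f : X f -> N f ^+ 2 = ip f f.
Proof. by move=> Xf; rewrite sqr_sqrtr// (sip_ge0 sip). Qed.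

Lemma ip_expand a f g : X f -> X g ->
  ip (f + a *: g) (f + a *: g) = ip f f + 2 * a * ip f g + a ^+ 2 * ip g g.
Proof.
move=> Xf Xg; have Xag := domZ a Xg.
rewrite ipDl ?ipDr ?ipZl ?ipZr//; do ?exact: domD.
rewrite (sip_sym sip Xg Xf); ring.
Qed.

Lemma cauchy_schwarz f g : X f -> X g -> `|ip f g| <= N f * N g.
Proof.
move=> Xf Xg; rewrite -sqrtrM ?(sip_ge0 sip)// -sqrtr_sqr ler_wsqrtr//.
have Pf := sip_ge0 sip Xf; have Pg := sip_ge0 sip Xg.
have P a : 0 <= ip f f + 2 * a * ip f g + a ^+ 2 * ip g g.
  by rewrite -ip_expand// (sip_ge0 sip)//; apply/domD/domZ.
have [g0|g0] := eqVneq (ip g g) 0.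
  have [->|fg0] := eqVneq (ip f g) 0; first by rewrite expr0n/= g0 mulr0.
  (* When [g] is null the quadratic is affine in [a]; this [a] gives it the value -1. *)
  have := P (- (ip f f + 1) / (2 * ip f g)).
  have -> : 2 * (- (ip f f + 1) / (2 * ip f g)) * ip f g = - (ip f f + 1).
    by field.
  rewrite g0; lra.
have gp : 0 < ip g g by rewrite lt_neqAle eq_sym g0 Pg.
(* The minimizer of the quadratic. *)
have := P (- ip f g / ip g g).
have -> : ip f f + 2 * (- ip f g / ip g g) * ip f g +
  (- ip f g / ip g g) ^+ 2 * ip g g = ip f f - ip f g ^+ 2 / ip g g by field.
by rewrite subr_ge0 ler_pdivrMr.
Qed.

Lemma sip_normD f g : X f -> X g -> N (f + g) <= N f + N g.
Proof.
move=> Xf Xg; rewrite -(@ler_pXn2r _ 2) ?nnegrE ?addr_ge0 ?sip_norm_ge0//.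
rewrite sqr_sip_norm; last exact: domD.
have := ip_expand 1 Xf Xg; rewrite scale1r => ->.
have := le_trans (ler_norm _) (cauchy_schwarz Xf Xg).
rewrite sqrrD !sqr_sip_norm// mulr1 expr1n mul1r -mulr_natl; lra.
Qed.

Lemma sip_normZ a f : X f -> N (a *: f) = `|a| * N f.
Proof.
move=> Xf; have Xa := domZ a Xf.
rewrite /sip_norm ipZl// ipZr// mulrA -expr2 sqrtrM ?sqr_ge0//.
by rewrite sqrtr_sqr.
Qed.

Lemma sip_normN f : X f -> N (- f) = N f.
Proof. by move=> Xf; rewrite -scaleN1r sip_normZ// normrN1 mul1r. Qed.

Lemma sip_norm0 : N 0 = 0.
Proof. by rewrite /sip_norm ip0l ?sqrtr0//; apply: (sip_dom0 sip). Qed.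

Lemma sip_normB f g : X f -> X g -> N (f - g) = N (g - f).
Proof. by move=> Xf Xg; rewrite -sip_normN ?opprB//; apply: domB. Qed.

Lemma sip_norm_le f g : X f -> X g -> N f <= N g + N (f - g).
Proof.
move=> Xf Xg; rewrite -[f in leLHS](subrK g) addrC.
by apply: sip_normD => //; apply: domB.
Qed.

Lemma sip_norm_tri f g h : X f -> X g -> X h -> N (f - h) <= N (f - g) + N (g - h).
Proof.
move=> Xf Xg Xh; have -> : f - h = (f - g) + (g - h) by rewrite addrA subrK.
by apply: sip_normD; apply: domB.
Qed.

(** Only sequences with a geometric Cauchy rate are considered: every Cauchy sequence has such a
    subsequence, and the sequences built below come with this rate. *)
Definition sip_complete : Prop := forall x_ : nat -> E,
  (forall n, X (x_ n)) ->
  (forall n k, (n <= k)%N -> N (x_ k - x_ n) <= 2^-1 ^+ n) ->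
  exists2 x, X x & N (x - x_ n) @[n --> \oo] --> 0.

End SemiNorm.
Arguments sip_norm {R E} ip f.
Arguments sip_complete {R E} X ip.

(** * Orthogonality and density *)

Section Density.
Context {R : realType} {E : lmodType R} {X : set E} {ip : E -> E -> R}.
Hypothesis sip : semi_inner_product X ip.
Local Notation N := (sip_norm ip).

(** Near 0 the linear term dominates. Dividing by [c + 1] instead of [c] in the test value of [a]
    also covers [c = 0]. *)
Lemma quadratic_ge0_eq0 (b c : R) : 0 <= c ->
  (forall a, 0 <= 2 * a * b + a ^+ 2 * c) -> b = 0.
Proof.
move=> c0 /(_ (- b / (c + 1))) h; apply/eqP; rewrite -sqrf_eq0 eq_le sqr_ge0 andbT.
have c1 : 0 < c + 1 by lra.
have e : 2 * (- b / (c + 1)) * b + (- b / (c + 1)) ^+ 2 * c =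
  - (b ^+ 2 * ((c + 2) / (c + 1) ^+ 2)) by field; rewrite gt_eqF.
move: h; rewrite e oppr_ge0 pmulr_lle0// divr_gt0 ?exprn_gt0//; lra.
Qed.

Lemma parallelogram f g h : X f -> X g -> X h ->
  ip (g - h) (g - h) + 4 * ip (f - 2^-1 *: (g + h)) (f - 2^-1 *: (g + h)) =
  2 * (ip (f - g) (f - g) + ip (f - h) (f - h)).
Proof.
move=> Xf Xg Xh; have Xgh := domD sip Xg Xh.
rewrite -scaleNr (ip_expand sip)// -(scaleN1r g) -(scaleN1r h).
rewrite !(ip_expand sip)// (ipDr sip)// (ipDl sip)// ?(ipDr sip)//.
by rewrite (sip_sym sip Xh Xg); field.
Qed.

(** The projection argument for a subspace [D] that need not be closed: a minimizing sequence in [D]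
    converges to some [x] in its closure, [f - x] is orthogonal to [D], hence null, and so the
    minimizing sequence approaches [f] itself. *)
Lemma dense_of_orthogonal (D : set E) : sip_complete X ip ->
  D `<=` X -> D 0 -> (forall a f g, D f -> D g -> D (a *: f + g)) ->
  (forall h, X h -> (forall d, D d -> ip h d = 0) -> N h = 0) ->
  forall f, X f -> forall e, 0 < e -> exists2 d, D d & N (f - d) < e.
Proof.
move=> cmp DX D0 DP orth f Xf.
have XfD d : D d -> X (f - d) by move=> Dd; apply: (domB sip) => //; exact: DX.
pose S := [set ip (f - d) (f - d) | d in D].
have S0 : S !=set0 by exists (ip (f - 0) (f - 0)), 0.
have Slb : has_lbound S.
  by exists 0 => _ [d Dd <-]; apply: (sip_ge0 sip); exact: XfD.
pose dl := inf S.
have dl_le d : D d -> dl <= ip (f - d) (f - d).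
  by move=> Dd; apply: ge_inf => //; exists d.
have dl0 : 0 <= dl.
  by apply: lb_le_inf => // _ [d Dd <-]; apply: (sip_ge0 sip); exact: XfD.
(* With this excess over the infimum, [parallelogram] bounds the squared distance of [d_ k] and
   [d_ n] by exactly [4^-1 ^+ n], the square of the rate in [sip_complete]. *)
have e0 n : 0 < 4^-1 * 4^-1 ^+ n :> R by rewrite mulr_gt0// ?exprn_gt0// invr_gt0.
have /choice[d_ hd] n : exists d, D d /\ ip (f - d) (f - d) < dl + 4^-1 * 4^-1 ^+ n.
  have /inf_adherent /(_ (conj S0 Slb))[_ [d Dd <-] h] := e0 n.
  by exists d.
have Dd n : D (d_ n) by have [] := hd n.
have Xd n : X (d_ n) by apply: DX.
have de n : ip (f - d_ n) (f - d_ n) < dl + 4^-1 * 4^-1 ^+ n by have [] := hd n.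
have [|x Xx xd] := cmp _ Xd.
  move=> n k nk; rewrite -(@ler_pXn2r _ 2) ?nnegrE ?sip_norm_ge0 ?exprn_ge0//.
  rewrite (sqr_sip_norm sip); last exact: (domB sip).
  have := parallelogram Xf (Xd k) (Xd n).
  have : dl <= ip (f - 2^-1 *: (d_ k + d_ n)) (f - 2^-1 *: (d_ k + d_ n)).
    apply: dl_le; rewrite -[2^-1 *: _]addr0; apply: (DP) => //.
    by rewrite -[d_ k]scale1r; apply: (DP).
  have := de n; have := de k.
  have : 4^-1 ^+ k <= 4^-1 ^+ n :> R.
    by apply: ler_wiXn2l => //; rewrite invf_le1// ler1n.
  have -> : (2^-1 ^+ n) ^+ 2 = 4^-1 ^+ n :> R.
    by rewrite exprAC; congr (_ ^+ _); field.
  lra.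
have Xfx : X (f - x) by apply: (domB sip).
have small e : 0 < e -> exists n, [/\ N (x - d_ n) < e & N (f - d_ n) < Num.sqrt dl + e].
  move=> ep.
  have l1 : \forall n \near \oo, N (x - d_ n) < e.
    move/cvgrPdist_lt : xd => /(_ _ ep); apply: filterS => n.
    by rewrite sub0r normrN ger0_norm// sip_norm_ge0.
  have l2 : \forall n \near \oo, 4^-1 ^+ n < e ^+ 2 :> R.
    have /cvgrPdist_lt/(_ _ (exprn_gt0 2 ep)) : (4^-1 ^+ n : R) @[n --> \oo] --> 0.
      by apply: cvg_expr; rewrite ger0_norm ?invr_ge0// invf_lt1// ltr1n.
    by apply: filterS => n; rewrite sub0r normrN ger0_norm// exprn_ge0.
  near \oo => n; exists n; split; first by near: n.
  rewrite -(@ltr_pXn2r _ 2) ?nnegrE ?sip_norm_ge0 ?addr_ge0 ?sqrtr_ge0// ?(ltW ep)//.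
  rewrite (sqr_sip_norm sip); last exact: XfD.
  apply: lt_le_trans (de n) _; rewrite sqrrD sqr_sqrtr// -addrA lerD2l.
  have h : 4^-1 ^+ n < e ^+ 2 by near: n.
  have : 0 <= Num.sqrt dl * e *+ 2 by rewrite mulrn_wge0// mulr_ge0 ?sqrtr_ge0// ltW.
  have : 0 <= 4^-1 ^+ n :> R by rewrite exprn_ge0.
  by move: h; lra.
have hx : N (f - x) <= Num.sqrt dl.
  apply/ler_addgt0Pr => e ep; have [|n [n1 n2]] := small (e / 2).
    by rewrite divr_gt0.
  have := sip_norm_tri sip Xf (Xd n) Xx.
  rewrite (sip_normB sip (Xd n))//; lra.
(* [f - x + a *: d] is the limit of [f - (d_ n - a *: d)], whose distance to 0 is at least the
   minimal one; so moving from [f - x] in a direction of [D] never shortens it. *)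
have h0 d : D d -> ip (f - x) d = 0.
  move=> Ddd; have Xdd := DX _ Ddd; apply: (@quadratic_ge0_eq0 _ (ip d d)).
    exact: (sip_ge0 sip).
  move=> a; have := ip_expand sip a Xfx Xdd.
  suff: dl <= ip (f - x + a *: d) (f - x + a *: d).
    have : ip (f - x) (f - x) <= dl.
      rewrite -(sqr_sip_norm sip)// -[leRHS]sqr_sqrtr//.
      by rewrite ler_pXn2r// ?nnegrE ?sip_norm_ge0 ?sqrtr_ge0.
    lra.
  have Xfa : X (f - x + a *: d) by apply: (domD sip) => //; apply: (domZ sip).
  rewrite -(sqr_sip_norm sip)// -[leLHS]sqr_sqrtr//.
  rewrite ler_pXn2r// ?nnegrE ?sip_norm_ge0 ?sqrtr_ge0//.
  apply/ler_addgt0Pr => e ep; have [n [n1 _]] := small _ ep.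
  have Dn : D (d_ n - a *: d).
    by rewrite addrC -scaleNr; apply: DP.
  have := dl_le _ Dn; rewrite -(sqr_sip_norm sip); last exact: XfD.
  rewrite -[leLHS]sqr_sqrtr// ler_pXn2r// ?nnegrE ?sip_norm_ge0 ?sqrtr_ge0//.
  move=> /le_trans; apply.
  have -> : f - (d_ n - a *: d) = (f - x + a *: d) + (x - d_ n).
    by rewrite opprB addrA [RHS]addrAC addrA addrAC subrK addrAC.
  apply: le_trans (sip_normD sip Xfa (domB sip Xx (Xd n))) _.
  by rewrite lerD2l ltW.
have hN := orth _ Xfx h0.
move=> e ep; have [|n [n1 _]] := small e => //; exists (d_ n) => //.
apply: le_lt_trans (sip_norm_tri sip Xf Xx (Xd n)) _.
by rewrite hN add0r.
Unshelve. all: by end_near. Qed.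

End Density.

(** * The uniform boundedness principle *)

Section UniformBoundedness.
Context {R : realType} {E : lmodType R} {X : set E} {ip : E -> E -> R}.
Hypothesis sip : semi_inner_product X ip.
Local Notation N := (sip_norm ip).

(* Baire's argument: nested balls on which the n-th selected seminorm is at
   least n shrink to a point where the seminorms are unbounded. *)
Lemma condensation_of_singularities {I : Type} (S : nat -> set I)
    (q : I -> E -> R) : sip_complete X ip ->
  (forall i f g, X f -> X g -> q i (f + g) <= q i f + q i g) ->
  (forall i a f, X f -> q i (a *: f) = `|a| * q i f) ->
  (forall i, exists M, forall f, X f -> q i f <= M * N f) ->
  (forall n B, exists2 i, S n i & exists2 f, X f & B * N f < q i f) ->
  exists2 x, X x & forall n, exists2 i, S n i & n%:R <= q i x.
Proof.
move=> cmp qD qZ qM qbig.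
have qN i f : X f -> q i (- f) = q i f.
  by move=> Xf; rewrite -scaleN1r qZ// normrN1 mul1r.
have step (n : nat) (s : E * R) : X s.1 -> 0 < s.2 -> exists s' : E * R,
    [/\ X s'.1, 0 < s'.2, s'.2 <= s.2 / 2, N (s'.1 - s.1) <= s.2 / 2 &
    exists2 i, S n i & forall y, X y -> N (y - s'.1) <= s'.2 -> n%:R <= q i y].
  case: s => x r /= Xx r0.
  have r20 : 0 < r / 2 by rewrite divr_gt0.
  have [i Si [f Xf qf]] := qbig n (n.+1%:R / (r / 2)).
  have [M hM] := qM i.
  have Nf0 : 0 < N f.
    rewrite lt_neqAle sip_norm_ge0 andbT; apply/eqP => Nf0.
    by have := hM _ Xf; move: qf; rewrite -Nf0 !mulr0; lra.
  pose xi := (r / 2 / N f) *: f.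
  have Xxi : X xi by apply: (domZ sip).
  have c0 : 0 < r / 2 / N f by rewrite divr_gt0.
  have Nxi : N xi = r / 2 by rewrite (sip_normZ sip)// gtr0_norm// divfK ?gt_eqF.
  have qxi : n.+1%:R <= q i xi.
    rewrite qZ// gtr0_norm// mulrAC ler_pdivlMr// [leRHS]mulrC -ler_pdivrMr//.
    by rewrite mulrAC ltW.
  (* Since [2 *: xi] is the difference of [x + xi] and [x - xi], the seminorm is at least [n.+1] at
     one of the two. *)
  have [x' [Xx' Nx' qx']] : exists x', [/\ X x', N (x' - x) <= r / 2 & n.+1%:R <= q i x'].
    have [h|h] := leP (n.+1%:R) (q i (x + xi)).
      exists (x + xi); split => //; first exact: (domD sip).
      by rewrite addrC addKr Nxi.
    exists (x - xi); split; first exact: (domB sip).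
      by rewrite addrC addKr (sip_normN sip)// Nxi.
    have : q i (2 *: xi) <= q i (x + xi) + q i (x - xi).
      have -> : 2 *: xi = (x + xi) + (- (x - xi)).
        by rewrite opprB addrC addrA subrK -mulr2n scaler_nat.
      have Xm := domB sip Xx Xxi.
      by rewrite -(qN _ (x - xi))// qD//; [exact: (domD sip)|exact: (domN sip)].
    by rewrite qZ// ger0_norm//; lra.
  (* On a ball of radius [M1^-1] the seminorm varies by at most 1, so [n.+1] at the centre leaves
     [n] on the whole ball. *)
  pose M1 := `|M| + 1; have M10 : 0 < M1 by rewrite ltr_wpDl.
  exists (x', Num.min (r / 2) M1^-1) => /=; split => //.
  - by rewrite lt_min r20 invr_gt0.
  - by rewrite ge_min lexx.
  exists i => // y Xy; rewrite le_min => /andP[_ yx'].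
  have Xd := domB sip Xx' Xy.
  have : q i x' <= q i y + q i (x' - y).
    by rewrite -[X in q i X <= _](subrK y) addrC qD.
  have : q i (x' - y) <= 1.
    apply: le_trans (hM _ Xd) _; rewrite (sip_normB sip)//.
    apply: (@le_trans _ _ (M1 * M1^-1)); last by rewrite divff// gt_eqF.
    apply: (@le_trans _ _ (M1 * N (y - x'))); last by rewrite ler_pM2l.
    by rewrite ler_wpM2r ?sip_norm_ge0// ler_wpDr// ler_norm.
  by move: qx'; rewrite -natr1; lra.
(* [F] has to be total for [choice]; the pair [(0, 0)] is a dummy for invalid balls. *)
have /choice[F hF] (ns : nat * (E * R)) : exists s', X ns.2.1 -> 0 < ns.2.2 ->
    [/\ X s'.1, 0 < s'.2, s'.2 <= ns.2.2 / 2, N (s'.1 - ns.2.1) <= ns.2.2 / 2 &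
    exists2 i, S ns.1 i & forall y, X y -> N (y - s'.1) <= s'.2 -> ns.1%:R <= q i y].
  have [Xx|nX] := pselect (X ns.2.1); last by exists (0, 0).
  have [r0|nr] := ltP 0 ns.2.2; last by exists (0, 0).
  by have [s' hs'] := step ns.1 _ Xx r0; exists s'.
pose s_ := fix s_ n : E * R := if n is n'.+1 then F (n', s_ n') else (0, 1).
have Xs n : X (s_ n).1 /\ 0 < (s_ n).2.
  by elim: n => [|n [Xn rn]] /=; [split => //; exact: (sip_dom0 sip)|
    have [] := hF (n, s_ n) Xn rn].
have hs n := hF (n, s_ n) (Xs n).1 (Xs n).2.
have r2 n : (s_ n).2 <= 2^-1 ^+ n.
  elim: n => [|n ih] /=; first by rewrite expr0.
  have [_ _ + _ _] := hs n => /le_trans; apply.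
  by rewrite exprSr ler_pM2r// invr_gt0.
(* The ball of index [k] lies inside the ball of index [n], so the limit belongs to every ball. *)
have sk n k : (n <= k)%N -> N ((s_ k).1 - (s_ n).1) <= (s_ n).2 - (s_ k).2.
  move=> /subnK <-; elim: (k - n)%N => [|j ih].
    by rewrite add0n !subrr (sip_norm0 sip).
  rewrite addSn; have [X1 _ h1 h2 _] := hs (j + n)%N.
  apply: le_trans (sip_norm_tri sip X1 (Xs (j + n)%N).1 (Xs n).1) _.
  by move: h1 h2 ih => /=; lra.
have [|n k nk|x Xx xs] := cmp (fun n => (s_ n).1).
- by move=> n; have [] := Xs n.
- by have := sk _ _ nk; have := r2 n; have := (Xs k).2; lra.
have xr n : N (x - (s_ n).1) <= (s_ n).2.
  apply/ler_addgt0Pr => e e0.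
  move/cvgrPdist_lt : xs => /(_ _ e0) xe.
  near \oo => k.
  have : N (x - (s_ k).1) < e.
    have : `|0 - N (x - (s_ k).1)| < e by near: k.
    by rewrite sub0r normrN ger0_norm// sip_norm_ge0.
  have nk : (n <= k)%N by near: k; exact: nbhs_infty_ge.
  have := sk _ _ nk; have := (Xs k).2.
  have := sip_norm_tri sip Xx (Xs k).1 (Xs n).1.
  lra.
exists x => // n; have [_ _ _ _ [i Si hi]] := hs n; exists i => //.
by apply: hi => //; exact: xr n.+1.
Unshelve. all: by end_near. Qed.

End UniformBoundedness.

(** * Lyapunov functions of semigroups *)

Section Evolution.
Context {R : realType}.

Lemma at_right0P (P : R -> Prop) : (\forall t \near 0^'+, P t) ->
  exists2 d, 0 < d & forall t, 0 < t -> t < d -> P t.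
Proof.
move=> /nbhs_ballP[d /= d0 h]; exists d => // t t0 td.
by apply: h => //; rewrite /ball/= sub0r normrN gtr0_norm.
Qed.

(** Induction along the real line on the bound [a r <= a 0 + e * r]: the condition from the left
    carries it to the supremum of the times up to which it holds, and the condition from the right
    pushes it beyond. *)
Lemma right_dini_nonincreasing (a : R -> R) (d : R) : 0 < d ->
  (forall t, 0 <= t < d -> forall e, 0 < e -> exists2 eta, 0 < eta &
     forall h, 0 < h < eta -> a (t + h) <= a t + e * h) ->
  (forall t, 0 < t <= d -> forall e, 0 < e -> exists2 eta, 0 < eta &
     forall h, 0 < h < eta -> h <= t -> a t <= a (t - h) + e) ->
  a d <= a 0.
Proof.
move=> d0 hr hl; apply/ler_addgt0Pr => e' e'0.
(* The allowed slope accumulates to [e'] at time [d]. *)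
pose e := e' / d; have e0 : 0 < e by rewrite divr_gt0.
pose S := [set s | 0 <= s <= d /\ forall r, 0 <= r <= s -> a r <= a 0 + e * r].
have S0 : S 0.
  split; first by rewrite lexx ltW.
  by move=> r /le_anti <-; rewrite mulr0 addr0.
have Sub : has_ubound S by exists d => s [/andP[]].
have Snb : has_sup S by split => //; exists 0.
pose s := sup S.
have s0 : 0 <= s by apply: ub_le_sup.
have sd : s <= d by apply: ge_sup; [exists 0|move=> r [/andP[]]].
have hlt r : 0 <= r -> r < s -> a r <= a 0 + e * r.
  move=> r0 /(sup_gt (proj1 Snb))[u [_ hu] ru]; apply: hu.
  by rewrite r0 ltW.
have hs : a s <= a 0 + e * s.
  have [->|sn0] := eqVneq s 0; first by rewrite mulr0 addr0.
  have sp : 0 < s by rewrite lt_neqAle eq_sym sn0.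
  apply/ler_addgt0Pr => c c0.
  have [|eta eta0 he] := hl s _ c c0; first by rewrite sp.
  pose h := Num.min (eta / 2) s.
  have h0 : 0 < h by rewrite lt_min sp divr_gt0.
  have h1 : h <= eta / 2 by rewrite ge_min lexx.
  have h2 : h <= s by rewrite ge_min lexx orbT.
  have := he h; rewrite h0/= => /(_ _ h2); have /[swap] /[apply] : h < eta by lra.
  move=> /le_trans; apply; rewrite lerD2r; apply: le_trans (hlt (s - h) _ _) _.
  - by rewrite subr_ge0.
  - by rewrite ltrBlDr ltrDl.
  - by rewrite lerD2l ler_pM2l// lerBlDr lerDl ltW.
have [sd'|ds] := ltP s d; last first.
  have <- : s = d by apply/le_anti; rewrite sd ds.
  apply: le_trans hs _; rewrite lerD2l /e mulrAC ler_pdivrMr// ler_pM2l//.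
have [|eta eta0 he] := hr s _ e e0; first by rewrite s0.
pose h := Num.min (eta / 2) (d - s).
have h0 : 0 < h by rewrite lt_min subr_gt0 sd' divr_gt0.
have h1 : h <= eta / 2 by rewrite ge_min lexx.
have h2 : h <= d - s by rewrite ge_min lexx orbT.
suff : S (s + h) by move=> /(ub_le_sup Sub); rewrite -/s; lra.
split; first by apply/andP; split; lra.
move=> r /andP[r0 rs]; have [rs'|sr] := leP r s.
  have [->//|nrs] := eqVneq r s.
  by apply: hlt => //; rewrite lt_neqAle nrs.
have := he (r - s); rewrite [s + _]addrC subrK => /(_ _) /le_trans; apply.
  by apply/andP; split; lra.
by move: hs; lra.
Qed.

Context {E : lmodType R} {X : set E} {ip : E -> E -> R}.
Hypothesis sip : semi_inner_product X ip.
Local Notation N := (sip_norm ip).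

(* Representatives that agree almost everywhere are distinct points, so every
   law only holds up to a vector of norm zero. *)
Record semigroup_mod_null (T : R -> E -> E) : Prop := SemigroupModNull {
  sg_dom : forall t f, 0 <= t -> X f -> X (T t f);
  sg_linear : forall t a f g, 0 <= t -> X f -> X g ->
    N (T t (a *: f + g) - (a *: T t f + T t g)) = 0;
  sg_bounded : forall t, 0 <= t -> exists M, forall f, X f -> N (T t f) <= M * N f;
  sg_0 : forall f, X f -> N (T 0 f - f) = 0;
  sg_add : forall s t f, 0 <= s -> 0 <= t -> X f ->
    N (T (s + t) f - T s (T t f)) = 0;
  sg_cont : forall f, X f -> N (T t f - f) @[t --> 0^'+] --> 0 }.

Definition sg_generator (T : R -> E -> E) f k : Prop :=
  [/\ X f, X k & N (t^-1 *: (T t f - f) - k) @[t --> 0^'+] --> 0].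

Variable T : R -> E -> E.
Hypothesis sg : semigroup_mod_null T.

Lemma norm_eq_mod f g : X f -> X g -> N (f - g) = 0 -> N f = N g.
Proof.
move=> Xf Xg fg; have := sip_norm_le sip Xf Xg; have := sip_norm_le sip Xg Xf.
by rewrite (sip_normB sip Xg)// fg; lra.
Qed.

Lemma sgX t f : 0 <= t -> X f -> X (T t f).
Proof. exact: (sg_dom sg). Qed.

(** Linearity of [T t] holds up to null vectors only, so its consequences are stated after taking
    norms. *)
Lemma sg_normB t f g : 0 <= t -> X f -> X g ->
  N (T t f - T t g) = N (T t (f - g)).
Proof.
move=> t0 Xf Xg; have Xfg := domB sip Xf Xg.
have XT := sgX t0 Xf; have XTg := sgX t0 Xg; have XTb := sgX t0 Xfg.
apply/esym/norm_eq_mod => //; first exact: (domB sip).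
have := sg_linear sg (-1) t0 Xg Xf; rewrite !scaleN1r.
by rewrite [- g + f]addrC [- T t g + _]addrC.
Qed.

Lemma sg_normZ t a f : 0 <= t -> X f -> N (T t (a *: f)) = `|a| * N (T t f).
Proof.
move=> t0 Xf; have Xaf := domZ sip a Xf; have XT := sgX t0 Xf.
have X0 := sip_dom0 sip; have XT0 := sgX t0 X0.
rewrite -(sip_normZ sip)//; apply: norm_eq_mod => //.
- exact: sgX.
- exact: (domZ sip).
have T0 : N (T t 0) = 0.
  have := sg_linear sg (-1) t0 X0 X0.
  by rewrite scaler0 addr0 scaleN1r addNr subr0.
have := sg_linear sg a t0 Xf X0; rewrite addr0 => h.
have XaT := domZ sip a XT.
have XTa := sgX t0 Xaf.
have := sip_norm_tri sip XTa (domD sip XaT XT0) XaT.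
rewrite h add0r [a *: T t f + _]addrC addrK T0.
by have := sip_norm_ge0 (ip := ip) (T t (a *: f) - a *: T t f); lra.
Qed.

Lemma sg_normD t f g : 0 <= t -> X f -> X g ->
  N (T t (f + g)) <= N (T t f) + N (T t g).
Proof.
move=> t0 Xf Xg; have := sg_linear sg 1 t0 Xf Xg; rewrite !scale1r => h.
have XT := sgX t0 Xf; have XTg := sgX t0 Xg.
have Xfg := domD sip Xf Xg; have XTfg := sgX t0 Xfg.
rewrite (norm_eq_mod XTfg (domD sip XT XTg) h).
exact: (sip_normD sip).
Qed.

(** If [T] were unbounded on every interval starting at 0, condensation of singularities would give
    one [x] and times tending to 0 along which [T t x] is unbounded, against strong continuity at
    0. *)
Lemma sg_locally_bounded : sip_complete X ip ->
  exists2 d, 0 < d & exists2 B, 0 <= B &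
    forall t f, 0 <= t <= d -> X f -> N (T t f) <= B * N f.
Proof.
move=> cmp; apply: contrapT => nb.
pose I := {t : R | 0 <= t}.
pose S (n : nat) := [set i : I | 0 < val i < n.+1%:R^-1].
pose q (i : I) f := N (T (val i) f).
have [||||x Xx hx] := @condensation_of_singularities _ _ _ _ sip I S q cmp.
- by move=> [t t0] f g Xf Xg; exact: sg_normD.
- by move=> [t t0] a f Xf; exact: sg_normZ.
- by move=> [t t0]; exact: (sg_bounded sg).
- move=> n B; apply: contrapT => nh; apply: nb.
  (* [n.+2] makes the inequality [t < n.+1%:R^-1] strict. The maximum with 1 settles [t = 0], which
     [S n] excludes and where [T t f] equals [f] up to a null vector. *)
  exists (n.+2%:R^-1); first by rewrite invr_gt0.
  exists (Num.max B 1); first by rewrite le_max ler01 orbT.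
  move=> t f /andP[t0 tn] Xf.
  have N0 := sip_norm_ge0 (ip := ip) f.
  have [->|tn0] := eqVneq t 0.
    rewrite (norm_eq_mod (sgX (lexx 0) Xf) Xf (sg_0 sg Xf)).
    by rewrite ler_peMl// le_max lexx orbT.
  rewrite leNgt; apply/negP => h; apply: nh.
  exists (exist _ t t0 : I).
    rewrite /S/= lt_neqAle eq_sym tn0 t0/=; apply: le_lt_trans tn _.
    by rewrite ltf_pV2 ?posrE// ltr_nat.
  exists f => //; apply: le_lt_trans h.
  by rewrite ler_wpM2r// le_max lexx.
have /cvgrPdist_lt/(_ _ ltr01)/at_right0P[d d0 hd] := sg_cont sg Xx.
near \oo => n.
have [[t t0] /= /andP[tp tn]] := hx n; rewrite /q/= => nq.
have : N (T t x - x) < 1.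
  have : `|0 - N (T t x - x)| < 1.
    apply: hd => //; apply: lt_trans tn _; near: n.
    by move: (d) d0 => e e0; exact: near_infty_natSinv_lt (PosNum e0).
  by rewrite sub0r normrN ger0_norm// sip_norm_ge0.
have := sip_norm_le sip (sgX t0 Xx) Xx.
have : N x + 1 < n%:R by near: n; exact: nbhs_infty_gtr.
lra.
Unshelve. all: by end_near. Qed.

(** [T h] and [T t] commute up to null vectors, both products being [T (t + h)], so the difference
    quotient of [T t f] is the image under the bounded [T t] of that of [f]. *)
Lemma sg_generator_invariant t f k : 0 <= t ->
  sg_generator T f k -> sg_generator T (T t f) (T t k).
Proof.
move=> t0 [Xf Xk fk]; split; [exact: sgX|exact: sgX|].
have [M hM] := sg_bounded sg t0.
have h0 : `|M| * N (h^-1 *: (T h f - f) - k) @[h --> 0^'+] --> 0.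
  by rewrite -[X in _ --> X](mulr0 `|M|); apply: cvgMr.
apply: (squeeze_cvgr _ (cvg_cst 0) h0); near=> h.
have hp : 0 < h by [].
rewrite sip_norm_ge0/=.
have Xh := sgX (ltW hp) Xf; have Xt := sgX t0 Xf; have Xtk := sgX t0 Xk.
have Xth := sgX t0 Xh; have Xht := sgX (ltW hp) Xt.
have Xd := domB sip Xh Xf; have Xhd := domZ sip h^-1 Xd.
have Xe := domB sip Xhd Xk.
have XTd := domB sip Xth Xt.
(* Replaces [T h (T t f)] by [T t (T h f)] inside the norm. *)
rewrite (@norm_eq_mod _ (h^-1 *: (T t (T h f) - T t f) - T t k)); last 3 first.
- by apply: (domB sip) => //; apply: (domZ sip); apply: (domB sip).
- by apply: (domB sip) => //; apply: (domZ sip).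
- have -> : h^-1 *: (T h (T t f) - T t f) - T t k -
    (h^-1 *: (T t (T h f) - T t f) - T t k) = h^-1 *: (T h (T t f) - T t (T h f)).
    rewrite opprB addrA subrK -scalerBr; congr (_ *: _).
    by rewrite opprB addrA subrK.
  rewrite (sip_normZ sip); last exact: (domB sip).
  have Xs := sgX (addr_ge0 t0 (ltW hp)) Xf.
  have a1 := sg_add sg (ltW hp) t0 Xf; have a2 := sg_add sg t0 (ltW hp) Xf.
  rewrite [h + t]addrC in a1.
  have := sip_norm_tri sip Xht Xs Xth.
  rewrite (sip_normB sip Xht Xs) a1 a2 addr0 => z.
  have -> : N (T h (T t f) - T t (T h f)) = 0.
    by apply/le_anti; rewrite z sip_norm_ge0.
  by rewrite mulr0.
apply: (@le_trans _ _ (N (T t (h^-1 *: (T h f - f) - k)))); last first.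
  apply: le_trans (hM _ Xe) _.
  by rewrite ler_wpM2r ?sip_norm_ge0// ler_norm.
have X1 : X (h^-1 *: (T t (T h f) - T t f)) by apply: (domZ sip).
have X2 := sgX t0 Xhd.
apply: le_trans (sip_norm_tri sip X1 X2 Xtk) _.
rewrite (sg_normB t0 Xhd Xk).
suff -> : N (h^-1 *: (T t (T h f) - T t f) - T t (h^-1 *: (T h f - f))) = 0.
  by rewrite add0r.
(* [sg_linear] scales only one of its two terms: [l1] takes care of [- h^-1 *: f], and the remaining
   [h^-1 *: T h f] is handled in [l3] as a scaled term plus 0. *)
have l1 := sg_linear sg (- h^-1) t0 Xf (domZ sip h^-1 Xh).
have l2 := sg_linear sg h^-1 t0 Xh (sip_dom0 sip).
have X0 := sip_dom0 sip; have XT0 := sgX t0 X0.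
have T00 : N (T t 0) = 0 by rewrite -(scale0r 0) sg_normZ// normr0 mul0r.
have X3 := sgX t0 (domZ sip h^-1 Xh).
have X4 := domZ sip h^-1 Xth.
have X5 := domZ sip (- h^-1) Xt.
rewrite addr0 in l2.
have l3 : N (h^-1 *: T t (T h f) - T t (h^-1 *: T h f)) = 0.
  apply/le_anti; rewrite sip_norm_ge0 andbT.
  have := sip_norm_tri sip X4 (domD sip X4 XT0) X3.
  rewrite (sip_normB sip (domD sip X4 XT0))// l2 addr0 opprD addrA subrr sub0r.
  by rewrite (sip_normN sip)// T00.
apply/le_anti; rewrite sip_norm_ge0 andbT.
have := sip_norm_tri sip X1 (domD sip X5 X3) X2.
have e : h^-1 *: (T h f - f) = - h^-1 *: f + h^-1 *: T h f.
  by rewrite scalerBr scaleNr addrC.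
rewrite (sip_normB sip (domD sip X5 X3) X2) [X in N (T t X - _)]e l1 addr0; move=> /le_trans; apply.
rewrite scalerBr [in X in N X]scaleNr opprD opprK addrA subrK.
by rewrite l3.
Unshelve. all: by end_near. Qed.

End Evolution.

(** * Decrease of a Lyapunov function along orbits *)

Section Lyapunov.
Context {R : realType} {E : lmodType R} {X : set E} {ip : E -> E -> R}.
Hypothesis sip : semi_inner_product X ip.
Local Notation N := (sip_norm ip).
Variable T : R -> E -> E.
Hypothesis sg : @semigroup_mod_null R E X ip T.
(** [P] stands for the gradient of [phi], and [phi_le] is the upper Taylor estimate of a function
    with Lipschitz gradient. *)
Variables (phi : E -> R) (P : E -> E).
Hypothesis PX : forall f, X f -> X (P f).
Hypothesis NP : forall f, X f -> N (P f) <= N f.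
Hypothesis phi_le : forall f g, X f -> X g ->
  phi g <= phi f + ip (g - f) (P f) + N (g - f) ^+ 2.

Lemma lyapunov_dist f g : X f -> X g ->
  phi g <= phi f + N (g - f) * (N f + N (g - f)).
Proof.
move=> Xf Xg; apply: le_trans (phi_le Xf Xg) _.
rewrite mulrDr -expr2 addrA lerD2r lerD2l.
have Xd := domB sip Xg Xf.
apply: le_trans (ler_norm _) _.
apply: le_trans (cauchy_schwarz sip Xd (PX Xf)) _.
by rewrite ler_wpM2l ?sip_norm_ge0// NP.
Qed.

Lemma lyapunov_mod f g : X f -> X g -> N (g - f) = 0 -> phi g <= phi f.
Proof.
by move=> Xf Xg h; have := lyapunov_dist Xf Xg; rewrite h mul0r addr0.
Qed.

Hypothesis dissipative : forall f k, sg_generator (X := X) (ip := ip) T f k -> ip k (P f) <= 0.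

Lemma lyapunov_generator d B f k : 0 < d -> 0 <= B ->
  (forall t f, 0 <= t <= d -> X f -> N (T t f) <= B * N f) ->
  sg_generator (X := X) (ip := ip) T f k -> phi (T d f) <= phi f.
Proof.
move=> d0 B0 hB fk; have [Xf Xk _] := fk.
apply: (@le_trans _ _ (phi (T 0 f))); last first.
  by apply: lyapunov_mod => //; [exact: (sg_dom sg)|exact: (sg_0 sg)].
apply: (@right_dini_nonincreasing _ (fun t => phi (T t f)) d) => //.
- move=> t /andP[t0 td] e e0.
  have [Xu Xv uv] := sg_generator_invariant sip sg t0 fk.
  have dis := dissipative (sg_generator_invariant sip sg t0 fk).
  set u := T t f in Xu uv dis *; set v := T t k in Xv uv dis *.
  (* With [w] the error of the difference quotient, [T h u - u] is [h *: (v + w)]. After division by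
     [h], [phi_le] leaves [ip v (P u) <= 0] and the errors [N w * N u] and [h * N (v + w) ^+ 2]; for
     [N w] and [h] below 1 and [e / C] these add up to at most [e]. *)
  pose C := N u + (N v + 1) ^+ 2 + 1.
  have Nu := sip_norm_ge0 (ip := ip) u; have Nv := sip_norm_ge0 (ip := ip) v.
  have C0 : 1 <= C by rewrite /C lerDr addr_ge0// exprn_ge0//; lra.
  have Cp : 0 < C by lra.
  have ec0 : 0 < Num.min 1 (e / C) by rewrite lt_min ltr01 divr_gt0.
  move/cvgrPdist_lt : uv => /(_ _ ec0)/at_right0P[d1 d10 hd1].
  pose eta := Num.min d1 (Num.min 1 (e / C)).
  exists eta; first by rewrite lt_min d10.
  move=> h /andP[h0]; rewrite !lt_min => /andP[hd1' /andP[h1 hC]].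
  have := hd1 _ h0 hd1'; rewrite sub0r normrN ger0_norm ?sip_norm_ge0//.
  rewrite lt_min => /andP[w1 wC].
  have Xh := sgX sg (ltW h0) Xu.
  have Xd := domB sip Xh Xu.
  have Xw := domB sip (domZ sip h^-1 Xd) Xv.
  set w := h^-1 *: (T h u - u) - v in w1 wC Xw.
  have dE : T h u - u = h *: (v + w).
    by rewrite /w [v + _]addrC subrK scalerA divff ?scale1r// gt_eqF.
  have -> : t + h = h + t by rewrite addrC.
  apply: (@le_trans _ _ (phi (T h u))).
    apply: lyapunov_mod => //; first by apply: (sgX sg) => //; rewrite addr_ge0 // ltW.
    exact: (sg_add sg (ltW h0) t0 Xf).
  apply: le_trans (phi_le Xu Xh) _.
  have Xvw := domD sip Xv Xw.
  rewrite -addrA lerD2l dE (ipZl sip)//; last exact: PX.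
  rewrite (sip_normZ sip)// gtr0_norm// exprMn.
  rewrite (ipDl sip)//; last exact: PX.
  rewrite [h ^+ 2]expr2 -mulrA -mulrDr [e * h]mulrC ler_pM2l//.
  have b1 : ip w (P u) <= N w * N u.
    apply: le_trans (ler_norm _) _; apply: le_trans (cauchy_schwarz sip Xw (PX Xu)) _.
    by rewrite ler_wpM2l ?sip_norm_ge0// NP.
  have b2 : h * N (v + w) ^+ 2 <= e / C * (N v + 1) ^+ 2.
    apply: ler_pM; rewrite ?exprn_ge0 ?sip_norm_ge0//; [exact: ltW|exact: ltW|].
    rewrite ler_pXn2r ?nnegrE ?sip_norm_ge0//; last by lra.
    by have := sip_normD sip Xv Xw; lra.
  have b3 : N w * N u <= e / C * N u by rewrite ler_wpM2r// ltW.
  have eC : e / C * C = e by rewrite divfK// gt_eqF.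
  have : 0 <= e / C by rewrite divr_ge0 ?ltW.
  by move: eC; rewrite {2}/C !mulrDr mulr1; lra.
- move=> t /andP[t0 td] e e0.
  have Nf := sip_norm_ge0 (ip := ip) f.
  (* Up to a null vector, [T t f] is [T (t - h) (T h f)], at distance at most [B * N (T h f - f)]
     from [T (t - h) f]. [C] bounds the factor by which [lyapunov_dist] multiplies
     [N (T h f - f)]. *)
  pose C := B * (B * N f + B + 1) + 1.
  have C0 : 1 <= C by rewrite /C lerDr mulr_ge0// !addr_ge0// mulr_ge0.
  have Cp : 0 < C by lra.
  have ec0 : 0 < Num.min 1 (e / C) by rewrite lt_min ltr01 divr_gt0.
  have /cvgrPdist_lt/(_ _ ec0)/at_right0P[d1 d10 hd1] := sg_cont sg Xf.
  exists d1 => // h /andP[h0 hd] ht.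
  have := hd1 _ h0 hd; rewrite sub0r normrN ger0_norm ?sip_norm_ge0//.
  rewrite lt_min => /andP[w1 wC].
  have th0 : 0 <= t - h by rewrite subr_ge0.
  have thd : t - h <= d by lra.
  have Xh := sgX sg (ltW h0) Xf; have Xth := sgX sg th0 Xf.
  have Xthh := sgX sg th0 Xh.
  suff : phi (T t f) <= phi (T (t - h) (T h f)) + 0.
    rewrite addr0 => /le_trans; apply.
    apply: le_trans (lyapunov_dist Xth Xthh) _; rewrite lerD2l.
    rewrite (sg_normB sip sg th0 Xh Xf).
    have Xd := domB sip Xh Xf.
    have th : 0 <= t - h <= d by rewrite th0.
    have c1 := hB _ _ th Xd; have c2 := hB _ _ th Xf.
    have Nd := sip_norm_ge0 (ip := ip) (T h f - f).
    apply: (@le_trans _ _ (B * (e / C) * (B * N f + B * 1))).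
      apply: ler_pM; rewrite ?addr_ge0 ?sip_norm_ge0//.
        by apply: le_trans c1 _; rewrite ler_wpM2l// ltW.
      by rewrite lerD// (le_trans c1)// ler_wpM2l// ltW.
    have eC : e / C * C = e by rewrite divfK// gt_eqF.
    have eC0 : 0 <= e / C by rewrite divr_ge0 ?ltW.
    rewrite -[leRHS]eC mulrAC mulrC ler_wpM2l// /C mulr1.
    have : 0 <= B * 1 by rewrite mulr1.
    by rewrite mulrDr; lra.
  rewrite addr0; apply: lyapunov_mod => //; first exact: (sgX sg (ltW t0) Xf).
  have := sg_add sg th0 (ltW h0) Xf; rewrite subrK //.
Qed.

Theorem lyapunov_semigroup : sip_complete X ip ->
  (forall f, X f -> forall e, 0 < e ->
    exists g k, sg_generator (X := X) (ip := ip) T g k /\ N (f - g) < e) ->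
  forall t f, 0 <= t -> X f -> phi (T t f) <= phi f.
Proof.
move=> cmp dense.
have [d d0 [B B0 hB]] := sg_locally_bounded sip sg cmp.
have loc s f : 0 < s <= d -> X f -> phi (T s f) <= phi f.
  move=> /andP[s0 sd] Xf; apply/ler_addgt0Pr => e e0.
  have Nf := sip_norm_ge0 (ip := ip) f.
  (* The two summands before 1 bound the costs of replacing [T s f] by [T s g] and [g] by [f],
     relative to the distance of [f] and [g]. *)
  pose C := B * (B * (N f + 1) + B) + (N f + 1) + 1.
  have NB : 0 <= B * (N f + 1) by rewrite mulr_ge0//; lra.
  have NBB : 0 <= B * (B * (N f + 1) + B) by rewrite mulr_ge0// addr_ge0.
  have Cp : 0 < C by rewrite /C; lra.
  have ec0 : 0 < Num.min 1 (e / C) by rewrite lt_min ltr01 divr_gt0.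
  have [g [k [gk]]] := dense _ Xf _ ec0; rewrite lt_min => /andP[w1 wC].
  have [Xg Xk _] := gk.
  have Xd := domB sip Xf Xg.
  have XTf := sgX sg (ltW s0) Xf; have XTg := sgX sg (ltW s0) Xg.
  have sd' : 0 <= s <= d by rewrite (ltW s0).
  have hg : phi (T s g) <= phi g.
    apply: (@lyapunov_generator s B g k) => //.
    move=> t h /andP[t0 ts] Xh; apply: hB => //.
    by rewrite t0 (le_trans ts).
  have c1 := lyapunov_dist XTg XTf; have c2 := lyapunov_dist Xf Xg.
  rewrite (sg_normB sip sg (ltW s0) Xf Xg) in c1.
  rewrite (sip_normB sip Xg Xf) in c2.
  have c3 := hB _ _ sd' Xd; have c4 := hB _ _ sd' Xg.
  have Ng : N g <= N f + 1.
    by have := sip_norm_le sip Xg Xf; rewrite (sip_normB sip Xg Xf); lra.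
  have Nd := sip_norm_ge0 (ip := ip) (f - g).
  have c5 : N (T s (f - g)) * (N (T s g) + N (T s (f - g))) <=
      B * (e / C) * (B * (N f + 1) + B * 1).
    apply: ler_pM; rewrite ?addr_ge0 ?sip_norm_ge0//.
      by apply: le_trans c3 _; rewrite ler_wpM2l// ltW.
    apply: lerD; first by apply: le_trans c4 _; rewrite ler_wpM2l.
    by apply: le_trans c3 _; rewrite ler_wpM2l// ltW.
  have c6 : N (f - g) * (N f + N (f - g)) <= e / C * (N f + 1).
    apply: ler_pM; rewrite ?addr_ge0 ?sip_norm_ge0//; first exact: ltW.
    by rewrite lerD2l ltW.
  have eC : e / C * C = e by rewrite divfK// gt_eqF.
  have eC0 : 0 <= e / C by rewrite divr_ge0 ?ltW.
  have c7 : B * (e / C) * (B * (N f + 1) + B * 1) = e / C * (B * (B * (N f + 1) + B)).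
    by ring.
  move: eC; rewrite {2}/C !(mulrDr (e / C)) mulr1.
  by lra.
move=> t f t0 Xf; have [->|tn0] := eqVneq t 0.
  by apply: lyapunov_mod => //; [exact: (sgX sg (lexx 0) Xf)|exact: (sg_0 sg)].
have tp : 0 < t by rewrite lt_neqAle eq_sym tn0.
(* The local bound covers times up to [d] only, so [t] is cut into [n.+1] equal steps of length at
   most [d]. *)
have [n hn] : exists n, t / d <= n.+1%:R.
  by exists (Num.trunc (t / d)); rewrite ltW// truncnS_gt.
pose s := t / n.+1%:R.
have s0 : 0 < s by rewrite divr_gt0.
have sd : 0 < s <= d.
  by rewrite s0/= ler_pdivrMr// mulrC -ler_pdivrMr.
have it : forall j, phi (T (j.+1%:R * s) f) <= phi f.
  elim=> [|j ih]; first by rewrite mul1r; exact: loc.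
  have j0 : 0 <= j.+1%:R * s by rewrite mulr_ge0// ltW.
  have Xj := sgX sg j0 Xf.
  have -> : j.+2%:R * s = s + j.+1%:R * s by rewrite -[j.+2%:R]natr1 mulrDl mul1r addrC.
  apply: le_trans ih; apply: le_trans (loc _ _ sd Xj).
  apply: lyapunov_mod; [exact: (sgX sg (ltW s0) Xj)| |].
    by apply: (sgX sg) => //; rewrite addr_ge0// ltW.
  exact: (sg_add sg (ltW s0) j0 Xf).
by have := it n; rewrite mulrC divfK.
Qed.

End Lyapunov.

(** * Integration on the unit interval *)

Section UnitInterval.
Context {R : realType}.
Notation mu := (@lebesgue_measure R).
Notation I01 := (`]0, 1[%classic : set R).
Implicit Types (f g h : R -> R).

Definition mfun01 f : Prop := measurable_fun (`]0, 1[ : set R) f.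
Definition intg01 f : Prop := mu.-integrable `]0, 1[ (EFin \o f).
Definition int01 f : R := Rintegral mu `]0, 1[ f.
Definition sqint01 f : Prop := mfun01 f /\ intg01 (fun x => f x ^+ 2).

Let ae_muF : Filter (almost_everywhere mu).
Proof. exact: ae_filter_ringOfSetsType. Qed.

Lemma ae01S (P Q : R -> Prop) : (forall x, x \in `]0, 1[ -> P x -> Q x) ->
  ae01 P -> ae01 Q.
Proof.
move=> PQ; apply: (@filterS _ _ ae_muF).
by move=> x Px xI; apply: PQ => //; exact: Px.
Qed.

Lemma ae01W (P : R -> Prop) : (forall x, x \in `]0, 1[ -> P x) -> ae01 P.
Proof. by move=> h; apply: aeW => x; exact: h. Qed.

Lemma ae01I (P Q : R -> Prop) : ae01 P -> ae01 Q -> ae01 (fun x => P x /\ Q x).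
Proof.
apply: (@filterS2 _ _ ae_muF).
by move=> x Px Qx xI; split; [exact: Px|exact: Qx].
Qed.

Lemma ae01S2 (P Q S : R -> Prop) :
  (forall x, x \in `]0, 1[ -> P x -> Q x -> S x) ->
  ae01 P -> ae01 Q -> ae01 S.
Proof. by move=> PQ hP hQ; move: (ae01I hP hQ); apply: ae01S => x xI []; exact: PQ. Qed.

Lemma measurable01 : measurable I01.
Proof. exact: measurable_itv. Qed.
Hint Resolve measurable01 : core.

Lemma mu01 : mu I01 = 1%:E.
Proof. by rewrite lebesgue_measure_itv/= lte_fin ltr01 oppr0 adde0. Qed.

Lemma intg01_mfun f : intg01 f -> mfun01 f.
Proof. by move=> /integrableP[/measurable_EFinP]. Qed.

Lemma intg01D f g : intg01 f -> intg01 g -> intg01 (fun x => f x + g x).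
Proof. by move=> hf hg; apply: (integrableD _ hf hg). Qed.

Lemma intg01N f : intg01 f -> intg01 (fun x => - f x).
Proof. by move=> hf; apply: (integrableN hf). Qed.

Lemma intg01B f g : intg01 f -> intg01 g -> intg01 (fun x => f x - g x).
Proof. by move=> hf hg; apply: intg01D => //; exact: intg01N. Qed.

Lemma intg01Z a f : intg01 f -> intg01 (fun x => a * f x).
Proof. by move=> hf; apply: (integrableZl _ a hf). Qed.

Lemma intg01_norm f : intg01 f -> intg01 (fun x => `|f x|).
Proof. exact: integrable_norm. Qed.

Lemma intg01_le_ae f g : mfun01 f -> ae01 (fun x => `|f x| <= g x) ->
  intg01 g -> intg01 f.
Proof.
move=> mf fg hg; have mg := intg01_mfun hg.
apply/integrableP; split; first exact/measurable_EFinP.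
move/integrableP : (hg) => [_]; apply: le_lt_trans.
apply: ae_ge0_le_integral => //.
- by do 2 apply: measurableT_comp => //.
- by do 2 apply: measurableT_comp => //.
- apply: (@filterS _ _ ae_muF _ _ _ fg) => x /= fgx xI; rewrite lee_fin.
  by rewrite (le_trans (fgx xI))// ler_norm.
Qed.

Lemma intg01_le f g : mfun01 f -> (forall x, x \in `]0, 1[ -> `|f x| <= g x) ->
  intg01 g -> intg01 f.
Proof. by move=> mf fg; apply: intg01_le_ae => //; exact: ae01W. Qed.

Lemma intg01_cst a : intg01 (fun=> a).
Proof.
by apply: measurable_bounded_integrable => //=; [rewrite mu01 ltry|
  exists `|a|; split; [exact: num_real|move=> x /ltW ax t _ /=]].
Qed.

Lemma intg01_bounded f M : mfun01 f -> (forall x, x \in `]0, 1[ -> `|f x| <= M) ->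
  intg01 f.
Proof. by move=> mf fM; apply: (intg01_le mf fM); exact: intg01_cst. Qed.

Lemma intg01_bddM f g M : mfun01 g ->
  (forall x, x \in `]0, 1[ -> `|g x| <= M) -> intg01 f -> intg01 (fun x => f x * g x).
Proof.
move=> mg gM hf; apply: (@intg01_le _ (fun x => M * `|f x|)).
- by apply: measurable_funM => //; exact: intg01_mfun.
- by move=> x xI; rewrite normrM mulrC ler_wpM2r// gM.
- exact/intg01Z/intg01_norm.
Qed.

Lemma int01_ae f g : mfun01 f -> mfun01 g -> ae01 (fun x => f x = g x) ->
  int01 f = int01 g.
Proof.
move=> mf mg fg; rewrite /int01 /Rintegral; congr fine.
apply: ae_eq_integral => //; [exact/measurable_EFinP|exact/measurable_EFinP|].
by apply: (@filterS _ _ ae_muF _ _ _ fg) => x /= h xI; rewrite h.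
Qed.

Lemma int01_eq f g : (forall x, x \in `]0, 1[ -> f x = g x) -> int01 f = int01 g.
Proof. by move=> fg; apply: eq_Rintegral => x /[!inE]; exact: fg. Qed.

Lemma int01D f g : intg01 f -> intg01 g ->
  int01 (fun x => f x + g x) = int01 f + int01 g.
Proof. exact: RintegralD. Qed.

Lemma int01B f g : intg01 f -> intg01 g ->
  int01 (fun x => f x - g x) = int01 f - int01 g.
Proof. exact: RintegralB. Qed.

Lemma int01Z a f : intg01 f -> int01 (fun x => a * f x) = a * int01 f.
Proof. exact: RintegralZl. Qed.

Lemma int01N f : intg01 f -> int01 (fun x => - f x) = - int01 f.
Proof.
move=> hf; rewrite -mulN1r -int01Z//; apply: int01_eq => x _.
by rewrite mulN1r.
Qed.

Lemma int01_ge0 f : (forall x, x \in `]0, 1[ -> 0 <= f x) -> 0 <= int01 f.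
Proof. by move=> f0; apply: Rintegral_ge0 => x; exact: f0. Qed.

Lemma int01_ge0_ae f : mfun01 f -> ae01 (fun x => 0 <= f x) -> 0 <= int01 f.
Proof.
move=> mf f0; rewrite (@int01_ae f (fun x => `|f x|))//.
- by apply: int01_ge0.
- exact: measurableT_comp.
- by apply: ae01S f0 => x _ h; rewrite ger0_norm.
Qed.

Lemma le_int01_ae f g : intg01 f -> intg01 g -> ae01 (fun x => f x <= g x) ->
  int01 f <= int01 g.
Proof.
move=> hf hg fg; rewrite -subr_ge0 -int01B//; apply: int01_ge0_ae.
  by apply: intg01_mfun; exact: intg01B.
by apply: ae01S fg => x _; rewrite subr_ge0.
Qed.

Lemma le_int01 f g : intg01 f -> intg01 g ->
  (forall x, x \in `]0, 1[ -> f x <= g x) -> int01 f <= int01 g.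
Proof. by move=> hf hg fg; apply: le_int01_ae => //; exact: ae01W. Qed.

Lemma le_norm_int01 f : intg01 f -> `|int01 f| <= int01 (fun x => `|f x|).
Proof. exact: le_normr_Rintegral. Qed.

Lemma int01_eq0_ae f : intg01 f -> (forall x, x \in `]0, 1[ -> 0 <= f x) ->
  int01 f = 0 -> ae01 (fun x => f x = 0).
Proof.
move=> hf f0 h; have mf := intg01_mfun hf.
have /(ae_eq_integral_abs mu measurable01) : measurable_fun I01 (EFin \o f).
  exact/measurable_EFinP.
move=> [+ _]; have -> : (\int[mu]_(x in `]0%R, 1%R[) `|(EFin \o f) x| = 0)%E.
  transitivity (\int[mu]_(x in `]0%R, 1%R[) (f x)%:E)%E.
    by apply: eq_integral => x /[!inE] xI; rewrite gee0_abs// lee_fin f0.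
  rewrite -[LHS]fineK; first by rewrite -/(Rintegral mu I01 f) -/(int01 f) h.
  exact: integrable_fin_num.
by move=> /(_ erefl); apply: (@filterS _ _ ae_muF) => x /= + xI => /(_ xI)[].
Qed.

Lemma sqint01_mfun f : sqint01 f -> mfun01 f. Proof. by case. Qed.

Lemma norm_mul_le_sqrD (a b : R) : `|a * b| <= a ^+ 2 + b ^+ 2.
Proof.
have h1 := sqr_ge0 (a - b); have h2 := sqr_ge0 (a + b).
have h3 := sqr_ge0 a; have h4 := sqr_ge0 b.
rewrite ler_norml; apply/andP; split; nra.
Qed.

Lemma sqint01M f g : sqint01 f -> sqint01 g -> intg01 (fun x => f x * g x).
Proof.
move=> [mf hf] [mg hg]; apply: (intg01_le _ _ (intg01D hf hg)).
  exact: measurable_funM.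
by move=> x _; exact: norm_mul_le_sqrD.
Qed.

Lemma sqint01_le_ae f g : mfun01 f -> ae01 (fun x => `|f x| <= `|g x|) ->
  sqint01 g -> sqint01 f.
Proof.
move=> mf fg [mg hg]; split => //; apply: (intg01_le_ae _ _ hg).
  exact: measurable_funX.
apply: ae01S fg => x _ fg.
by rewrite normrX -[leRHS]ger0_norm ?sqr_ge0// normrX ler_pXn2r// nnegrE.
Qed.

Lemma sqint01D f g : sqint01 f -> sqint01 g -> sqint01 (fun x => f x + g x).
Proof.
move=> Hf Hg; have [mf hf] := Hf; have [mg hg] := Hg; split.
  exact: measurable_funD.
have := intg01D (intg01D hf hg) (intg01Z 2 (sqint01M Hf Hg)).
congr intg01; apply/funext => x; rewrite sqrrD -mulr_natl; ring.
Qed.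

Lemma sqint01Z a f : sqint01 f -> sqint01 (fun x => a * f x).
Proof.
move=> [mf hf]; split; first exact: measurable_funM.
by have := intg01Z (a ^+ 2) hf; congr intg01; apply/funext => x; rewrite exprMn.
Qed.

Lemma sqint01N f : sqint01 f -> sqint01 (fun x => - f x).
Proof.
move=> [mf hf]; split; first exact: measurableT_comp.
by move: hf; congr intg01; apply/funext => x; rewrite sqrrN.
Qed.

Lemma sqint01B f g : sqint01 f -> sqint01 g -> sqint01 (fun x => f x - g x).
Proof. by move=> hf hg; apply: sqint01D => //; exact: sqint01N. Qed.

Lemma sqint01_bounded f M : mfun01 f -> (forall x, x \in `]0, 1[ -> `|f x| <= M) ->
  sqint01 f.
Proof.
move=> mf fM; split => //; apply: (@intg01_bounded _ (M ^+ 2)).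
  exact: measurable_funX.
move=> x xI; rewrite normrX ler_pXn2r ?nnegrE ?fM//.
by rewrite (le_trans _ (fM _ xI)).
Qed.

Lemma sqint01_cst a : sqint01 (fun=> a).
Proof. by apply: (@sqint01_bounded _ `|a|) => //; exact: measurable_cst. Qed.

Lemma sqint01_intg f : sqint01 f -> intg01 f.
Proof.
move=> hf; have := sqint01M hf (sqint01_cst 1).
by congr intg01; apply/funext => x; rewrite mulr1.
Qed.

Lemma sqint01_eq0_ae f : sqint01 f -> int01 (fun x => f x * f x) = 0 ->
  ae01 (fun x => f x = 0).
Proof.
move=> hf /(int01_eq0_ae (sqint01M hf hf)) h.
have : ae01 (fun x => f x * f x = 0).
  by apply: h => x _; rewrite -expr2 sqr_ge0.
by apply: ae01S => x _ /eqP; rewrite mulf_eq0 orbb => /eqP.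
Qed.

(** Weighted arithmetic-geometric mean inequality. On an interval of length 1 it turns the bound
    [K * 4^-1 ^+ n] on squares into the summable L^1 bound [(1 + K) * 2^-1 ^+ n]. *)
Lemma norm_le_geometric n (z : R) : `|z| <= 2^-1 ^+ n + 2 ^+ n * z ^+ 2.
Proof.
have p0 : 0 < 2 ^+ n :> R by rewrite exprn_gt0.
have e : 2 ^+ n * 2^-1 ^+ n = 1 :> R by rewrite -exprMn divff ?expr1n.
have h1 := sqr_ge0 (1 - 2 ^+ n * `|z|).
have h2 : 0 <= 2 ^+ n * `|z| by rewrite mulr_ge0// ltW.
rewrite -(ler_pM2l p0) mulrDr e mulrA -expr2.
move: h1; rewrite sqrrB expr1n mul1r exprMn real_normK ?num_real// -mulr_natl.
lra.
Qed.

(** Riesz-Fischer: the sum of the absolute increments is integrable, hence finite almost everywhere,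
    so the sequence converges pointwise there; Fatou's lemma then bounds the distance to the
    limit. *)
Lemma sqint01_complete (x_ : nat -> R -> R) K : (forall n, sqint01 (x_ n)) ->
  (forall n k, (n <= k)%N ->
    int01 (fun t => (x_ k t - x_ n t) ^+ 2) <= K * 4^-1 ^+ n) ->
  exists2 x, sqint01 x & forall n, int01 (fun t => (x t - x_ n t) ^+ 2) <= K * 4^-1 ^+ n.
Proof.
move=> hx hK.
have hD n k : sqint01 (fun t => x_ k t - x_ n t) by exact: sqint01B.
pose y n t := `|x_ n.+1 t - x_ n t|.
have my n : mfun01 (y n) by apply: measurableT_comp => //; exact: sqint01_mfun.
have iy n : (\int[mu]_(t in I01) (y n t)%:E <= ((1 + K) * 2^-1 ^+ n)%:E)%E.
  have h1 : intg01 (y n) by apply/intg01_norm/sqint01_intg.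
  rewrite -[leLHS]fineK; last exact: integrable_fin_num.
  rewrite lee_fin.
  apply: (@le_trans _ _ (int01 (fun t => 2^-1 ^+ n + 2 ^+ n * (x_ n.+1 t - x_ n t) ^+ 2))).
    apply: le_int01 => //.
      by apply: intg01D; [exact: intg01_cst|apply: intg01Z; have [] := hD n n.+1].
    by move=> t _; exact: norm_le_geometric.
  rewrite int01D//; [|exact: intg01_cst|by apply: intg01Z; have [] := hD n n.+1].
  rewrite int01Z; last by have [] := hD n n.+1.
  rewrite /int01 Rintegral_cst// [X in _ * fine X]mu01 mulr1 mulrDl mul1r lerD2l.
  have p0 : 0 < 2 ^+ n :> R by rewrite exprn_gt0.
  have := hK n n.+1 (leqnSn n); rewrite -(ler_pM2l p0) => /le_trans; apply.
  rewrite mulrCA ler_wpM2l//.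
    have := hK 0 0 (leqnn 0); rewrite expr0 mulr1; apply: le_trans.
    by apply: int01_ge0 => t _; exact: sqr_ge0.
  by rewrite -exprMn; have -> : 2 / 4 = 2^-1 :> R by field.
have K0 : 0 <= K.
  have := hK 0 0 (leqnn 0); rewrite expr0 mulr1; apply: le_trans.
  by apply: int01_ge0 => t _; exact: sqr_ge0.
pose Y t := (\sum_(0 <= n <oo) (y n t)%:E)%E.
have y0 n t : I01 t -> (0 <= (y n t)%:E)%E by rewrite lee_fin /y.
have mY : measurable_fun I01 Y.
  apply: ge0_emeasurable_sum => //; first by move=> n t tI _; exact: y0.
  by move=> n _; apply/measurable_EFinP; exact: my.
have Y0 t : I01 t -> (0 <= Y t)%E.
  by move=> tI; apply: nneseries_ge0 => n _ _; exact: y0.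
have iY : mu.-integrable I01 Y.
  apply/integrableP; split => //.
  have -> : (\int[mu]_(t in I01) `|Y t| = \int[mu]_(t in I01) Y t)%E.
    by apply: eq_integral => t /[!inE] tI; rewrite gee0_abs// Y0.
  rewrite integral_nneseries//; last by move=> n; apply/measurable_EFinP; exact: my.
  apply: (@le_lt_trans _ _ (\sum_(0 <= n <oo) ((1 + K) * 2^-1 ^+ n)%:E)%E).
    apply: lee_nneseries => n _; last exact: iy.
    by move=> _; apply: integral_ge0 => t tI; exact: y0.
  have : (\sum_(0 <= k < n) ((1 + K) * 2^-1 ^+ k)%:E)%E @[n --> \oo] --> ((1 + K) * 2)%:E.
    under eq_cvg do rewrite sumEFin.
    apply: cvg_EFin; first by apply: nearW.
    have := @cvg_geometric_series R (1 + K) 2^-1.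
    rewrite ger0_norm ?invr_ge0// invf_lt1// ltr1n => /(_ isT).
    by rewrite (_ : 1 - 2^-1 = 2^-1 :> R) ?invrK//; field.
  by move/cvg_lim => -> //; rewrite ltry.
have aeY : ae01 (fun t => cvgn (fun n => x_ n t)).
  have : {ae mu, forall t, I01 t -> Y t \is a fin_num}.
    by apply: integrable_ae => //.
  apply: (@filterS _ _ ae_muF) => t /= + tI => /(_ tI) fY.
  have cy : cvgn (series (fun n => y n t)).
    apply: nondecreasing_is_cvgn.
      by apply/nondecreasing_seqP => n; rewrite seriesSr lerDl /y.
    exists (fine (Y t)) => _ [n _ <-].
    rewrite -lee_fin fineK// /series/= -sumEFin.
    by apply: nneseries_lim_ge => k _ _; exact: y0.
  have : cvgn (series (fun n => x_ n.+1 t - x_ n t)) by apply: normed_cvg.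
  move=> cz; rewrite (_ : (fun n => x_ n t) =
    (fun n => x_ 0%N t + series (telescope (fun n => x_ n t)) n)).
    by apply: is_cvgD => //; exact: is_cvg_cst.
  by apply/funext => n; exact: (eq_sum_telescope (fun n => x_ n t)).
(* The upper limit is measurable and defined everywhere; it is the limit wherever the sequence
   converges. *)
pose x t := fine (limn_esup (fun n => (x_ n t)%:E)).
have mx : mfun01 x.
  apply: (@measurableT_comp _ _ _ _ _ _ fine); first exact: fine_measurable.
  by apply: measurable_fun_limn_esup => n; apply/measurable_EFinP; exact: sqint01_mfun.
have xE : ae01 (fun t => x_ n t @[n --> \oo] --> x t).
  apply: ae01S aeY => t _ /cvg_ex[l xl].
  suff -> : x t = l by [].
  suff /cvg_limn_einf_sup[_ e] : (x_ n t)%:E @[n --> \oo] --> l%:E by rewrite /x e.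
  by apply: cvg_EFin => //; exact: nearW.
have fatou_x n : (\int[mu]_(t in I01) ((x t - x_ n t) ^+ 2)%:E <= (K * 4^-1 ^+ n)%:E)%E.
  (* The shift by [n] keeps every index at least [n], so that [hK] bounds all the integrals in
     Fatou's lemma. *)
  pose F k t := ((x_ (k + n)%N t - x_ n t) ^+ 2)%:E.
  have mF k : measurable_fun I01 (F k).
    by apply/measurable_EFinP/measurable_funX; exact: (sqint01_mfun (hD n (k + n)%N)).
  have F0 k t : I01 t -> (0 <= F k t)%E by rewrite lee_fin sqr_ge0.
  apply: (@le_trans _ _ (\int[mu]_(t in I01) limn_einf (F ^~ t))%E).
    apply: ae_ge0_le_integral => //.
    - by move=> t _; rewrite lee_fin sqr_ge0.
    - by apply/measurable_EFinP/measurable_funX/measurable_funB => //; exact: sqint01_mfun.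
    - move=> t tI; rewrite limn_einf_lim; apply: lime_ge.
        exact: is_cvg_einfs.
      by apply: nearW => k; apply: le_ereal_inf_tmp => _ [l _ <-]; exact: F0.
    - rewrite (_ : (fun t => limn_einf (F ^~ t)) =
        (fun t => - limn_esup (fun k => - F k t))%E); last first.
        by apply/funext => t; rewrite -limn_einfN; congr limn_einf;
          apply/funext => k; rewrite /comp oppeK.
      apply: measurableT_comp => //; apply: measurable_fun_limn_esup => k.
      by apply: measurableT_comp => //; exact: mF.
    - move: xE; apply: (@filterS _ _ ae_muF) => t /= h tI.
      suff /cvg_limn_einf_sup[-> _] : F k t @[k --> \oo] --> ((x t - x_ n t) ^+ 2)%:E.
        by [].
      apply: cvg_EFin; first exact: nearW.
      apply: (@cvgM _ _ _ _ (fun k => x_ (k + n)%N t - x_ n t) (fun k => x_ (k + n)%N t - x_ n t));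
      apply: cvgB; [|exact: cvg_cst| |exact: cvg_cst];
      by rewrite (cvg_shiftn n (fun k => x_ k t)); exact: h.
  apply: (@le_trans _ _ (limn_einf (fun k => \int[mu]_(t in I01) F k t)%E)).
    by apply: fatou.
  rewrite limn_einf_lim; apply: lime_le; first exact: is_cvg_einfs.
  apply: nearW => k; apply: (@le_trans _ _ (\int[mu]_(t in I01) F k t)%E).
    by apply: ereal_inf_lbound; exists k => /=.
  rewrite -[leLHS]fineK; last first.
    by apply: integrable_fin_num => //; have [] := hD n (k + n)%N.
  by rewrite lee_fin; apply: hK; rewrite leq_addl.
have sx n : sqint01 (fun t => x t - x_ n t).
  split; first by apply: measurable_funB => //; exact: sqint01_mfun.
  apply/integrableP; split.
    by apply/measurable_EFinP/measurable_funX/measurable_funB => //; exact: sqint01_mfun.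
  apply: le_lt_trans (ltry (K * 4^-1 ^+ n)); apply: le_trans (fatou_x n).
  rewrite le_eqVlt; apply/orP; left; apply/eqP; apply: eq_integral => t _ /=.
  by rewrite ger0_norm ?sqr_ge0.
exists x => [|n].
  have := sqint01D (sx 0%N) (hx 0%N); congr sqint01; apply/funext => t.
  by rewrite subrK.
rewrite -lee_fin fineK//; apply: integrable_fin_num => //.
by have [] := sx n.
Qed.
End UnitInterval.

(** * Test functions and weak derivatives *)

Section TestFunctions.
Context {R : realType}.
Notation mu := (@lebesgue_measure R).
Implicit Types (f g h : R -> R).

Definition C1fun f f1 : Prop := (forall x : R, is_derive x (1 : R) f (f1 x)) /\ continuous f1.

Definition supp01 f : Prop := exists a b : R, [/\ 0 < a, b < 1 &
  forall x, x \notin `[a, b] -> f x = 0].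

Definition C2c f : Prop := exists f1 f2, [/\ C1fun f f1, C1fun f1 f2,
  supp01 f & supp01 f1].

Lemma C1fun_continuous f f1 : C1fun f f1 -> continuous f.
Proof.
move=> [df _] x; apply: differentiable_continuous; apply/derivable1_diffP.
exact: (@ex_derive _ _ _ _ _ _ _ (df x)).
Qed.

Lemma C1fun_derive1 f f1 : C1fun f f1 -> derive1 f = f1.
Proof.
by move=> [df _]; apply/funext => x; rewrite derive1E; exact: (@derive_val _ _ _ _ _ _ _ (df x)).
Qed.

Lemma C1fun_test f f1 : C1fun f f1 -> supp01 f -> test_function f.
Proof.
move=> fC sf; split => //; first by move=> x; have [h _] := fC; exact: (@ex_derive _ _ _ _ _ _ _ (h x)).
by rewrite (C1fun_derive1 fC); have [] := fC.
Qed.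

Lemma test_C1fun f : test_function f -> C1fun f (derive1 f) /\ supp01 f.
Proof.
move=> [df cf sf]; split; last exact: sf.
split; last exact: cf.
move=> x.
by rewrite derive1E; exact: derivableP (df x).
Qed.

Lemma C2c_test f : C2c f -> test_function f.
Proof. by move=> [f1 [f2 [h _ sf _]]]; exact: C1fun_test h sf. Qed.

Lemma C1fun_cst a : C1fun (fun=> a) (fun=> 0).
Proof. by split=> [x|x]; [exact: is_derive_cst|exact: cst_continuous]. Qed.

Lemma C1funD f f1 g g1 : C1fun f f1 -> C1fun g g1 ->
  C1fun (fun x => f x + g x) (fun x => f1 x + g1 x).
Proof.
move=> [df cf] [dg cg]; split=> [x|x]; first exact: is_deriveD.
by apply: cvgD; [exact: cf|exact: cg].
Qed.

Lemma C1funM f f1 g g1 : C1fun f f1 -> C1fun g g1 ->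
  C1fun (fun x => f x * g x) (fun x => f x * g1 x + g x * f1 x).
Proof.
move=> hf hg; have [df cf] := hf; have [dg cg] := hg; split=> [x|x].
  exact: is_deriveM.
have c1 := C1fun_continuous hf; have c2 := C1fun_continuous hg.
by apply: cvgD; apply: cvgM; [exact: c1|exact: cg|exact: c2|exact: cf].
Qed.

Lemma C1funZ a f f1 : C1fun f f1 -> C1fun (fun x => a * f x) (fun x => a * f1 x).
Proof.
move=> hf; have := C1funM (C1fun_cst a) hf; congr C1fun.
by apply/funext => x; rewrite mulr0 addr0.
Qed.

Lemma supp01D f g : supp01 f -> supp01 g -> supp01 (fun x => f x + g x).
Proof.
move=> [a [b [a0 b1 hf]]] [c [d [c0 d1 hg]]].
exists (Num.min a c), (Num.max b d); split.
- by rewrite lt_min a0.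
- by rewrite gt_max b1.
move=> x; rewrite in_itv/= ge_min le_max negb_and !negb_or => h.
by case/orP : h => /andP[/negPf h1 /negPf h2];
  rewrite hf ?hg ?addr0// in_itv/= ?h1 ?h2 ?andbF.
Qed.

Lemma supp01Ml f g : supp01 f -> supp01 (fun x => f x * g x).
Proof.
move=> [a [b [a0 b1 hf]]]; exists a, b; split => // x xab.
by rewrite hf// mul0r.
Qed.

Lemma supp01Mr f g : supp01 f -> supp01 (fun x => g x * f x).
Proof.
move=> [a [b [a0 b1 hf]]]; exists a, b; split => // x xab.
by rewrite hf// mulr0.
Qed.

Lemma C2cD f g : C2c f -> C2c g -> C2c (fun x => f x + g x).
Proof.
move=> [f1 [f2 [h1 h2 s1 s2]]] [g1 [g2 [k1 k2 t1 t2]]].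
exists (fun x => f1 x + g1 x), (fun x => f2 x + g2 x).
by split; [exact: C1funD|exact: C1funD|exact: supp01D|exact: supp01D].
Qed.

Lemma C2cZ a f : C2c f -> C2c (fun x => a * f x).
Proof.
move=> [f1 [f2 [h1 h2 s1 s2]]].
exists (fun x => a * f1 x), (fun x => a * f2 x).
by split; [exact: C1funZ|exact: C1funZ|exact: supp01Mr|exact: supp01Mr].
Qed.

Lemma C2cM f g : C2c f -> C2c g -> C2c (fun x => f x * g x).
Proof.
move=> [f1 [f2 [h1 h2 s1 s2]]] [g1 [g2 [k1 k2 t1 t2]]].
exists (fun x => f x * g1 x + g x * f1 x),
  (fun x => (f x * g2 x + g1 x * f1 x) + (g x * f2 x + f1 x * g1 x)).
by split; [exact: C1funM|apply: C1funD; exact: C1funM|exact: supp01Ml|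
  apply: supp01D; exact: supp01Mr].
Qed.

Lemma C2c0 : C2c (fun=> 0).
Proof.
have s : supp01 (fun=> 0 : R) by exists 2^-1, 2^-1; split => //; lra.
by exists (fun=> 0), (fun=> 0); split => //; exact: C1fun_cst.
Qed.

Definition pospart (x : R) := Num.max x 0.

Lemma pospart_continuous : continuous pospart.
Proof. by move=> x; apply: continuous_max; [exact: cvg_id|exact: cvg_cst]. Qed.

Lemma is_derive_pospart n (x : R) :
  is_derive x 1 (fun s => pospart s ^+ n.+2) (n.+2%:R * pospart x ^+ n.+1).
Proof.
have [x0|x0|->] := ltgtP x 0.
- have -> : pospart x = 0 by rewrite /pospart max_r// ltW.
  rewrite expr0n/= mulr0.
  have H : is_derive x (1 : R) (cst 0 : R -> R) (0 : R) by exact: is_derive_cst.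
  apply: near_eq_is_derive H.
  near=> y; rewrite /pospart max_r ?expr0n//.
  by near: y; exact: lt_le_nbhsl.
- have -> : pospart x = x by rewrite /pospart max_l// ltW.
  have H : is_derive x (1 : R) (fun s : R => s ^+ n.+2) (n.+2%:R * x ^+ n.+1).
    have := @is_deriveX R R id n.+2 x 1 1 (is_derive_id _ _).
    by rewrite exprfctE /= [_%:A]mulr1.
  apply: near_eq_is_derive H; near=> y; rewrite /pospart max_l//.
  by near: y; exact: lt_le_nbhsr.
have p0 : pospart 0 = 0 by rewrite /pospart max_l.
rewrite p0 expr0n/= mulr0.
(* At 0 the two branches meet; the exponent is at least 2, so the quotient is at most [|h|] in
   absolute value when [|h| <= 1]. *)
suff h : h^-1 *: (((fun s => pospart s ^+ n.+2) \o shift 0) (h *: 1) - pospart 0 ^+ n.+2) @[h --> (0:R)^'] --> (0 : R).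
  apply: DeriveDef; first by apply/cvg_ex; exists 0.
  exact: (cvg_lim _ h).
apply/cvgr0Pnorm_le => e e0; near=> h.
rewrite /= addr0 p0 expr0n/= subr0 [_ *: 1]mulr1.
have h0 : h != 0 by near: h; exact: nbhs_dnbhs_neq.
have h1 : `|pospart h| <= `|h|.
  rewrite /pospart; have [_|_] := leP h 0; rewrite ?normr0//.
have he : `|h| <= Num.min 1 e.
  near: h; apply: dnbhs0_le; rewrite lt_min ltr01 e0//.
rewrite [_ *: _]/(_ * _) normrM normfV normrX ler_pdivrMl ?normr_gt0//.
apply: (@le_trans _ _ (`|h| ^+ n.+2)); first by rewrite ler_pXn2r// nnegrE.
rewrite exprS ler_wpM2l// exprS; move: he; rewrite le_min => /andP[hh1 hhe].
apply: (@le_trans _ _ `|h|) => //; rewrite ler_piMr// exprn_ile1//.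
Unshelve. all: by end_near. Qed.

Lemma C1fun_comp f f1 g g1 : C1fun f f1 -> C1fun g g1 ->
  C1fun (fun x => f (g x)) (fun x => f1 (g x) * g1 x).
Proof.
move=> [df cf] hg; have [dg cg] := hg; split=> x.
  exact: (@is_derive1_comp _ f g x _ _ (df (g x)) (dg x)).
apply: cvgM; last exact: cg.
apply: (@continuous_comp _ _ _ g f1); [exact: (C1fun_continuous hg)|exact: cf].
Qed.

Lemma C1fun_affine c d : C1fun (fun x => c * x + d) (fun=> c).
Proof.
have C1id : C1fun (fun x => x) (fun=> 1).
  by split=> x; [exact: is_derive_id|exact: cst_continuous].
have := C1funD (C1funZ c C1id) (C1fun_cst d); congr C1fun.
by apply/funext => x; rewrite mulr1 addr0.
Qed.

Lemma C1fun_pospart n :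
  C1fun (fun x => pospart x ^+ n.+2) (fun x => n.+2%:R * pospart x ^+ n.+1).
Proof.
split=> [x|x]; first exact: is_derive_pospart.
apply: cvgM; first exact: cvg_cst.
apply: (@continuous_comp _ _ _ pospart (fun y => y ^+ n.+1)).
  exact: pospart_continuous.
exact: exprn_continuous.
Qed.

Lemma pospart_ge0 x : 0 <= pospart x.
Proof. by rewrite /pospart le_max lexx orbT. Qed.

Lemma pospart_eq0 x : x <= 0 -> pospart x = 0.
Proof. by move=> x0; rewrite /pospart max_r. Qed.

Lemma pospart_id x : 0 <= x -> pospart x = x.
Proof. by move=> x0; rewrite /pospart max_l. Qed.

(** The cube is the lowest power of the positive part that is of class C^2. *)
Definition bump a b x : R := pospart (x - a) ^+ 3 * pospart (b - x) ^+ 3.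

Lemma C2c_bump a b : 0 < a -> b < 1 -> C2c (bump a b).
Proof.
move=> a0 b1.
pose f := fun x : R => pospart (1 * x + - a).
pose g := fun x : R => pospart (-1 * x + b).
have P3 := C1fun_pospart 1; have P2 := C1funZ 3 (C1fun_pospart 0).
have hf := C1fun_comp P3 (C1fun_affine 1 (- a)).
have hg := C1fun_comp P3 (C1fun_affine (-1) b).
have hf' := C1funM (C1fun_comp P2 (C1fun_affine 1 (- a))) (C1fun_cst 1).
have hg' := C1funM (C1fun_comp P2 (C1fun_affine (-1) b)) (C1fun_cst (-1)).
have M1 := C1funM hf hg.
have M2 := C1funD (C1funM hf hg') (C1funM hg hf').
have bE : bump a b = fun x => f x ^+ 3 * g x ^+ 3.
  by apply/funext => x; rewrite /bump /f /g mul1r mulN1r addrC [- x + b]addrC.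
have z x : x \notin `[a, b] -> f x = 0 \/ g x = 0.
  rewrite in_itv/= negb_and -!ltNge => /orP[h|h]; [left|right].
    by rewrite /f pospart_eq0// mul1r; lra.
  by rewrite /g pospart_eq0// mulN1r; lra.
rewrite bE; eexists; eexists; split; [exact: M1|exact: M2| |];
  exists a, b; split => // x /z; rewrite -/(f x) -/(g x) => -[->|->];
  by rewrite /= !expr0n/= !(mulr0, mul0r, addr0).
Qed.

Lemma bump_ge0 a b x : 0 <= bump a b x.
Proof. by rewrite mulr_ge0// exprn_ge0// pospart_ge0. Qed.

Lemma bump_gt0 a b x : a < x -> x < b -> 0 < bump a b x.
Proof.
move=> ax xb; rewrite mulr_gt0// exprn_gt0// pospart_id ?subr_gt0// subr_ge0 ltW//.
Qed.

Lemma bump_out a b x : x \notin `]a, b[ -> bump a b x = 0.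
Proof.
rewrite in_itv/= negb_and -!leNgt /bump => /orP[h|h].
  by rewrite [pospart (x - a)]pospart_eq0 ?subr_le0// expr0n mul0r.
by rewrite [pospart (b - x)]pospart_eq0 ?subr_le0// expr0n mulr0.
Qed.

Lemma bump_le1 a b x : 0 <= a -> b <= 1 -> bump a b x <= 1.
Proof.
move=> a0 b1; have [xab|xab] := boolP (x \in `]a, b[); last by rewrite bump_out.
move: xab; rewrite in_itv/= => /andP[ax xb].
rewrite /bump; apply: mulr_ile1; rewrite ?exprn_ge0 ?pospart_ge0//;
  by rewrite exprn_ile1 ?pospart_ge0// pospart_id; lra.
Qed.

(* As n grows this converges boundedly to the indicator of ]a, b[. *)
Lemma C2c_bump_iter a b n : 0 < a -> b < 1 -> C2c (fun x => 1 - (1 - bump a b x) ^+ n).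
Proof.
move=> a0 b1; have hb := C2c_bump a0 b1; elim: n => [|n ih].
  by have := C2c0; congr C2c; apply/funext => x; rewrite expr0 subrr.
have := C2cD ih (C2cD hb (C2cZ (-1) (C2cM hb ih))); congr C2c.
by apply/funext => x; rewrite exprS; ring.
Qed.

Lemma continuous_mfun01 f : continuous f -> mfun01 f.
Proof.
by move=> cf; apply: measurable_funTS; exact: continuous_measurable_fun.
Qed.

Lemma C2c_continuous f : C2c f -> continuous f.
Proof. by move=> [f1 [f2 [h _ _ _]]]; exact: C1fun_continuous h. Qed.

Lemma int01_dominated (f_ : nat -> R -> R) f h : (forall n, mfun01 (f_ n)) -> mfun01 f ->
  (forall x, x \in `]0, 1[ -> f_ n x @[n --> \oo] --> f x) ->
  intg01 h -> (forall n x, x \in `]0, 1[ -> `|f_ n x| <= h x) ->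
  int01 (f_ n) @[n --> \oo] --> int01 f.
Proof.
move=> mf_ mf f_f ih fh.
have [] := @dominated_convergence _ _ _ mu `]0%R, 1%R[%classic (measurable_itv _)
  (fun n x => (f_ n x)%:E) (EFin \o f) (EFin \o h) => //.
- by move=> n; apply/measurable_EFinP; exact: mf_.
- exact/measurable_EFinP.
- apply: aeW => x xI; apply: cvg_EFin; first exact: nearW.
  exact: f_f.
- by apply: aeW => x n xI; rewrite lee_fin; exact: fh.
move=> if_ _ cf; apply: fine_cvg; rewrite -/(int01 f).
suff -> : (int01 f)%:E = (\int[mu]_(x in `]0%R, 1%R[) (EFin \o f) x)%E by [].
by rewrite /int01 /Rintegral fineK//; exact: integrable_fin_num.
Qed.

Lemma int01_patch_eq0 g a b : intg01 g ->
  (forall phi, C2c phi -> int01 (fun x => g x * phi x) = 0) ->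
  0 < a -> b < 1 -> int01 (g \_ `]a, b[) = 0.
Proof.
move=> ig h a0 b1.
pose f_ n x := g x * (1 - (1 - bump a b x) ^+ n).
have mg := intg01_mfun ig.
have b01 x : 0 <= 1 - bump a b x <= 1.
  apply/andP; split; last by rewrite gerBl bump_ge0.
  by rewrite subr_ge0 bump_le1// ltW.
have : int01 (f_ n) @[n --> \oo] --> int01 (g \_ `]a, b[).
  apply: (@int01_dominated _ _ (fun x => `|g x|)).
  - move=> n; apply: measurable_funM; first exact: mg.
    exact: (continuous_mfun01 (C2c_continuous (C2c_bump_iter n a0 b1))).
  - apply/measurable_restrict => //.
    by apply: measurable_funS mg.
  - move=> x _; rewrite patchE; case: ifPn => xab.
      rewrite -[X in _ --> X]mulr1; apply: cvgM; first exact: cvg_cst.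
      rewrite -[X in _ --> X]subr0; apply: cvgB; first exact: cvg_cst.
      have bx : 0 < bump a b x.
        by move: xab; rewrite inE/= in_itv/= => /andP[]; exact: bump_gt0.
      apply: cvg_expr; have /andP[b0 _] := b01 x.
      by rewrite ger0_norm// gtrBl.
    rewrite (_ : (fun n => f_ n x) = fun=> 0); first exact: cvg_cst.
    apply/funext => n; rewrite /f_ bump_out ?subr0 ?expr1n ?subrr ?mulr0//.
    by move: xab; rewrite notin_setE/= => /negP.
  - exact: intg01_norm.
  - move=> n x _; rewrite normrM ler_piMr//.
    have /andP[c0 c1] := b01 x.
    have d0 : 0 <= (1 - bump a b x) ^+ n <= 1 by rewrite exprn_ge0// exprn_ile1.
    by rewrite ger0_norm; lra.
have -> : (fun n => int01 (f_ n)) = fun=> 0.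
  by apply/funext => n; apply: h; exact: C2c_bump_iter.
by move=> /(cvg_unique _ (cvg_cst 0)) <-.
Qed.

End TestFunctions.

(** * The fundamental lemma, primitives and the chain rule *)

Section WeakDerivatives.
Context {R : realType}.
Notation mu := (@lebesgue_measure R).
Notation I01 := (`]0, 1[%classic : set R).
Implicit Types (f g h phi : R -> R).

Lemma patch01_integrable g (A : set R) : measurable A -> intg01 g ->
  mu.-integrable A (EFin \o (g \_ I01)).
Proof.
move=> mA ig; rewrite -restrict_EFin.
apply/integrable_restrict => //.
by apply: integrableS ig => //; exact: measurableI.
Qed.

(** The integral of [g] over every interval inside []0, 1[] vanishes, so its indefinite integral is
    constant there, while by Lebesgue differentiation the derivative is [g] almost everywhere. *)
Lemma fundamental_lemma g : intg01 g ->
  (forall phi, C2c phi -> int01 (fun x => g x * phi x) = 0) ->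
  ae01 (fun x => g x = 0).
Proof.
move=> ig h; set G := g \_ I01.
have iG A : measurable A -> mu.-integrable A (EFin \o G).
  by move=> mA; exact: patch01_integrable.
have lG : locally_integrable [set: R] G.
  by apply: integrable_locally => //; exact: iG.
have := FTC1Ny (fun y => iG _ (measurable_itv _)) lG.
set F := fun x => _.
have FE x y : 0 < x -> x <= y -> y < 1 -> F y = F x.
  move=> x0 xy y1; apply/eqP; rewrite -subr_eq0 /F Rintegral_itvB//; last by apply: iG.
  rewrite -Rintegral_itv_bndo_bndc; last by apply: iG.
  rewrite -Rintegral_mkcondr setIidl; last first.
    by apply: subset_itvW => //; exact: ltW.
  have := int01_patch_eq0 ig h x0 y1.
  rewrite /int01 -Rintegral_mkcondr setIidr; first by move=> ->.
  by apply: subset_itvW => //; exact: ltW.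
apply: (@filterS _ _ (ae_filter_ringOfSetsType mu)) => x [_ /= dF] xI.
have [x0 x1] : 0 < x /\ x < 1 by move: xI; rewrite in_itv/= => /andP.
have <- : G x = g x by rewrite /G patchE mem_set.
rewrite -dF derive1E -(@near_eq_derive _ _ _ (cst (F x))) ?derive_cst//.
near=> y; have [xy|yx] := leP x y.
  by apply/esym/FE => //; near: y; exact: lt_nbhsl.
by apply: FE; [near: y; exact: lt_nbhsr|exact: ltW|].
Unshelve. all: by end_near. Qed.

Lemma within01_bounded f : {within `[0, 1], continuous f} ->
  exists2 M, 0 <= M & forall x, x \in `[0, 1] -> `|f x| <= M.
Proof.
move=> cf.
have [M [Mr hM]] := compact_bounded (continuous_compact cf (@segment_compact _ 0 1)).
exists (`|M| + 1) => [|x xI]; first by rewrite addr_ge0.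
by apply: (hM (`|M| + 1)); [rewrite (le_lt_trans (ler_norm _))// ltrDl|exists x].
Qed.

Lemma continuous_within f (A : set R) : continuous f -> {within A, continuous f}.
Proof. by move=> cf; exact: continuous_subspaceT. Qed.

Lemma subitv01 x : x \in `]0, 1[ -> x \in (`[0, 1] : interval R).
Proof. by move=> /subset_itv_oo_cc. Qed.

Lemma within01_mfun f : {within `[0, 1], continuous f} -> mfun01 f.
Proof.
move=> cf; have mf : measurable_fun (`[0, 1] : set R) f.
  by apply: subspace_continuous_measurable_fun.
by apply: measurable_funS mf => //; exact: subset_itv_oo_cc.
Qed.

Lemma within01_intg f : {within `[0, 1], continuous f} -> intg01 f.
Proof.
move=> cf; have [M _ hM] := within01_bounded cf.
by apply: (@intg01_bounded _ _ M) => [|x /subitv01]; [exact: within01_mfun|exact: hM].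
Qed.

Lemma continuous_intg01 f : continuous f -> intg01 f.
Proof. by move=> cf; exact/within01_intg/continuous_within. Qed.

Lemma intg01M_within f g : {within `[0, 1], continuous f} -> intg01 g ->
  intg01 (fun x => g x * f x).
Proof.
move=> cf ig; have [M _ hM] := within01_bounded cf.
by apply: (@intg01_bddM _ _ _ M) => // [|x /subitv01];
  [exact: within01_mfun|exact: hM].
Qed.

Lemma supp01_out (f : R -> R) : supp01 f -> f = f \_ I01.
Proof.
move=> [a [b [a0 b1 h]]]; apply/funext => x; rewrite patchE.
case: ifPn => //; rewrite notin_setE/= => /negP xI; apply: h.
apply: contra xI; rewrite !in_itv/= => /andP[ax xb].
by rewrite (lt_le_trans a0 ax) (le_lt_trans xb b1).
Qed.

(** The zero mean makes the primitive from the left vanish again to the right of the support. *)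
Lemma test_primitive f : continuous f -> supp01 f -> int01 f = 0 ->
  exists2 phi, test_function phi & derive1 phi = f.
Proof.
move=> cf sf f0; have [a [b [a0 b1 h]]] := sf.
have iA A : measurable A -> mu.-integrable A (EFin \o f).
  by move=> mA; rewrite (supp01_out sf); apply/patch01_integrable/continuous_intg01.
pose phi x := Rintegral mu `]-oo, x] f.
have dphi x : derivable phi x 1 /\ derive1 phi x = f x.
  apply: (@continuous_FTC1 _ f -oo%O x (x + 1)).
  - by rewrite ltrDl.
  - exact: iA.
  - by rewrite ltNyr.
  - exact: cf.
have ephi : derive1 phi = f by apply/funext => x; have [] := dphi x.
exists phi => //; split.
- by move=> x; have [] := dphi x.
- by rewrite ephi.
exists a, b; split => // x; rewrite in_itv/= negb_and -!ltNge => /orP[xa|bx].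
  rewrite /phi (@eq_Rintegral _ _ _ _ _ (cst 0)); last first.
    move=> y; rewrite inE/= in_itv/= => yx; apply: h.
    by rewrite in_itv/= negb_and -ltNge (le_lt_trans yx).
  by rewrite Rintegral_cst// mul0r.
rewrite /phi Rintegral_mkcond -[RHS]f0 /int01 [RHS]Rintegral_mkcond.
congr Rintegral; rewrite -(supp01_out sf).
apply/funext => y; rewrite patchE; case: ifPn => //.
rewrite notin_setE/= in_itv/= => /negP; rewrite -ltNge => xy.
by rewrite h// in_itv/= negb_and -!ltNge (lt_trans bx xy) orbT.
Qed.

(** Subtracting from [e] the multiple of a fixed [rho] with the same integral leaves the derivative
    of a test function. Hence [w - C] is orthogonal to every [e], where [C] is the average of [w]
    weighted by [rho]. *)
Lemma du_bois_reymond w : intg01 w ->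
  (forall phi, test_function phi -> int01 (fun x => w x * derive1 phi x) = 0) ->
  exists C, ae01 (fun x => w x = C).
Proof.
move=> iw hw.
(* rho exists: otherwise the fundamental lemma would give 1 = 0 almost everywhere. *)
have [[rho [rC r0]]|nr] :=
    pselect (exists rho : R -> R, C2c rho /\ int01 rho != 0); last first.
  have h1 : @ae01 R (fun=> (1 : R) = 0).
    apply: (fundamental_lemma (intg01_cst 1)) => phi phiC.
    apply: contrapT => /eqP p0; apply: nr; exists phi; split => //.
    by rewrite (_ : phi = fun x => 1 * phi x)//; apply/funext => x; rewrite mul1r.
  by exists 0; apply: ae01S h1 => x _ /eqP; rewrite oner_eq0.
set r := int01 rho in r0.
have cont (e : R -> R) : C2c e -> {within `[0, 1], continuous e}.
  by move=> eC; exact: (continuous_within (C2c_continuous eC)).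
have ic (e : R -> R) : C2c e -> intg01 e by move=> eC; exact: (continuous_intg01 (C2c_continuous eC)).
have iwc (e : R -> R) : C2c e -> intg01 (fun x => w x * e x) by move=> eC; apply: intg01M_within => //; exact: cont.
pose C := int01 (fun x => w x * rho x) / r.
exists C; suff : ae01 (fun x => w x - C = 0) by apply: ae01S => x _ /eqP; rewrite subr_eq0 => /eqP.
apply: fundamental_lemma; first by apply: intg01B => //; exact: intg01_cst.
move=> e eC; set E := int01 e.
have tC : C2c (fun x => e x + - (E / r) * rho x) by apply: C2cD => //; exact: C2cZ.
have [f1 [f2 [_ _ st _]]] := tC.
have [|phi tphi dphi] := test_primitive (C2c_continuous tC) st.
  rewrite int01D ?int01Z//; [|exact: ic|exact: ic|by apply: intg01Z; exact: ic].
  by rewrite -/r -/E mulNr divfK// subrr.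
have := hw _ tphi; rewrite dphi.
have -> : int01 (fun x => w x * (e x + - (E / r) * rho x)) =
    int01 (fun x => w x * e x + - (E / r) * (w x * rho x)).
  by congr int01; apply/funext => x; ring.
rewrite int01D ?int01Z//; [|exact: iwc|exact: iwc|by apply: intg01Z; exact: iwc].
move=> z; have -> : int01 (fun x => (w x - C) * e x) =
    int01 (fun x => w x * e x + - C * e x).
  by congr int01; apply/funext => x; ring.
rewrite int01D ?int01Z//; [|exact: ic|exact: iwc|by apply: intg01Z; exact: ic].
by rewrite -z; congr (_ + _); rewrite -/E /C; field.
Qed.

Definition weak_deriv f g : Prop := forall phi, test_function phi ->
  int01 (fun x => f x * derive1 phi x) = - int01 (fun x => g x * phi x).

(** The primitive from 0, written over all of []0, 1[] with a cut-off integrand so that the rules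
    for [int01] apply to it. *)
Definition prim g (x : R) : R := int01 (g \_ `[0, x]).

Lemma primE g x : prim g x = parameterized_integral mu 0 x (g \_ I01).
Proof.
by rewrite /prim /int01 /parameterized_integral -!Rintegral_mkcondr setIC.
Qed.

Lemma intg01_patch g (A : set R) : measurable A -> intg01 g -> intg01 (g \_ A).
Proof.
move=> mA ig; rewrite /intg01 -restrict_EFin; apply/integrable_restrict => //.
by apply: integrableS ig => //; exact: measurableI.
Qed.

Lemma primB_le g h x : intg01 g -> intg01 h ->
  `|prim g x - prim h x| <= int01 (fun y => `|g y - h y|).
Proof.
move=> ig ih; have mx : measurable (`[0, x]%classic : set R) by exact: measurable_itv.
have ig' := intg01_patch mx ig; have ih' := intg01_patch mx ih.
rewrite /prim -int01B//; apply: le_trans (le_norm_int01 (intg01B ig' ih')) _.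
apply: le_int01; [exact/intg01_norm/intg01B|exact/intg01_norm/intg01B|].
by move=> y _; rewrite !patchE; case: ifPn => _ //; rewrite subrr normr0.
Qed.

Lemma prim_within g : intg01 g -> {within `[0, 1], continuous (prim g)}.
Proof.
move=> ig; rewrite (_ : prim g = fun x => parameterized_integral mu 0 x (g \_ I01)).
  apply: parameterized_integral_continuous => //.
  by apply: patch01_integrable => //; exact: measurable_itv.
by apply/funext => x; exact: primE.
Qed.

Lemma prim_is_derive g (x : R) : continuous g -> x \in `]0, 1[ ->
  is_derive x (1 : R) (prim g) (g x).
Proof.
move=> cg xI; have [x0 x1] : 0 < x /\ x < 1 by move: xI; rewrite in_itv/= => /andP.
rewrite (_ : prim g = fun x => parameterized_integral mu 0 x (g \_ I01)); last first.
  by apply/funext => y; exact: primE.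
have [||||d1 d2] := @continuous_FTC1_closed R (g \_ I01) 0 x (x + 1).
- by rewrite ltrDl.
- by apply: patch01_integrable; [exact: measurable_itv|exact: continuous_intg01].
- exact: x0.
- rewrite /prop_for /continuous_at patchE mem_set//.
  have : g y @[y --> x] --> g x by exact: cg.
  apply: cvg_trans; apply: near_eq_cvg; near=> y.
  rewrite patchE mem_set//= in_itv/=; apply/andP; split.
    by near: y; exact: lt_nbhsr.
  by near: y; exact: lt_nbhsl.
apply: DeriveDef => //.
by rewrite -derive1E d2 patchE mem_set.
Unshelve. all: by end_near. Qed.

Lemma within_comp f h (A : set R) : continuous h -> {within A, continuous f} ->
  {within A, continuous (fun x => h (f x))}.
Proof. by move=> ch cf x; apply: continuous_comp; [exact: cf|exact: ch]. Qed.

Lemma withinM f h (A : set R) : {within A, continuous f} -> {within A, continuous h} ->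
  {within A, continuous (fun x => f x * h x)}.
Proof. by move=> cf ch x; apply: cvgM; [exact: cf|exact: ch]. Qed.

Lemma withinD f h (A : set R) : {within A, continuous f} -> {within A, continuous h} ->
  {within A, continuous (fun x => f x + h x)}.
Proof. by move=> cf ch x; apply: cvgD; [exact: cf|exact: ch]. Qed.

Lemma within_cst a (A : set R) : {within A, continuous (fun=> a : R)}.
Proof. by apply: continuous_within => x; exact: cvg_cst. Qed.

Lemma test_continuous phi : test_function phi -> continuous phi.
Proof. by move=> /test_C1fun[/C1fun_continuous]. Qed.

(** For continuous [g] the composite is classically differentiable inside the interval; the identity
    is the fundamental theorem of calculus for its product with [phi], which vanishes near both
    ends. *)
Lemma chain_rule_continuous p dp g C : C1fun p dp -> continuous g ->
  weak_deriv (fun x => p (C + prim g x)) (fun x => dp (C + prim g x) * g x).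
Proof.
move=> pC cg phi tphi; have [[dphi cphi'] sphi] := test_C1fun tphi.
have cp := C1fun_continuous pC; have [dpp cdp] := pC.
have cphi := test_continuous tphi.
pose v x := C + prim g x.
have cv : {within `[0, 1], continuous v}.
  by apply: withinD; [exact: within_cst|exact/prim_within/continuous_intg01].
pose k1 x := dp (v x) * g x * phi x; pose k2 x := p (v x) * derive1 phi x.
have ck1 : {within `[0, 1], continuous k1}.
  apply: withinM; last exact: continuous_within.
  by apply: withinM; [exact: within_comp|exact: continuous_within].
have ck2 : {within `[0, 1], continuous k2}.
  by apply: withinM; [exact: within_comp|exact: continuous_within].
have ck : {within `[0, 1], continuous (fun x => k1 x + k2 x)} by exact: withinD.
pose h x := p (v x) * phi x.
have dh (x : R) : x \in `]0, 1[ -> is_derive x (1 : R) h (k1 x + k2 x).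
  move=> xI; have dv : is_derive x (1 : R) v (g x).
    have := @is_deriveD R _ _ (cst C) (prim g) x 1 0 (g x) (is_derive_cst _ _ _)
      (prim_is_derive cg xI).
    by rewrite add0r.
  have := @is_deriveM R R (p \o v) phi x 1 _ _ (@is_derive1_comp _ p v x _ _ (dpp (v x)) dv) (dphi x).
  by move=> H; apply: (is_derive_eq H); rewrite /k1 /k2 /= addrC; congr (_ + _); rewrite /GRing.scale/=; ring.
have [a [b [a0 b1 phi0]]] := sphi.
have hout x : x \notin `[a, b] -> h x = 0 by move=> /phi0 p0; rewrite /h p0 mulr0.
have h0 : h 0 = 0 by apply: hout; rewrite in_itv/= negb_and -!ltNge a0.
have h1 : h 1 = 0 by apply: hout; rewrite in_itv/= negb_and -!ltNge b1 orbT.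
have := @continuous_FTC2 R (fun x => k1 x + k2 x) h 0 1 ltr01 ck.
rewrite h0 h1 => FT.
have e : int01 (fun x => k1 x + k2 x) = 0.
  rewrite /int01 Rintegral_itv_bndo_bndc; last exact: within01_intg.
  rewrite Rintegral_itv_obnd_cbnd; last first.
    apply: (@integrableS _ _ _ mu `[0, 1]%classic) => //.
      by apply: subset_itvr; rewrite bnd_simp.
    by apply: continuous_compact_integrable => //; exact: segment_compact.
  rewrite /Rintegral FT//= ?subrr//.
  - split.
    + by move=> x /dh [].
    + rewrite h0; apply: cvg_near_cst; near=> x; apply: hout.
      rewrite in_itv/= negb_and -!ltNge; apply/orP; left.
      by near: x; exact: nbhs_right_lt.
    + rewrite h1; apply: cvg_near_cst; near=> x; apply: hout.
      rewrite in_itv/= negb_and -!ltNge; apply/orP; right.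
      by near: x; exact: nbhs_left_gt.
  - by move=> x /dh [_]; rewrite derive1E.
move: e; rewrite int01D; [|exact: within01_intg|exact: within01_intg].
by rewrite addrC => /eqP; rewrite addr_eq0 => /eqP.
Unshelve. all: by end_near. Qed.
Lemma continuous_dense_L1 g (e : R) : intg01 g -> 0 < e ->
  exists2 h, continuous h & int01 (fun x => `|g x - h x|) < e.
Proof.
move=> ig e0.
have [|||h_ [ch ih h0]] := @approximation_continuous_integrable R I01 g.
- exact: measurable_itv.
- by apply: (@le_lt_trans _ _ 1%:E); rewrite ?ltry// le_eqVlt; apply/orP; left; apply/eqP; exact: mu01.
- exact: ig.
have : int01 (fun x => `|g x - h_ n x|) @[n --> \oo] --> (0 : R).
  by apply: fine_cvg; exact: h0.
move=> /cvgrPdist_lt/(_ _ e0)[n _ /(_ n (leqnn n))].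
rewrite /= sub0r normrN => hn; exists (h_ n); first exact: ch.
by apply: le_lt_trans hn; rewrite ler_norm.
Qed.

(** Approximation of [g] by a continuous [h] in L^1: the primitives are then uniformly close, and
    the Lipschitz bounds on [p] and [dp] carry this over to both sides of the identity. *)
Lemma chain_rule_prim p dp B L g C : C1fun p dp ->
  (forall a, `|dp a| <= B) -> (forall a b, `|p a - p b| <= B * `|a - b|) ->
  (forall a b, `|dp a - dp b| <= L * `|a - b|) -> intg01 g ->
  weak_deriv (fun x => p (C + prim g x)) (fun x => dp (C + prim g x) * g x).
Proof.
move=> pC dpB pB dpL ig phi tphi.
have B0 : 0 <= B by apply: le_trans (dpB 0).
have L0 : 0 <= L.
  by have := dpL 1 0; rewrite subr0 normr1 mulr1; apply: le_trans.
have [[dphi cphi'] sphi] := test_C1fun tphi.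
have cphi := test_continuous tphi; have cp := C1fun_continuous pC.
have [dpp cdp] := pC.
have [M M0 hM] := within01_bounded (continuous_within cphi).
have [M' M'0 hM'] := within01_bounded (continuous_within cphi').
pose G := int01 (fun x => `|g x|).
have G0 : 0 <= G by apply: int01_ge0.
apply/eqP; rewrite -addr_eq0 -normr_eq0 eq_le normr_ge0 andbT.
(* [B * M'] comes from the side with [p]. The rest comes from splitting [dp v * g - dp w * h] into
   [(dp v - dp w) * g] and [dp w * (g - h)]. *)
pose K := B * M' + M * (L * G + B).
have K0 : 0 <= K by rewrite addr_ge0// mulr_ge0// addr_ge0// mulr_ge0.
apply/ler_addgt0Pr => e e0; rewrite add0r.
have [|h ch gh] := @continuous_dense_L1 g (e / (K + 1)) ig.
  by rewrite divr_gt0// ltr_wpDl.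
set d := int01 _ in gh; have d0 : 0 <= d by apply: int01_ge0.
have ih := continuous_intg01 ch.
pose v x := C + prim g x; pose w x := C + prim h x.
have vw x : `|v x - w x| <= d by rewrite /v /w opprD addrACA subrr add0r primB_le.
have cv : {within `[0, 1], continuous v}.
  by apply: withinD; [exact: within_cst|exact: prim_within].
have cw : {within `[0, 1], continuous w}.
  by apply: withinD; [exact: within_cst|exact: prim_within].
have cpv : {within `[0, 1], continuous (fun x => p (v x))} by exact: within_comp.
have cpw : {within `[0, 1], continuous (fun x => p (w x))} by exact: within_comp.
have cdv : {within `[0, 1], continuous (fun x => dp (v x))} by exact: within_comp.
have cdw : {within `[0, 1], continuous (fun x => dp (w x))} by exact: within_comp.
have wphi := continuous_within cphi (A := `[0, 1]).
have wphi' := continuous_within cphi' (A := `[0, 1]).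
have i1 : intg01 (fun x => p (v x) * derive1 phi x).
  by apply: within01_intg; exact: withinM.
have i2 : intg01 (fun x => p (w x) * derive1 phi x).
  by apply: within01_intg; exact: withinM.
have i3' : intg01 (fun x => dp (v x) * g x).
  by have := intg01M_within cdv ig; congr intg01; apply/funext => x; rewrite mulrC.
have i4' : intg01 (fun x => dp (w x) * h x).
  by have := intg01M_within cdw ih; congr intg01; apply/funext => x; rewrite mulrC.
have i3 : intg01 (fun x => dp (v x) * g x * phi x) by exact: intg01M_within.
have i4 : intg01 (fun x => dp (w x) * h x * phi x) by exact: intg01M_within.
have E := chain_rule_continuous C pC ch tphi.
rewrite -/v -[X in `|X + _| <= _](addrNK (int01 (fun x => p (w x) * derive1 phi x))).
rewrite {2}E -addrA [- _ + _]addrC -int01B// -int01B//.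
apply: le_trans (ler_normD _ _) _.
have s1 : `|int01 (fun x => p (v x) * derive1 phi x - p (w x) * derive1 phi x)| <= B * d * M'.
  apply: le_trans (le_norm_int01 (intg01B i1 i2)) _.
  have -> : B * d * M' = int01 (fun=> B * d * M').
    by rewrite /int01 Rintegral_cst// [X in fine X]mu01 mulr1.
  apply: le_int01; [exact/intg01_norm/intg01B|exact: intg01_cst|].
  move=> x xI; rewrite -mulrBl normrM; apply: ler_pM => //; last exact/hM'/subitv01.
  by apply: le_trans (pB _ _) _; rewrite ler_wpM2l.
have s2 : `|int01 (fun x => dp (v x) * g x * phi x - dp (w x) * h x * phi x)| <=
    M * (L * d) * G + M * B * d.
  apply: le_trans (le_norm_int01 (intg01B i3 i4)) _.
  have -> : M * (L * d) * G = int01 (fun x => M * (L * d) * `|g x|).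
    by rewrite int01Z//; exact: intg01_norm.
  have -> : M * B * d = int01 (fun x => M * B * `|g x - h x|).
    by rewrite int01Z//; exact/intg01_norm/intg01B.
  rewrite -int01D; [|exact/intg01Z/intg01_norm|exact/intg01Z/intg01_norm/intg01B].
  apply: le_int01; [exact/intg01_norm/intg01B|
    apply: intg01D; [exact/intg01Z/intg01_norm|exact/intg01Z/intg01_norm/intg01B]|].
  move=> x xI; have -> : dp (v x) * g x * phi x - dp (w x) * h x * phi x =
    phi x * ((dp (v x) - dp (w x)) * g x) + phi x * (dp (w x) * (g x - h x)) by ring.
  apply: le_trans (ler_normD _ _) _; rewrite !normrM.
  have pM := hM _ (subitv01 xI).
  apply: lerD; rewrite !mulrA.
    rewrite ler_wpM2r//; apply: (@le_trans _ _ (M * `|dp (v x) - dp (w x)|)).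
      by rewrite ler_wpM2r.
    rewrite -mulrA ler_wpM2l//; apply: le_trans (dpL _ _) _.
    by rewrite ler_wpM2l.
  rewrite ler_wpM2r//; apply: ler_pM => //.
apply: le_trans (lerD s1 s2) _.
have -> : B * d * M' + (M * (L * d) * G + M * B * d) = K * d by rewrite /K; ring.
have K1 : 0 < K + 1 by rewrite ltr_wpDl.
apply: (@le_trans _ _ (K * (e / (K + 1)))); first by rewrite ler_wpM2l// ltW.
rewrite mulrCA; apply: ler_piMr; first exact: ltW.
by rewrite ler_pdivrMr// mul1r lerDl ler01.
Qed.

(** The chain rule for the identity function, whose derivative has Lipschitz constant 0. *)
Lemma prim_weak_deriv g C : intg01 g -> weak_deriv (fun x => C + prim g x) g.
Proof.
move=> ig; have C1id : C1fun (fun x : R => x) (fun=> 1).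
  by split=> x; [exact: is_derive_id|exact: cst_continuous].
have := @chain_rule_prim _ _ 1 0 g C C1id; rewrite (_ : (fun x => 1 * g x) = g).
  by apply => // [a|a b|a b]; rewrite ?normr1 ?mul1r ?subrr ?normr0 ?mul0r.
by apply/funext => x; rewrite mul1r.
Qed.

Lemma weak_deriv_unique f g h : intg01 g -> intg01 h ->
  weak_deriv f g -> weak_deriv f h -> ae01 (fun x => g x = h x).
Proof.
move=> ig ih fg fh.
have : ae01 (fun x => g x - h x = 0).
  apply: fundamental_lemma; first exact: intg01B.
  move=> phi phiC; have wphi := continuous_within (C2c_continuous phiC) (A := `[0, 1]).
  have := fg _ (C2c_test phiC); rewrite (fh _ (C2c_test phiC)) => /oppr_inj e.
  have -> : (fun x => (g x - h x) * phi x) = fun x => g x * phi x - h x * phi x.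
    by apply/funext => x; rewrite mulrBl.
  by rewrite int01B ?e ?subrr//; exact: intg01M_within.
by apply: ae01S => x _ /eqP; rewrite subr_eq0 => /eqP.
Qed.

Lemma weak_deriv_ae f f' g g' : mfun01 f' -> mfun01 g' ->
  intg01 f -> intg01 g ->
  ae01 (fun x => f x = f' x) -> ae01 (fun x => g x = g' x) ->
  weak_deriv f g -> weak_deriv f' g'.
Proof.
move=> mf' mg' i_f i_g ff gg h phi tphi.
have [[dphi cphi'] sphi] := test_C1fun tphi.
have cphi := test_continuous tphi.
have [mf mg] := (intg01_mfun i_f, intg01_mfun i_g).
have mphi := continuous_mfun01 cphi; have mphi' := continuous_mfun01 cphi'.
have <- : int01 (fun x => f x * derive1 phi x) = int01 (fun x => f' x * derive1 phi x).
  apply: int01_ae; [exact: measurable_funM|exact: measurable_funM|].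
  by apply: ae01S ff => x _ ->.
have <- : int01 (fun x => g x * phi x) = int01 (fun x => g' x * phi x).
  apply: int01_ae; [exact: measurable_funM|exact: measurable_funM|].
  by apply: ae01S gg => x _ ->.
exact: h.
Qed.

(** [f - prim g] has weak derivative 0, so [du_bois_reymond] makes it constant. This gives the
    continuous representative and reduces the chain rule to primitives. *)
Lemma weak_deriv_prim f g : intg01 f -> intg01 g -> weak_deriv f g ->
  exists C, ae01 (fun x => C + prim g x = f x).
Proof.
move=> i_f i_g fg.
have ip : intg01 (prim g) by exact/within01_intg/prim_within.
have [phi tphi|C hC] := @du_bois_reymond (fun x => f x - prim g x) (intg01B i_f ip).
  have [[dphi cphi'] sphi] := test_C1fun tphi.
  have wphi' := continuous_within cphi' (A := `[0, 1]).
  have -> : (fun x => (f x - prim g x) * derive1 phi x) =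
      fun x => f x * derive1 phi x - prim g x * derive1 phi x.
    by apply/funext => x; rewrite mulrBl.
  rewrite int01B; [|exact: intg01M_within|exact: intg01M_within].
  rewrite (_ : (fun x => prim g x * _) = fun x => (0 + prim g x) * derive1 phi x).
    by rewrite fg// (@prim_weak_deriv g 0 i_g phi tphi) subrr.
  by apply/funext => x; rewrite add0r.
by exists C; apply: ae01S hC => x _ <-; rewrite subrK.
Qed.

Lemma weak_deriv_continuous_repr f g : intg01 f -> intg01 g -> weak_deriv f g ->
  exists2 u : R -> R, {within `[0, 1], continuous u} & ae01 (fun x => u x = f x).
Proof.
move=> i_f i_g /(weak_deriv_prim i_f i_g)[C hC].
exists (fun x => C + prim g x) => //.
by apply: withinD; [exact: within_cst|exact: prim_within].
Qed.

Lemma chain_rule p dp B L f g : C1fun p dp ->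
  (forall a, `|dp a| <= B) -> (forall a b, `|p a - p b| <= B * `|a - b|) ->
  (forall a b, `|dp a - dp b| <= L * `|a - b|) ->
  intg01 f -> intg01 g -> weak_deriv f g ->
  weak_deriv (fun x => p (f x)) (fun x => dp (f x) * g x).
Proof.
move=> pC dpB pB dpL i_f i_g fg; have [C hC] := weak_deriv_prim i_f i_g fg.
have cp := C1fun_continuous pC; have [dpp cdp] := pC.
have mf := intg01_mfun i_f; have mg := intg01_mfun i_g.
have cv : {within `[0, 1], continuous (fun x => C + prim g x)}.
  by apply: withinD; [exact: within_cst|exact: prim_within].
have mcomp q : continuous q -> mfun01 (fun x => q (f x)).
  by move=> cq; apply: measurableT_comp => //; exact: continuous_measurable_fun.
apply: (weak_deriv_ae _ _ _ _ _ _ (@chain_rule_prim p dp B L g C pC dpB pB dpL i_g)).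
- exact: mcomp.
- by apply: measurable_funM => //; exact: mcomp.
- by apply: within01_intg; exact: within_comp.
- have := intg01M_within (within_comp cdp cv) i_g; congr intg01.
  by apply/funext => x; rewrite mulrC.
- by apply: ae01S hC => x _ ->.
- by apply: ae01S hC => x _ ->.
Qed.

End WeakDerivatives.

(** * The space X_2 *)

Section ComplexComponents.
Context {R : realType}.
Implicit Types (f g : R -> R[i]) (z : R[i]).
Local Open Scope complex_scope.

Definition Rep f (x : R) : R := complex.Re (f x).
Definition Imp f (x : R) : R := complex.Im (f x).

Lemma sqr_normc z : ComplexField.Normc.normc z ^+ 2 = complex.Re z ^+ 2 + complex.Im z ^+ 2.
Proof. by case: z => a b /=; rewrite sqr_sqrtr// addr_ge0 ?sqr_ge0. Qed.

Lemma inL2P (w : R) f : 0 < w -> inL2 w f <-> sqint01 (Rep f) /\ sqint01 (Imp f).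
Proof.
move=> w0; split=> [[[mr mi] h]|[[mr hr] [mi hi]]].
  have h' : intg01 (fun x => Rep f x ^+ 2 + Imp f x ^+ 2).
    have h1 : intg01 (fun x => ComplexField.Normc.normc (f x) ^+ 2 * w) by exact: h.
    have := intg01Z w^-1 h1; congr intg01; apply/funext => x.
    by rewrite mulrCA mulVf ?mulr1 ?sqr_normc// gt_eqF.
  split; split => //; apply: intg01_le h'; do ?exact: measurable_funX.
    by move=> x _; rewrite ger0_norm ?sqr_ge0// lerDl sqr_ge0.
  by move=> x _; rewrite ger0_norm ?sqr_ge0// lerDr sqr_ge0.
split; first by split.
have := intg01Z w (intg01D hr hi); rewrite /intg01; congr integrable.
by apply/funext => x /=; rewrite sqr_normc mulrC.
Qed.

Lemma cint01_Re f : complex.Re (cint01 f) = int01 (Rep f).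
Proof. by []. Qed.

Lemma cint01_Im f : complex.Im (cint01 f) = int01 (Imp f).
Proof. by []. Qed.

Lemma complex_eq z1 z2 : complex.Re z1 = complex.Re z2 ->
  complex.Im z1 = complex.Im z2 -> z1 = z2.
Proof. by case: z1 z2 => a b [c d] /= -> ->. Qed.

Lemma is_weak_derivativeP f g : is_weak_derivative f g <->
  weak_deriv (Rep f) (Rep g) /\ weak_deriv (Imp f) (Imp g).
Proof.
have RM (h : R -> R[i]) (k : R -> R) : Rep (fun x => h x * (k x)%:C) = fun x => Rep h x * k x.
  by apply/funext => x; rewrite /Rep; case: (h x) => a b /=; rewrite mulr0 subr0.
have IM (h : R -> R[i]) (k : R -> R) : Imp (fun x => h x * (k x)%:C) = fun x => Imp h x * k x.
  by apply/funext => x; rewrite /Imp; case: (h x) => a b /=; rewrite mulr0 add0r.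
split=> [h|[hr hi] phi tphi].
  split=> phi tphi; have := h _ tphi => e.
    have := congr1 (@complex.Re R) e; rewrite cint01_Re RM => ->.
    by rewrite /= -/(int01 _) -/(Rep (fun x => g x * (phi x)%:C)) RM.
  have := congr1 (@complex.Im R) e; rewrite cint01_Im IM => ->.
  by rewrite /= -/(int01 _) -/(Imp (fun x => g x * (phi x)%:C)) IM.
apply: complex_eq.
  by rewrite cint01_Re RM hr//= -/(int01 _) -/(Rep (fun x => g x * (phi x)%:C)) RM.
by rewrite cint01_Im IM hi//= -/(int01 _) -/(Imp (fun x => g x * (phi x)%:C)) IM.
Qed.

Lemma inH1P f : inH1 f -> [/\ sqint01 (Rep f), sqint01 (Imp f),
  sqint01 (Rep (weak_derivative f)), sqint01 (Imp (weak_derivative f)) &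
  is_weak_derivative f (weak_derivative f)].
Proof.
move=> [/(inL2P _ ltr01)[hr hi] [g [g2 fg]]].
have [/(inL2P _ ltr01)[gr gi] wd] := xgetPex (fun=> 0)
  (ex_intro (fun g => inL2 1 g /\ is_weak_derivative f g) g (conj g2 fg)).
by split.
Qed.

Lemma weak_derivative_ae f g : inH1 f -> inL2 1 g -> is_weak_derivative f g ->
  ae01 (fun x => weak_derivative f x = g x).
Proof.
move=> /inH1P[fr fi wr wi /is_weak_derivativeP[dr di]] /(inL2P _ ltr01)[gr gi].
move=> /is_weak_derivativeP[er ei].
have := weak_deriv_unique (sqint01_intg wr) (sqint01_intg gr) dr er.
have := weak_deriv_unique (sqint01_intg wi) (sqint01_intg gi) di ei.
by apply: ae01S2 => x _ h1 h2; exact: complex_eq.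
Qed.

End ComplexComponents.

(** * [X_2] as a complete real semi-inner product space *)

Section ProductSpace.
Context {R : realType} {m : nat} (mu : 'I_m -> R).
Hypothesis mu_gt0 : forall j, 0 < mu j.
Notation E := ('I_m -> R -> Rcomplex R).
Implicit Types (f g h : E).
Local Open Scope complex_scope.

(* [Rcomplex R] is R[i] as a real vector space: the real part of the inner
   product of X_2 makes X_2 a real Hilbert space with the same norm. *)
Definition reip f g : R := complex.Re (innerX2 mu f g).

Lemma Rep_linear a f g j x : Rep ((a *: f + g) j) x = a * Rep (f j) x + Rep (g j) x.
Proof.
rewrite /Rep; have -> : (a *: f + g) j x = a *: f j x + g j x by [].
by case: (f j x) => ? ?; case: (g j x).
Qed.

Lemma Imp_linear a f g j x : Imp ((a *: f + g) j) x = a * Imp (f j) x + Imp (g j) x.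
Proof.
rewrite /Imp; have -> : (a *: f + g) j x = a *: f j x + g j x by [].
by case: (f j x) => ? ?; case: (g j x).
Qed.

Lemma RepB f g j x : Rep ((f - g) j) x = Rep (f j) x - Rep (g j) x.
Proof.
rewrite /Rep; have -> : (f - g) j x = f j x - g j x by [].
by case: (f j x) => ? ?; case: (g j x).
Qed.

Lemma ImpB f g j x : Imp ((f - g) j) x = Imp (f j) x - Imp (g j) x.
Proof.
rewrite /Imp; have -> : (f - g) j x = f j x - g j x by [].
by case: (f j x) => ? ?; case: (g j x).
Qed.

Lemma weight_ge0 j a b : 0 <= a -> 0 <= b -> 0 <= mu j * (a + b).
Proof. by move=> a0 b0; rewrite mulr_ge0 ?addr_ge0// ltW. Qed.

Lemma inX2P f : inX2 mu f <-> forall j, sqint01 (Rep (f j)) /\ sqint01 (Imp (f j)).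
Proof. by split=> h j; have := h j; rewrite (inL2P _ (mu_gt0 j)). Qed.

Lemma Re_sum (F : 'I_m -> R[i]) : complex.Re (\sum_j F j) = \sum_j complex.Re (F j).
Proof.
apply: (big_morph (@complex.Re R)) => //.
by case=> a b [c d].
Qed.

Lemma reipE f g : inX2 mu f -> inX2 mu g -> reip f g = \sum_j mu j *
  (int01 (fun x => Rep (f j) x * Rep (g j) x) + int01 (fun x => Imp (f j) x * Imp (g j) x)).
Proof.
move=> /inX2P Xf /inX2P Xg; rewrite /reip Re_sum; apply: eq_bigr => j _.
have [fr fi] := Xf j; have [gr gi] := Xg j.
rewrite -int01D; [|exact: sqint01M|exact: sqint01M].
rewrite -int01Z; last by apply: intg01D; exact: sqint01M.
rewrite cint01_Re; congr int01; apply/funext => x; rewrite /Rep /Imp.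
by case: (f j x) => a b; case: (g j x) => c d /=; ring.
Qed.

Lemma edge_sip : semi_inner_product (inX2 mu : set E) reip.
Proof.
have XP a f g : inX2 mu f -> inX2 mu g -> inX2 mu (a *: f + g).
  move=> /inX2P Xf /inX2P Xg; apply/inX2P => j.
  have [fr fi] := Xf j; have [gr gi] := Xg j; split.
    have := sqint01D (sqint01Z a fr) gr; congr sqint01; apply/funext => x.
    by rewrite Rep_linear.
  have := sqint01D (sqint01Z a fi) gi; congr sqint01; apply/funext => x.
  by rewrite Imp_linear.
have X0 : inX2 mu (0 : E).
  apply/inX2P => j; split; [have := @sqint01_cst R 0|have := @sqint01_cst R 0];
    by congr sqint01; apply/funext => x.
split => //.
- move=> f g Xf Xg; rewrite !reipE//; apply: eq_bigr => j _; congr (_ * (_ + _));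
  by congr int01; apply/funext => x; rewrite mulrC.
- move=> a f g h Xf Xg Xh; rewrite !reipE//; last exact: XP.
  rewrite mulr_sumr -big_split/=; apply: eq_bigr => j _.
  have [fr fi] := (inX2P f).1 Xf j; have [gr gi] := (inX2P g).1 Xg j.
  have [hr hi] := (inX2P h).1 Xh j.
  have -> : int01 (fun x => Rep ((a *: f + g) j) x * Rep (h j) x) =
      int01 (fun x => a * (Rep (f j) x * Rep (h j) x) + Rep (g j) x * Rep (h j) x).
    congr int01; apply/funext => x; rewrite mulrA -mulrDl; congr (_ * _).
    exact: Rep_linear.
  have -> : int01 (fun x => Imp ((a *: f + g) j) x * Imp (h j) x) =
      int01 (fun x => a * (Imp (f j) x * Imp (h j) x) + Imp (g j) x * Imp (h j) x).
    congr int01; apply/funext => x; rewrite mulrA -mulrDl; congr (_ * _).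
    exact: Imp_linear.
  have A1 := sqint01M fr hr; have A2 := sqint01M fi hi.
  have A3 := sqint01M gr hr; have A4 := sqint01M gi hi.
  rewrite int01D//; last exact: intg01Z.
  rewrite int01D//; last exact: intg01Z.
  by rewrite int01Z// int01Z//; ring.
- move=> f Xf; rewrite reipE//; apply: sumr_ge0 => j _.
  by apply: weight_ge0; apply: int01_ge0 => x _; rewrite -expr2 sqr_ge0.
Qed.

Lemma reip_self f : inX2 mu f -> reip f f = \sum_j mu j *
  (int01 (fun x => Rep (f j) x ^+ 2) + int01 (fun x => Imp (f j) x ^+ 2)).
Proof. by move=> Xf; rewrite reipE. Qed.

(** The bridge between laws stated almost everywhere and laws stated modulo null vectors. *)
Lemma eqX_norm f g : inX2 mu f -> inX2 mu g ->
  eqX f g <-> sip_norm reip (f - g) = 0.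
Proof.
move=> Xf Xg; have Xd := domB edge_sip Xf Xg.
have Xd' := (inX2P (f - g)).1 Xd.
rewrite /sip_norm reip_self//; split=> [fg|].
  rewrite big1 ?sqrtr0// => j _.
  have z (h : R -> R) : sqint01 h -> ae01 (fun x => h x = 0) -> int01 (fun x => h x ^+ 2) = 0.
    move=> Xh h0; have -> : 0 = int01 (fun=> 0 : R).
      by rewrite /int01 Rintegral_cst// mul0r.
    apply: int01_ae; [exact: measurable_funX (sqint01_mfun Xh)|exact: measurable_cst|].
    by apply: ae01S h0 => x _ ->; rewrite expr0n.
  have [dr di] := Xd' j; have fgj : ae01 (fun x => f j x = g j x) := fg j.
  rewrite (z _ dr) ?(z _ di) ?addr0 ?mulr0//.
    by apply: ae01S fgj => x _ e; rewrite ImpB /Imp e subrr.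
  by apply: ae01S fgj => x _ e; rewrite RepB /Rep e subrr.
move=> /eqP; rewrite sqrtr_eq0 => s0 j.
have t0 i : 0 <= mu i * (int01 (fun x => Rep ((f - g) i) x ^+ 2) +
    int01 (fun x => Imp ((f - g) i) x ^+ 2)).
  by apply: weight_ge0; apply: int01_ge0 => x _; rewrite sqr_ge0.
have /eqP : \sum_i mu i * (int01 (fun x => Rep ((f - g) i) x ^+ 2) +
    int01 (fun x => Imp ((f - g) i) x ^+ 2)) = 0.
  by apply/le_anti; rewrite s0 sumr_ge0.
rewrite psumr_eq0// => /allP/(_ j (mem_index_enum _))/=.
rewrite mulf_eq0 gt_eqF//= paddr_eq0; last 2 first.
- by apply: int01_ge0 => x _; exact: sqr_ge0.
- by apply: int01_ge0 => x _; exact: sqr_ge0.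
move=> /andP[/eqP r0 /eqP i0]; have [dr di] := Xd' j.
apply: ae01S2 (sqint01_eq0_ae dr r0) (sqint01_eq0_ae di i0) => x _.
rewrite RepB ImpB => /eqP; rewrite subr_eq0 => /eqP e1 /eqP.
by rewrite subr_eq0 => /eqP e2; exact: complex_eq.
Qed.

Lemma edge_complete : sip_complete (inX2 mu : set E) reip.
Proof.
move=> x_ Xx fast.
have comp n k : (n <= k)%N -> forall j,
    int01 (fun t => (Rep (x_ k j) t - Rep (x_ n j) t) ^+ 2) <= (mu j)^-1 * 4^-1 ^+ n /\
    int01 (fun t => (Imp (x_ k j) t - Imp (x_ n j) t) ^+ 2) <= (mu j)^-1 * 4^-1 ^+ n.
  move=> nk j; have Xd := domB edge_sip (Xx k) (Xx n).
  have := fast _ _ nk; rewrite -(@ler_pXn2r _ 2) ?nnegrE ?sip_norm_ge0 ?exprn_ge0//.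
  rewrite (sqr_sip_norm edge_sip)// reip_self// (bigD1 j)//= exprAC.
  have -> : 2^-1 ^+ 2 = 4^-1 :> R by field.
  set S := \sum_(_ | _) _; have S0 : 0 <= S.
    apply: sumr_ge0 => i _.
    by apply: weight_ge0; apply: int01_ge0 => x _; rewrite sqr_ge0.
  have eR : (fun t => (Rep (x_ k j) t - Rep (x_ n j) t) ^+ 2) =
      fun t => Rep ((x_ k - x_ n) j) t ^+ 2.
    by apply/funext => t; rewrite RepB.
  have eI : (fun t => (Imp (x_ k j) t - Imp (x_ n j) t) ^+ 2) =
      fun t => Imp ((x_ k - x_ n) j) t ^+ 2.
    by apply/funext => t; rewrite ImpB.
  rewrite eR eI; set A := int01 _; set B := int01 _ => h.
  have A0 : 0 <= A by apply: int01_ge0 => t _; exact: sqr_ge0.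
  have B0 : 0 <= B by apply: int01_ge0 => t _; exact: sqr_ge0.
  rewrite ![(mu j)^-1 * _]mulrC !ler_pdivlMr//.
  move: h (mu_gt0 j); rewrite mulrDr.
  have := mulr_ge0 (ltW (mu_gt0 j)) A0; have := mulr_ge0 (ltW (mu_gt0 j)) B0.
  rewrite ![_ * mu j]mulrC; move: (mu j * A) (mu j * B) S0 => a b.
  by clear; move=> *; split; lra.
have /choice[xr hxr] j : exists x, sqint01 x /\
    forall n, int01 (fun t => (x t - Rep (x_ n j) t) ^+ 2) <= (mu j)^-1 * 4^-1 ^+ n.
  have [|n k nk|x] := @sqint01_complete R (fun n => Rep (x_ n j)) (mu j)^-1.
  - by move=> n; have [] := (inX2P (x_ n)).1 (Xx n) j.
  - by have [] := comp _ _ nk j.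
  - by exists x.
have /choice[xi hxi] j : exists x, sqint01 x /\
    forall n, int01 (fun t => (x t - Imp (x_ n j) t) ^+ 2) <= (mu j)^-1 * 4^-1 ^+ n.
  have [|n k nk|x] := @sqint01_complete R (fun n => Imp (x_ n j)) (mu j)^-1.
  - by move=> n; have [] := (inX2P (x_ n)).1 (Xx n) j.
  - by have [] := comp _ _ nk j.
  - by exists x.
pose x : E := fun j t => xr j t +i* xi j t.
have Xlim : inX2 mu x by apply/inX2P => j; split; [have [] := hxr j|have [] := hxi j].
exists x => //.
(* There are [m] edges with two real components each, and each component contributes at most
   [4^-1 ^+ n] once the weight [mu j] cancels its inverse. *)
have bnd n : sip_norm reip (x - x_ n) <= Num.sqrt (m.*2%:R) * 2^-1 ^+ n.
  have Xd := domB edge_sip Xlim (Xx n).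
  rewrite -(@ler_pXn2r _ 2) ?nnegrE ?sip_norm_ge0 ?mulr_ge0 ?sqrtr_ge0 ?exprn_ge0//.
  rewrite (sqr_sip_norm edge_sip)// reip_self// exprMn sqr_sqrtr// exprAC.
  have -> : 2^-1 ^+ 2 = 4^-1 :> R by field.
  rewrite -mul2n mulrC mulnC natrM mulrA.
  apply: (@le_trans _ _ (\sum_(j < m) (4^-1 ^+ n * 2))); last first.
    rewrite sumr_const card_ord -[leLHS]mulr_natl le_eqVlt; apply/orP; left.
    by apply/eqP; ring.
  apply: ler_sum => j _.
  have h1 := (hxr j).2 n; have h2 := (hxi j).2 n.
  have eR : (fun t => Rep ((x - x_ n) j) t ^+ 2) = fun t => (xr j t - Rep (x_ n j) t) ^+ 2.
    by apply/funext => t; rewrite RepB.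
  have eI : (fun t => Imp ((x - x_ n) j) t ^+ 2) = fun t => (xi j t - Imp (x_ n j) t) ^+ 2.
    by apply/funext => t; rewrite ImpB.
  rewrite eR eI mulrC -ler_pdivlMr//; apply: le_trans (lerD h1 h2) _.
  by rewrite -mulrDr mulrC -mulr2n -[_ *+ 2]mulr_natr.
apply: (squeeze_cvgr (f := fun=> 0) (h := fun n => Num.sqrt (m.*2%:R) * 2^-1 ^+ n)).
- by apply: nearW => n; rewrite sip_norm_ge0/=.
- exact: cvg_cst.
- rewrite -[X in _ --> X](mulr0 (Num.sqrt (m.*2%:R))).
  apply: cvgMr; apply: cvg_expr; by rewrite ger0_norm ?invr_ge0// invf_lt1// ltr1n.
Qed.

End ProductSpace.

(** * Density of smooth functions supported inside the edges *)

Section SmoothDensity.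
Context {R : realType} {m : nat} (mu : 'I_m -> R).
Hypothesis mu_gt0 : forall j, 0 < mu j.
Notation E := ('I_m -> R -> Rcomplex R).
Implicit Types (f g h : E).
Local Open Scope complex_scope.

Definition smooth_edges f : Prop := forall j, C2c (Rep (f j)) /\ C2c (Imp (f j)).

Lemma C2c_sqint01 (f : R -> R) : C2c f -> sqint01 f.
Proof.
move=> fC; have cf := C2c_continuous fC.
have [M _ hM] := within01_bounded (continuous_within cf).
apply: (@sqint01_bounded _ _ M); first exact: continuous_mfun01.
by move=> x /subitv01; exact: hM.
Qed.

Lemma smooth_inX2 f : smooth_edges f -> inX2 mu f.
Proof.
move=> fs; apply/(inX2P mu_gt0) => j; have [h1 h2] := fs j.
by split; exact: C2c_sqint01.
Qed.

Lemma single_edge_sum (F : 'I_m -> R) j : (forall i, i != j -> F i = 0) ->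
  \sum_i F i = F j.
Proof. by move=> F0; rewrite (bigD1 j)//= big1 ?addr0// => i ij; rewrite F0. Qed.

(** A vector orthogonal to all smooth ones is null: test vectors living on one edge, with real or
    purely imaginary values, isolate each real component, to which [fundamental_lemma] applies. *)
Lemma smooth_dense f e : inX2 mu f -> 0 < e ->
  exists2 g, smooth_edges g & sip_norm (reip mu) (f - g) < e.
Proof.
move=> Xf e0; apply: (dense_of_orthogonal (edge_sip mu_gt0)) => //.
- exact: edge_complete.
- exact: smooth_inX2.
- by move=> j; split; exact: C2c0.
- move=> a g h gs hs j; have [g1 g2] := gs j; have [h1 h2] := hs j; split.
    have := C2cD (C2cZ a g1) h1; congr C2c; apply/funext => x.
    by rewrite Rep_linear.
  have := C2cD (C2cZ a g2) h2; congr C2c; apply/funext => x.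
  by rewrite Imp_linear.
move=> h Xh orth.
have int0 : int01 (fun=> 0 : R) = 0 by rewrite /int01 Rintegral_cst// mul0r.
suff h0 : eqX h 0.
  have := (eqX_norm mu_gt0 Xh (sip_dom0 (edge_sip mu_gt0))).1 h0.
  by rewrite subr0.
have Xh' := (inX2P mu_gt0 h).1 Xh.
move=> j; have [hr hi] := Xh' j.
have rh : ae01 (fun x => Rep (h j) x = 0).
  apply: fundamental_lemma; first exact: sqint01_intg.
  move=> phi phiC.
  pose d : E := fun i x => if i == j then (phi x)%:C else 0.
  have ds : smooth_edges d.
    move=> i; rewrite /Rep /Imp /d; case: eqP => _; split => //; exact: C2c0.
  have := orth _ ds; rewrite reipE//; last exact: smooth_inX2.
  rewrite (@single_edge_sum _ j) => [|i /negPf ij]; last first.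
    rewrite /Rep /Imp /d ij/=.
    under [X in int01 X]funext do rewrite mulr0.
    under [X in _ + int01 X]funext do rewrite mulr0.
    by rewrite int0 addr0 mulr0.
  rewrite /Imp /d eqxx/=; under [X in _ + int01 X]funext do rewrite mulr0.
  rewrite int0 addr0 => /eqP; rewrite mulf_eq0 gt_eqF//= => /eqP.
  by congr (_ = _); congr int01; apply/funext => x; rewrite /Rep eqxx.
have ih : ae01 (fun x => Imp (h j) x = 0).
  apply: fundamental_lemma; first exact: sqint01_intg.
  move=> phi phiC.
  pose d : E := fun i x => if i == j then (0 +i* phi x)%C else 0.
  have ds : smooth_edges d.
    move=> i; rewrite /Rep /Imp /d; case: eqP => _; split => //; exact: C2c0.
  have := orth _ ds; rewrite reipE//; last exact: smooth_inX2.
  rewrite (@single_edge_sum _ j) => [|i /negPf ij]; last first.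
    rewrite /Rep /Imp /d ij/=.
    under [X in int01 X]funext do rewrite mulr0.
    under [X in _ + int01 X]funext do rewrite mulr0.
    by rewrite int0 addr0 mulr0.
  rewrite /Rep /d eqxx/=; under [X in int01 X + _]funext do rewrite mulr0.
  rewrite int0 add0r => /eqP; rewrite mulf_eq0 gt_eqF//= => /eqP.
  by congr (_ = _); congr int01; apply/funext => x; rewrite /Imp eqxx.
by apply: ae01S2 rh ih => x _ h1 h2; exact: complex_eq.
Qed.

End SmoothDensity.

(** * Smooth functions in the domain of A *)

Section ContinuousRepresentative.
Context {R : realType}.
Notation mu := (@lebesgue_measure R).
Implicit Types (f u : R -> R[i]) (h : R -> R).
Local Open Scope complex_scope.

Lemma ae01_itv_ex (P : R -> Prop) (a b : R) : 0 <= a -> a < b -> b <= 1 -> ae01 P ->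
  exists2 x, x \in `]a, b[ & P x.
Proof.
move=> a0 ab b1 aeP; apply: contrapT => nP.
have : mu.-negligible (`]a, b[%classic : set R).
  apply: negligibleS aeP => x xab hx; apply: nP; exists x => //; apply: hx.
  by move: xab; rewrite /= !in_itv/= => /andP[ax xb]; rewrite (le_lt_trans a0 ax) (lt_le_trans xb b1).
move=> /(negligibleP mu (measurable_itv _)).
move=> z; have : lebesgue_measure (`]a, b[%classic : set R) = (b - a)%:E.
  by rewrite lebesgue_measure_itv/= lte_fin ab -EFinD.
by move=> /(eq_trans (esym z)) /eqP; rewrite eqe eq_sym subr_eq0 gt_eqF.
Qed.

Lemma within01_ae_eq0 h : {within `[0, 1], continuous h} ->
  ae01 (fun x => h x = 0) -> forall x, x \in `[0, 1] -> h x = 0.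
Proof.
move=> /subspace_continuousP ch ae0 x xI; apply/eqP; rewrite -normr_eq0 eq_le normr_ge0 andbT.
apply/ler_addgt0Pr => e e0; rewrite add0r.
have /cvgrPdist_lt/(_ _ e0) := ch x xI.
rewrite near_withinE => /nbhs_ballP[d /= d0 hd].
have [x0 x1] : 0 <= x /\ x <= 1 by move: xI; rewrite in_itv/= => /andP.
(* Clipping to the unit interval leaves a nonempty open interval even when [x] is an end point. *)
have [y yab hy] : exists2 y, y \in `]Num.max 0 (x - d), Num.min 1 (x + d)[ & h y = 0.
  apply: ae01_itv_ex ae0; rewrite ?le_max ?lexx ?ge_min ?lexx//.
  by rewrite gt_max !lt_min ltr01/=; apply/andP; split; [lra|apply/andP; split; lra].
move: yab; rewrite in_itv/= gt_max lt_min => /andP[/andP[y0 xy] /andP[y1 yx]].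
have : `|h x - h y| < e.
  apply: hd; last by rewrite /= in_itv/= !ltW.
  by rewrite /ball/= ltr_distl; apply/andP; split; lra.
by rewrite hy subr0 => /ltW.
Qed.

Lemma norm_normc (z : R[i]) : `|z| = (ComplexField.Normc.normc z)%:C.
Proof. by []. Qed.

Lemma ler_normc_Re (z : R[i]) : `|complex.Re z| <= ComplexField.Normc.normc z.
Proof. by case: z => a b /=; rewrite -sqrtr_sqr ler_wsqrtr// lerDl sqr_ge0. Qed.

Lemma ler_normc_Im (z : R[i]) : `|complex.Im z| <= ComplexField.Normc.normc z.
Proof. by case: z => a b /=; rewrite -sqrtr_sqr ler_wsqrtr// lerDr sqr_ge0. Qed.

Lemma ler_normcD_Re_Im (z : R[i]) :
  ComplexField.Normc.normc z <= `|complex.Re z| + `|complex.Im z|.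
Proof.
case: z => a b /=; rewrite -(@ler_pXn2r _ 2) ?nnegrE ?sqrtr_ge0 ?addr_ge0//.
rewrite sqr_sqrtr ?addr_ge0 ?sqr_ge0// sqrrD !real_normK ?num_real//.
by rewrite lerD2r lerDl mulrn_wge0// mulr_ge0.
Qed.

Lemma cvg_complexP {T : Type} (F : set_system T) (FF : Filter F) (u : T -> R[i]) (l : R[i]) :
  (u : T -> R[i]^o) x @[x --> F] --> (l : R[i]^o) <->
  (complex.Re (u x) @[x --> F] --> complex.Re l) /\
  (complex.Im (u x) @[x --> F] --> complex.Im l).
Proof.
split=> [/cvgrPdist_lt h|[/cvgrPdist_lt hr /cvgrPdist_lt hi]].
  have h' e : 0 < e -> \forall x \near F, ComplexField.Normc.normc (l - u x) < e.
    move=> e0; have ec : 0 < e%:C :> R[i] by rewrite ltcR.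
    by have := h _ ec; apply: filterS => x; rewrite norm_normc ltcR.
  split; apply/cvgrPdist_lt => e /h'; apply: filterS => x; apply: le_lt_trans.
    by have := ler_normc_Re (l - u x); case: (l) => ? ?; case: (u x).
  by have := ler_normc_Im (l - u x); case: (l) => ? ?; case: (u x).
apply/cvgrPdist_lt => e e0.
(* The norm on [R[i]] takes values in [R[i]], so epsilon is complex; being positive, it is real. *)
have [er0 ee] : 0 < complex.Re e /\ e = (complex.Re e)%:C.
  by case: e e0 => a b; rewrite ltcE /= => /andP[/eqP -> ->].
have e20 : 0 < complex.Re e / 2 by rewrite divr_gt0.
apply: filterS2 (hr _ e20) (hi _ e20) => x h1 h2.
rewrite ee norm_normc ltcR; apply: le_lt_trans (ler_normcD_Re_Im _) _.
have -> : complex.Re (l - u x) = complex.Re l - complex.Re (u x).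
  by case: (l) => ? ?; case: (u x).
have -> : complex.Im (l - u x) = complex.Im l - complex.Im (u x).
  by case: (l) => ? ?; case: (u x).
by move: h1 h2; move: `|_| `|_| => a b; lra.
Qed.

Lemma within_complexP u (A : set R) : {within A, continuous (u : R -> R[i]^o)} <->
  {within A, continuous (Rep u)} /\ {within A, continuous (Imp u)}.
Proof.
split=> [/subspace_continuousP h|[/subspace_continuousP hr /subspace_continuousP hi]].
  by split; apply/subspace_continuousP => x Ax; have /cvg_complexP[] := h x Ax.
by apply/subspace_continuousP => x Ax; apply/cvg_complexP; split; [exact: hr|exact: hi].
Qed.

(** Two continuous functions that agree almost everywhere agree on all of [[0, 1]], so the choice
    made by [xget] does not affect boundary values. *)
Lemma continuous_repr_eq f u : {within `[0, 1], continuous (Rep u)} ->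
  {within `[0, 1], continuous (Imp u)} -> ae01 (fun x => u x = f x) ->
  [/\ {within `[0, 1], continuous (Rep (continuous_repr f))},
      {within `[0, 1], continuous (Imp (continuous_repr f))},
      ae01 (fun x => continuous_repr f x = f x) &
      forall x, x \in `[0, 1] -> continuous_repr f x = u x].
Proof.
move=> ur ui uf; pose S := [set u : R -> R[i] |
  {within `[0, 1], continuous (u : R -> R[i]^o)} /\ ae01 (fun x => u x = f x)].
have Su : S u by split => //; apply/within_complexP.
have [/within_complexP[wr wi] wf] : S (continuous_repr f) := xgetPex (fun=> 0) (ex_intro S u Su).
split => // x xI; apply: complex_eq.
  apply/eqP; rewrite -subr_eq0 -[- _]mulN1r; apply/eqP.
  apply: (@within01_ae_eq0 (fun x => Rep (continuous_repr f) x + -1 * Rep u x)) => //.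
    by apply: withinD => //; apply: withinM => //; exact: within_cst.
  by apply: ae01S2 wf uf => y _ e1 e2; rewrite /Rep e1 e2 mulN1r subrr.
apply/eqP; rewrite -subr_eq0 -[- _]mulN1r; apply/eqP.
apply: (@within01_ae_eq0 (fun x => Imp (continuous_repr f) x + -1 * Imp u x)) => //.
  by apply: withinD => //; apply: withinM => //; exact: within_cst.
by apply: ae01S2 wf uf => y _ e1 e2; rewrite /Imp e1 e2 mulN1r subrr.
Qed.

End ContinuousRepresentative.

(** * Multiplication by [C^1] coefficients *)

Section Coefficients.
Context {R : realType}.
Implicit Types (c f : R -> R).
Local Open Scope complex_scope.

Lemma within01_continuous_at f (x : R) : {within `[0, 1], continuous f} ->
  x \in `]0, 1[ -> {for x, continuous f}.
Proof.
move=> /subspace_continuousP cf xI; apply/cvgrPdist_lt => e e0.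
have [x0 x1] : 0 < x /\ x < 1 by move: xI; rewrite in_itv/= => /andP.
have /cvgrPdist_lt/(_ _ e0) := cf x (subitv01 xI).
rewrite near_withinE => h; near=> y.
have yI : y \in `[0, 1].
  rewrite in_itv/=; apply/andP; split; near: y.
    exact: lt_le_nbhsr.
  exact: lt_le_nbhsl.
by move: yI; near: y.
Unshelve. all: by end_near. Qed.

Lemma C1_01_derive c : C1_01 c -> exists2 c' : R -> R,
  {within `[0, 1], continuous c'} &
  forall x : R, x \in `]0, 1[ -> is_derive x (1 : R) c (c' x).
Proof.
move=> [c' cc' dc]; exists c' => // x xI.
have [x0 x1] : 0 < x /\ x < 1 by move: xI; rewrite in_itv/= => /andP.
suff h : h^-1 *: ((c \o shift x) (h *: 1) - c x) @[h --> (0:R)^'] --> c' x.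
  by apply: DeriveDef; [apply/cvg_ex; exists (c' x)|exact: (cvg_lim _ h)].
apply/cvgrPdist_lt => e e0.
have /cvgrPdist_lt/(_ _ e0) H := dc x (subitv01 xI).
rewrite !near_withinE in H; move/nbhs_ballP : H => [d /= d0 hd].
have m0 : 0 < Num.min d (Num.min x (1 - x)) by rewrite !lt_min d0 x0 subr_gt0.
near=> h.
have h0 : h != 0 by near: h; exact: nbhs_dnbhs_neq.
have : `|h| < Num.min d (Num.min x (1 - x)) by near: h; exact: dnbhs0_lt.
rewrite !lt_min => /andP[hd' /andP[hx hx1]].
have hn : h <= `|h| by exact: ler_norm.
have hn' : - h <= `|h| by rewrite -normrN ler_norm.
have /= := hd (h + x); rewrite addrK [_ *: 1]mulr1 [_ *: _]mulrC; apply.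
- by rewrite /ball/= opprD addrCA subrr addr0 normrN.
- by rewrite -subr_eq0 addrK.
- by rewrite in_itv/=; apply/andP; split; lra.
Unshelve. all: by end_near. Qed.

Lemma C1_01_mfun c : C1_01 c -> mfun01 c.
Proof.
move=> /C1_01_derive[c' _ dc]; apply: open_continuous_measurable_fun.
  exact: interval_open.
move=> x; rewrite inE/= => xI; apply: differentiable_continuous.
by apply/derivable1_diffP; have [] := dc _ xI.
Qed.

Lemma near_out_itv (a b x : R) : x \notin `[a, b] -> \forall y \near x, y \notin `[a, b].
Proof.
rewrite in_itv/= negb_and -!ltNge => /orP[xa|bx]; near=> y;
  rewrite in_itv/= negb_and -!ltNge; apply/orP; [left|right]; near: y.
  exact: lt_nbhsl.
exact: lt_nbhsr.
Unshelve. all: by end_near. Qed.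

Lemma C1fun_out f f1 (a b : R) : C1fun f f1 ->
  (forall x, x \notin `[a, b] -> f x = 0) -> forall x, x \notin `[a, b] -> f1 x = 0.
Proof.
move=> [df _] f0 x xab; have [_ <-] := df x.
rewrite -(@near_eq_derive _ _ _ (cst 0)) ?derive_cst//.
by apply: filterS (near_out_itv xab) => y /f0.
Qed.

(** [c] is controlled on [[0, 1]] only; around any point outside the support of [f] the product is
    locally 0, whatever [c] does there. *)
Lemma C1_01_mul_C1fun c f f1 : C1_01 c -> C1fun f f1 -> supp01 f ->
  exists2 k, C1fun (fun x => c x * f x) k & supp01 k.
Proof.
move=> /C1_01_derive[c' cc' dc] fC [a [b [a0 b1 f0]]].
have [df cf1] := fC; have cf := C1fun_continuous fC.
have f10 := C1fun_out fC f0.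
pose k x := c x * f1 x + f x * c' x.
have k0 x : x \notin `[a, b] -> k x = 0.
  by move=> xab; rewrite /k f0// f10// mulr0 mul0r addr0.
have inI x : x \in `[a, b] -> x \in `]0, 1[.
  by rewrite !in_itv/= => /andP[ax xb]; rewrite (lt_le_trans a0) ?(le_lt_trans xb).
exists k; last by exists a, b.
split=> x; have [xab|xab] := boolP (x \in `[a, b]).
- have := @is_deriveM R R c f x 1 _ _ (dc _ (inI _ xab)) (df x).
  by move=> H; apply: (is_derive_eq H).
- rewrite k0//; have H : is_derive x (1 : R) (cst 0 : R -> R) (0 : R) by exact: is_derive_cst.
  apply: near_eq_is_derive H.
  by apply: filterS (near_out_itv xab) => y /f0 ->; rewrite mulr0.
- have cx : {for x, continuous c}.
    apply: differentiable_continuous; apply/derivable1_diffP.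
    by have [] := dc _ (inI _ xab).
  have cx' := within01_continuous_at cc' (inI _ xab).
  by apply: cvgD; apply: cvgM; [exact: cx|exact: cf1|exact: cf|exact: cx'].
- rewrite /continuous_at k0//; apply: cvg_near_cst.
  by apply: filterS (near_out_itv xab) => y /k0.
Qed.

(** The constant 1, written as 1 plus the primitive of 0, has weak derivative 0. *)
Lemma int01_derive_test (phi : R -> R) : test_function phi -> int01 (derive1 phi) = 0.
Proof.
move=> tphi; have := @prim_weak_deriv R (fun=> 0) 1 (intg01_cst 0) phi tphi.
have p0 x : prim (fun=> 0 : R) x = 0.
  rewrite /prim (_ : _ \_ _ = fun=> 0 : R) ?/int01 ?Rintegral_cst ?mul0r//.
  by apply/funext => y; rewrite patchE; case: ifP.
rewrite (_ : (fun x => 0 * phi x) = fun=> 0); last by apply/funext => x; rewrite mul0r.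
rewrite [in RHS]/int01 Rintegral_cst// mul0r oppr0 => <-.
by congr int01; apply/funext => x; rewrite p0 addr0 mul1r.
Qed.

Lemma C1fun_weak_deriv f f1 : C1fun f f1 -> weak_deriv f f1.
Proof.
move=> fC phi tphi; have [pC ps] := test_C1fun tphi.
have M := C1funM fC pC; have [df cf1] := fC; have [dp cp1] := pC.
have cf := C1fun_continuous fC; have cp := C1fun_continuous pC.
have := int01_derive_test (C1fun_test M (supp01Mr f ps)).
rewrite (C1fun_derive1 M) int01D; last 2 first.
- by apply/continuous_intg01 => x; apply: cvgM; [exact: cf|exact: cp1].
- by apply/continuous_intg01 => x; apply: cvgM; [exact: cp|exact: cf1].
move/eqP; rewrite addr_eq0 => /eqP ->; congr (- _).
by congr int01; apply/funext => x; rewrite mulrC.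
Qed.

End Coefficients.

(** * Green's formula on an edge *)

Section SmoothOperator.
Context {R : realType} {n m : nat} (G : edge_graph n m) (mu : 'I_m -> R) (c : 'I_m -> R -> R).
Hypothesis mu_gt0 : forall j, 0 < mu j.
Hypothesis c_C1 : forall j, C1_01 (c j).
Notation E := ('I_m -> R -> Rcomplex R).
Implicit Types (f g h : E).
Local Open Scope complex_scope.

Lemma supp01_end (f : R -> R) : supp01 f -> f 0 = 0 /\ f 1 = 0.
Proof.
move=> [a [b [a0 b1 f0]]]; split; apply: f0; rewrite in_itv/= negb_and -!ltNge.
  by rewrite a0.
by rewrite b1 orbT.
Qed.

Lemma C2c_supp01 (f : R -> R) : C2c f -> supp01 f.
Proof. by move=> [? [? [_ _ s _]]]. Qed.

Lemma smooth_weak_derivative (f : R -> R[i]) (f1r f1i : R -> R) :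
  C2c (Rep f) -> C2c (Imp f) -> C1fun (Rep f) f1r -> C1fun (Imp f) f1i ->
  inH1 f /\ ae01 (fun x => weak_derivative f x = f1r x +i* f1i x).
Proof.
move=> fr fi dr di; have [_ cr] := dr; have [_ ci] := di.
have sq (h : R -> R) : continuous h -> sqint01 h.
  move=> ch; have [M _ hM] := within01_bounded (continuous_within ch).
  apply: (@sqint01_bounded _ _ M); first exact: continuous_mfun01.
  by move=> x /subitv01; exact: hM.
have g2 : inL2 1 (fun x => f1r x +i* f1i x).
  by apply/(inL2P _ ltr01); split; exact: sq.
have wd : is_weak_derivative f (fun x => f1r x +i* f1i x).
  by apply/is_weak_derivativeP; split; exact: C1fun_weak_deriv.
have H : inH1 f.
  split; first by apply/(inL2P _ ltr01); split; exact: C2c_sqint01.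
  by exists (fun x => f1r x +i* f1i x).
by split => //; exact: weak_derivative_ae.
Qed.

Lemma smooth_domV f : smooth_edges f -> domV G f.
Proof.
move=> fs; split=> [j|].
  have [fr fi] := fs j; have [r1 [r2 [hr _ _ _]]] := fr; have [i1 [i2 [hi _ _ _]]] := fi.
  by have [] := smooth_weak_derivative fr fi hr hi.
exists 0; rewrite !mulmx0.
have e j x : x \in `[0, 1] -> continuous_repr (f j) x = f j x.
  have [fr fi] := fs j.
  have [_ _ _ h] := @continuous_repr_eq R (f j) (f j)
    (continuous_within (C2c_continuous fr)) (continuous_within (C2c_continuous fi))
    (ae01W (fun x _ => erefl)).
  exact: h.
split; apply/matrixP => j k; rewrite !mxE e ?in_itv/= ?lexx ?ler01//;
  have [fr fi] := fs j; apply/esym/complex_eq;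
  have [r0 r1] := supp01_end (C2c_supp01 fr);
  have [i0 i1] := supp01_end (C2c_supp01 fi); by [].
Qed.

(** The real and imaginary parts of [c0 f'] are themselves test functions, so they can be inserted
    into the definition of the weak derivative of [h]; hence no boundary terms. *)
Lemma green_edge (w : R) (c0 : R -> R) (f h : R -> R[i]) (f1r f1i kr ki : R -> R) :
  C1_01 c0 -> continuous f1r -> continuous f1i ->
  test_function (fun x => c0 x * f1r x) -> test_function (fun x => c0 x * f1i x) ->
  derive1 (fun x => c0 x * f1r x) = kr -> derive1 (fun x => c0 x * f1i x) = ki ->
  ae01 (fun x => weak_derivative f x = f1r x +i* f1i x) -> inH1 f -> inH1 h ->
  cint01 (fun x => (w * c0 x)%:C * weak_derivative f x * (weak_derivative h x)^* ) =
  cint01 (fun x => - (kr x +i* ki x) * (h x)^* * w%:C).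
Proof.
move=> c0C cr ci tr ti er ei fae /inH1P[_ _ wr wi _].
move=> /inH1P[hr hi vr vi /is_weak_derivativeP[dr di]].
set v := weak_derivative h in vr vi dr di *; set u := weak_derivative f in fae wr wi *.
have mc := C1_01_mfun c0C.
have ctr := test_continuous tr; have cti := test_continuous ti.
have ckr : continuous kr by rewrite -er; have [[_ ?] _] := test_C1fun tr.
have cki : continuous ki by rewrite -ei; have [[_ ?] _] := test_C1fun ti.
have [ivr ivi] := (sqint01_intg vr, sqint01_intg vi).
have [ihr ihi] := (sqint01_intg hr, sqint01_intg hi).
have IM (q p : R -> R) : intg01 q -> continuous p -> intg01 (fun x => q x * p x).
  by move=> iq cp; apply: intg01M_within => //; exact: continuous_within.
have i1 := IM _ _ ivr ctr; have i2 := IM _ _ ivi cti.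
have i3 := IM _ _ ivr cti; have i4 := IM _ _ ivi ctr.
have j1 := IM _ _ ihr ckr; have j2 := IM _ _ ihi cki.
have j3 := IM _ _ ihr cki; have j4 := IM _ _ ihi ckr.
have e1 := dr _ tr; have e2 := di _ ti; have e3 := dr _ ti; have e4 := di _ tr.
rewrite er in e1 e4; rewrite ei in e2 e3.
have mf1r := continuous_mfun01 cr; have mf1i := continuous_mfun01 ci.
have [[mvr mvi] [mwr mwi]] := ((sqint01_mfun vr, sqint01_mfun vi), (sqint01_mfun wr, sqint01_mfun wi)).
have mwc : mfun01 (fun x => w * c0 x) by apply: measurable_funM => //; exact: measurable_cst.
apply: complex_eq; rewrite ?cint01_Re ?cint01_Im.
- transitivity (int01 (fun x => w * (Rep v x * (c0 x * f1r x) + Imp v x * (c0 x * f1i x)))).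
    transitivity (int01 (fun x => w * c0 x * (Rep u x * Rep v x + Imp u x * Imp v x))).
      congr int01; apply/funext => x; rewrite /Rep /Imp.
      by case: (u x) => ? ?; case: (v x) => ? ? /=; ring.
    apply: int01_ae.
    + by apply: measurable_funM => //; apply: measurable_funD; exact: measurable_funM.
    + apply: measurable_funM; first exact: measurable_cst.
      by apply: intg01_mfun; exact: intg01D.
    + by apply: ae01S fae => x _ e; rewrite /Rep /Imp e /=; ring.
  rewrite int01Z ?int01D//; last exact: intg01D.
  transitivity (int01 (fun x => w * (- (Rep h x * kr x) - Imp h x * ki x))).
    rewrite int01Z; last by apply: intg01B => //; exact: intg01N.
    by rewrite int01B//; [rewrite int01N// e1 e2; ring|exact: intg01N].
  by congr int01; apply/funext => x; rewrite /Rep /Imp; case: (h x) => ? ? /=; ring.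
transitivity (int01 (fun x => w * (Rep v x * (c0 x * f1i x) - Imp v x * (c0 x * f1r x)))).
  transitivity (int01 (fun x => w * c0 x * (Imp u x * Rep v x - Rep u x * Imp v x))).
    congr int01; apply/funext => x; rewrite /Rep /Imp.
    by case: (u x) => ? ?; case: (v x) => ? ? /=; ring.
  apply: int01_ae.
  + by apply: measurable_funM => //; apply: measurable_funB; exact: measurable_funM.
  + apply: measurable_funM; first exact: measurable_cst.
    by apply: intg01_mfun; exact: intg01B.
  + by apply: ae01S fae => x _ e; rewrite /Rep /Imp e /=; ring.
rewrite int01Z ?int01B//; last exact: intg01B.
transitivity (int01 (fun x => w * (Imp h x * kr x - Rep h x * ki x))).
  rewrite int01Z; last exact: intg01B.
  by rewrite int01B// e3 e4; ring.
by congr int01; apply/funext => x; rewrite /Rep /Imp; case: (h x) => ? ? /=; ring.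
Qed.

(** The image [k] is [(c f')'] on each edge, the constant weight [mu j] being common to the form and
    the inner product. The pair [q] holds its real and imaginary parts. *)
Lemma smooth_operator_A f : smooth_edges f -> exists k, operator_A G mu c f k.
Proof.
move=> fs; have dV := smooth_domV fs.
have /choice[q hq] j : exists q : (R -> R) * (R -> R),
    inL2 (mu j) (fun x => - (q.1 x +i* q.2 x)) /\
    forall h : E, domV G h ->
    cint01 (fun x => (mu j * c j x)%:C * weak_derivative (f j) x * (weak_derivative (h j) x)^* ) =
    cint01 (fun x => - (q.1 x +i* q.2 x) * (h j x)^* * (mu j)%:C).
  have [fr fi] := fs j; have [r1 [r2 [hr hr2 sr sr1]]] := fr.
  have [i1 [i2 [hi hi2 si si1]]] := fi.
  have [kr krC kr0] := C1_01_mul_C1fun (c_C1 j) hr2 sr1.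
  have [ki kiC ki0] := C1_01_mul_C1fun (c_C1 j) hi2 si1.
  have [Hf fae] := smooth_weak_derivative fr fi hr hi.
  have [_ ckr] := krC; have [_ cki] := kiC.
  have sq (h : R -> R) : continuous h -> sqint01 h.
    move=> ch; have [M _ hM] := within01_bounded (continuous_within ch).
    apply: (@sqint01_bounded _ _ M); first exact: continuous_mfun01.
    by move=> x /subitv01; exact: hM.
  exists (kr, ki); split=> [|h [hH _]] /=.
    by apply/(inL2P _ (mu_gt0 j)); split; apply: sqint01N; exact: sq.
  apply: (green_edge _ (c_C1 j) _ _ _ _ _ _ fae Hf (hH j)).
  - exact: C1fun_continuous hr2.
  - exact: C1fun_continuous hi2.
  - by apply: (C1fun_test krC); exact: supp01Mr.
  - by apply: (C1fun_test kiC); exact: supp01Mr.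
  - exact: C1fun_derive1.
  - exact: C1fun_derive1.
pose g : E := fun j x => - ((q j).1 x +i* (q j).2 x).
exists (fun j x => - g j x); split => //.
  move=> j; have [/(inL2P _ (mu_gt0 j))[gr gi] _] := hq j; apply/(inL2P _ (mu_gt0 j)).
  by split; [exact: (sqint01N gr)|exact: (sqint01N gi)].
exists g; split.
- by move=> j; have [] := hq j.
- by move=> h hV; apply: eq_bigr => j _; have [_ ->] := hq j.
- by move=> j; exact: ae01W.
Qed.

End SmoothOperator.

(** * Truncations in V *)

Section Truncation.
Context {R : realType}.
Implicit Types (f : R -> R) (a b s : R).

Lemma C1fun_MVT f f1 a b : C1fun f f1 -> exists2 c, `|c - a| <= `|b - a| &
  f b - f a = f1 c * (b - a).
Proof.
move=> fC; have [df _] := fC; have cf := C1fun_continuous fC.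
have [ab|ba|->] := ltgtP a b; last by exists b; rewrite !subrr ?mulr0.
  have [c + ->] := MVT ab (fun x _ => df x) (continuous_within cf).
  rewrite in_itv/= => /andP[ac cb]; exists c => //.
  by rewrite !ger0_norm ?subr_ge0 ?(ltW ac)// ?(ltW ab)// lerB// ltW.
have [c + h] := MVT ba (fun x _ => df x) (continuous_within cf).
rewrite in_itv/= => /andP[bc ca]; exists c.
  by rewrite !ler0_norm ?subr_le0 ?(ltW ca)// ?(ltW ba)// lerN2 lerB// ltW.
by rewrite -[LHS]opprB h -mulrN opprB.
Qed.

Lemma C1fun_lipschitz f f1 B a b : C1fun f f1 -> (forall x, `|f1 x| <= B) ->
  `|f a - f b| <= B * `|a - b|.
Proof.
move=> fC hB; have [c _ ->] := C1fun_MVT b a fC.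
by rewrite normrM ler_wpM2r.
Qed.

(** The mean value theorem suffices, at the price of a factor 2 against the Taylor remainder. *)
Lemma C1fun_quadratic_upper f f1 a b : C1fun f f1 ->
  (forall x y, `|f1 x - f1 y| <= `|x - y|) ->
  f b <= f a + f1 a * (b - a) + (b - a) ^+ 2.
Proof.
move=> fC L; have [c ca e] := C1fun_MVT a b fC.
have : (f1 c - f1 a) * (b - a) <= (b - a) ^+ 2.
  apply: le_trans (ler_norm _) _; rewrite normrM -(@real_normK _ (b - a)) ?num_real// expr2.
  by rewrite ler_wpM2r// (le_trans (L _ _)).
by rewrite mulrBl -e; lra.
Qed.

Section Threshold.
Variable M : R.

(* [slope] is min(max(s - M, 0), 1); [excess] and [penalty] are its successive
   antiderivatives vanishing on ]-oo, M], and the clipping at 1 makes [excess]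
   Lipschitz. *)
Definition penalty s : R :=
  6^-1 * (pospart (1 * s + - M) ^+ 3 + - 1 * pospart (1 * s + - (M + 1)) ^+ 3).
Definition excess s : R :=
  2^-1 * (pospart (1 * s + - M) ^+ 2 + - 1 * pospart (1 * s + - (M + 1)) ^+ 2).
Definition slope s : R := pospart (1 * s + - M) + - 1 * pospart (1 * s + - (M + 1)).

(** The arguments [1 * s + - M] have the shape produced by [C1fun_affine], so the derivative is
    assembled from the C1 rules without rewriting. *)
Lemma C1fun_penalty : C1fun penalty excess.
Proof.
have A k := C1fun_comp (C1fun_pospart 1) (C1fun_affine (1 : R) k).
have := C1funZ 6^-1 (C1funD (A (- M)) (C1funZ (-1) (A (- (M + 1))))).
by congr C1fun; apply/funext => x; rewrite /excess; field.
Qed.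

Lemma C1fun_excess : C1fun excess slope.
Proof.
have A k := C1fun_comp (C1fun_pospart 0) (C1fun_affine (1 : R) k).
have := C1funZ 2^-1 (C1funD (A (- M)) (C1funZ (-1) (A (- (M + 1))))).
by congr C1fun; apply/funext => x; rewrite /slope; field.
Qed.

Lemma slope_ge0_le1 s : 0 <= slope s <= 1.
Proof.
rewrite /slope /pospart; case: (leP (1 * s + - M) 0) => h1;
  by case: (leP (1 * s + - (M + 1)) 0) => h2; apply/andP; split; lra.
Qed.

Lemma slope_lipschitz a b : `|slope a - slope b| <= 1 * `|a - b|.
Proof.
rewrite mul1r /slope /pospart.
have n1 := ler_norm (a - b); have n2 := ler_norm (b - a); rewrite distrC in n2.
case: (leP (1 * a + - M) 0) => h1; case: (leP (1 * a + - (M + 1)) 0) => h2;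
case: (leP (1 * b + - M) 0) => h3; case: (leP (1 * b + - (M + 1)) 0) => h4;
rewrite ler_norml; apply/andP; split; lra.
Qed.

Lemma norm_slope s : `|slope s| <= 1.
Proof. by have /andP[s0 s1] := slope_ge0_le1 s; rewrite ger0_norm. Qed.

Lemma excess_lipschitz a b : `|excess a - excess b| <= 1 * `|a - b|.
Proof. by apply: C1fun_lipschitz C1fun_excess _; exact: norm_slope. Qed.

Lemma penalty_quadratic_upper a b :
  penalty b <= penalty a + excess a * (b - a) + (b - a) ^+ 2.
Proof.
apply: C1fun_quadratic_upper C1fun_penalty _ => x y.
by have := excess_lipschitz x y; rewrite mul1r.
Qed.

Lemma penalty_le s : s <= M -> penalty s = 0.
Proof.
move=> sM; rewrite /penalty !pospart_eq0; [by rewrite expr0n/= mulr0 addr0 mulr0| |]; lra.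
Qed.

Lemma pospart_shift_le s : pospart (1 * s + - (M + 1)) <= pospart (1 * s + - M).
Proof.
rewrite /pospart; case: (leP (1 * s + - M) 0) => h1;
  by case: (leP (1 * s + - (M + 1)) 0) => h2; lra.
Qed.

Lemma penalty_ge0 s : 0 <= penalty s.
Proof.
rewrite mulr_ge0 ?invr_ge0// mulN1r subr_ge0 ler_pXn2r ?nnegrE ?pospart_ge0//.
exact: pospart_shift_le.
Qed.

Lemma penalty_eq0 s : penalty s = 0 -> s <= M.
Proof.
move=> /eqP; rewrite mulf_eq0 invr_eq0 pnatr_eq0/= mulN1r subr_eq0 => /eqP h.
rewrite leNgt; apply/negP => Ms.
have : pospart (1 * s + - (M + 1)) ^+ 3 < pospart (1 * s + - M) ^+ 3.
  rewrite ltr_pXn2r ?nnegrE ?pospart_ge0// /pospart.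
  case: (leP (1 * s + - M) 0) => h1;
    by case: (leP (1 * s + - (M + 1)) 0) => h2; lra.
by rewrite h ltxx.
Qed.

Hypothesis M0 : 0 <= M.

Lemma excess_0 : excess 0 = 0.
Proof.
rewrite /excess !pospart_eq0; [by rewrite expr0n/= mulr0 addr0 mulr0| |];
  move: M0; lra.
Qed.

(** [0 <= M] places 0 where [excess] vanishes; this yields the norm bound required of the gradient
    in the Lyapunov argument. *)
Lemma norm_excess s : `|excess s| <= `|s|.
Proof. by have := excess_lipschitz s 0; rewrite excess_0 !subr0 mul1r. Qed.

Lemma penalty_le_sqr s : penalty s <= s ^+ 2.
Proof.
by have := penalty_quadratic_upper 0 s; rewrite (penalty_le M0) excess_0 mul0r !add0r subr0.
Qed.

End Threshold.
End Truncation.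

(** * Truncation on [X_2] and on the form domain *)

Section TruncationInV.
Context {R : realType} {n m : nat} (G : edge_graph n m) (mu : 'I_m -> R) (c : 'I_m -> R -> R).
Hypothesis mu_gt0 : forall j, 0 < mu j.
Hypothesis c_C1 : forall j, C1_01 (c j).
Hypothesis c_gt0 : forall j x, x \in `[0, 1] -> 0 < c j x.
Variable M : R.
Hypothesis M0 : 0 <= M.
Notation E := ('I_m -> R -> Rcomplex R).
Implicit Types (f g h u : E).
Local Open Scope complex_scope.

(** The gradient of [penaltyX] for the real inner product [reip]; it is real-valued since the
    penalty sees real parts only. *)
Definition truncX u : E := fun j x => (excess M (Rep (u j) x))%:C.

Lemma excess_continuous : continuous (excess M).
Proof. exact: C1fun_continuous (C1fun_excess M). Qed.

Lemma excess_sqint01 (f : R -> R) : sqint01 f -> sqint01 (fun x => excess M (f x)).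
Proof.
move=> hf; apply: (sqint01_le_ae _ _ hf).
  apply: measurableT_comp; last exact: sqint01_mfun hf.
  by apply: continuous_measurable_fun; exact: excess_continuous.
by apply: ae01W => x _; exact: norm_excess.
Qed.

Lemma truncX_inX2 u : inX2 mu u -> inX2 mu (truncX u).
Proof.
move=> /(inX2P mu_gt0) Xu; apply/(inX2P mu_gt0) => j; have [ur _] := Xu j.
by split; [exact: excess_sqint01|exact: sqint01_cst].
Qed.

Lemma truncX_weak_derivative j u : inH1 (u j) -> inH1 (truncX u j) /\
  ae01 (fun x => weak_derivative (truncX u j) x =
    (slope M (Rep (u j) x) * Rep (weak_derivative (u j)) x)%:C).
Proof.
move=> /inH1P[ur ui wr wi /is_weak_derivativeP[dr _]].
have ms : mfun01 (fun x => slope M (Rep (u j) x)).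
  apply: measurableT_comp; last exact: sqint01_mfun ur.
  by apply: continuous_measurable_fun; have [] := C1fun_excess M.
have sg : sqint01 (fun x => slope M (Rep (u j) x) * Rep (weak_derivative (u j)) x).
  apply: (sqint01_le_ae _ _ wr); first by apply: measurable_funM => //; exact: sqint01_mfun wr.
  by apply: ae01W => x _; rewrite normrM ler_piMl// norm_slope.
have g2 : inL2 1 (fun x => (slope M (Rep (u j) x) * Rep (weak_derivative (u j)) x)%:C).
  by apply/(inL2P _ ltr01); split; [exact: sg|exact: sqint01_cst].
have wd : is_weak_derivative (truncX u j)
    (fun x => (slope M (Rep (u j) x) * Rep (weak_derivative (u j)) x)%:C).
  apply/is_weak_derivativeP; split.
    apply: (chain_rule (C1fun_excess M) (norm_slope M) (@excess_lipschitz R M)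
      (@slope_lipschitz R M) (sqint01_intg ur) (sqint01_intg wr) dr).
  by apply: C1fun_weak_deriv; exact: C1fun_cst.
have H : inH1 (truncX u j).
  split; last by exists (fun x => (slope M (Rep (u j) x) * Rep (weak_derivative (u j)) x)%:C).
  by apply/(inL2P _ ltr01); split; [exact: excess_sqint01|exact: sqint01_cst].
by split => //; exact: weak_derivative_ae.
Qed.

Lemma inH1_continuous_repr (f : R -> R[i]) : inH1 f ->
  [/\ {within `[0, 1], continuous (Rep (continuous_repr f))},
      {within `[0, 1], continuous (Imp (continuous_repr f))} &
      ae01 (fun x => continuous_repr f x = f x)].
Proof.
move=> /inH1P[fr fi wr wi /is_weak_derivativeP[dr di]].
have [vr cr er] := weak_deriv_continuous_repr (sqint01_intg fr) (sqint01_intg wr) dr.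
have [vi ci ei] := weak_deriv_continuous_repr (sqint01_intg fi) (sqint01_intg wi) di.
have e : ae01 (fun x => vr x +i* vi x = f x).
  by apply: ae01S2 er ei => x _ h1 h2; exact: complex_eq.
by have [] := @continuous_repr_eq R f (fun x => vr x +i* vi x) cr ci e.
Qed.

Lemma truncX_continuous_repr j u : inH1 (u j) -> forall x, x \in `[0, 1] ->
  continuous_repr (truncX u j) x = (excess M (Rep (continuous_repr (u j)) x))%:C.
Proof.
move=> /inH1_continuous_repr[cr ci e].
have [//|||_ _ _ h] := @continuous_repr_eq R (truncX u j)
  (fun x => (excess M (Rep (continuous_repr (u j)) x))%:C).
- by apply: within_comp => //; exact: excess_continuous.
- exact: within_cst.
- by apply: ae01S e => x _ ex; rewrite /truncX /Rep ex.
exact: h.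
Qed.

(** A transposed incidence matrix reads off the vertex value at one end of each edge; a general [e]
    covers both ends. *)
Lemma Phi_mul (e : 'I_m -> 'I_n) (d : 'cV[R[i]]_n) j (k : 'I_1) :
  ((\matrix_(i < n, l < m) (e l == i)%:R)^T *m d) j k = d (e j) k.
Proof.
rewrite !mxE (bigD1 (e j))//= !mxE eqxx mul1r big1 ?addr0// => i /negPf ij.
by rewrite !mxE eq_sym ij mul0r.
Qed.

Lemma truncX_domV u : domV G u -> domV G (truncX u).
Proof.
move=> [uH [d [d0 d1]]]; split=> [j|]; first by have [] := truncX_weak_derivative (uH j).
exists (\col_i (excess M (complex.Re (d i ord0)))%:C).
have e0 : (0 : R) \in `[0, 1] by rewrite in_itv/= lexx ler01.
have e1 : (1 : R) \in `[0, 1] by rewrite in_itv/= lexx ler01.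
split; apply/matrixP => j k; rewrite Phi_mul !mxE truncX_continuous_repr//.
  have := congr1 (fun A : 'cV_m => A j k) d0; rewrite Phi_mul mxE => h.
  by rewrite /Rep -h (ord1 k).
have := congr1 (fun A : 'cV_m => A j k) d1; rewrite Phi_mul mxE => h.
by rewrite /Rep -h (ord1 k).
Qed.

Lemma form_truncX_ge0 u : domV G u -> 0 <= complex.Re (form_a mu c u (truncX u)).
Proof.
move=> [uH _]; rewrite /form_a Re_sum; apply: sumr_ge0 => j _; rewrite cint01_Re.
have [tH te] := truncX_weak_derivative (uH j).
have [_ _ wr wi _] := inH1P (uH j); have [_ _ vr vi _] := inH1P tH.
set w := weak_derivative (u j) in te wr wi *.
set v := weak_derivative (truncX u j) in te vr vi *.
have mc := C1_01_mfun (c_C1 j).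
have -> : Rep (fun x => (mu j * c j x)%:C * w x * (v x)^* ) =
    fun x => mu j * c j x * (Rep w x * Rep v x + Imp w x * Imp v x).
  by apply/funext => x; rewrite /Rep /Imp; case: (w x) => ? ?; case: (v x) => ? ? /=; ring.
apply: int01_ge0_ae.
  have mw : mfun01 (fun x => mu j * c j x).
    by apply: measurable_funM => //; exact: measurable_cst.
  have mi : mfun01 (fun x => Rep w x * Rep v x + Imp w x * Imp v x).
    by apply: intg01_mfun; apply: intg01D; exact: sqint01M.
  exact: (measurable_funM mw mi).
apply: ae01S te => x xI e.
have -> : Rep v x = slope M (Rep (u j) x) * Rep w x by rewrite /Rep e.
have -> : Imp v x = 0 by rewrite /Imp e.
rewrite mulr0 addr0 [Rep w x * _]mulrCA -expr2.
have /andP[s0 _] := slope_ge0_le1 M (Rep (u j) x).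
apply: mulr_ge0; first by rewrite mulr_ge0 ?ltW// c_gt0// subitv01.
by rewrite mulr_ge0// sqr_ge0.
Qed.

End TruncationInV.

(** * Invariance of half-planes *)

Section HalfSpaceInvariance.
Context {R : realType} {n m : nat} (G : edge_graph n m) (mu : 'I_m -> R) (c : 'I_m -> R -> R).
Hypothesis mu_gt0 : forall j, 0 < mu j.
Hypothesis c_C1 : forall j, C1_01 (c j).
Hypothesis c_gt0 : forall j x, x \in `[0, 1] -> 0 < c j x.
Variable T : R -> edge_fun (R := R) (m := m) -> edge_fun (R := R) (m := m).
Hypothesis T_gen : generated_by_A G mu c T.
Notation E := ('I_m -> R -> Rcomplex R).
Implicit Types (f g h k : E).
Local Open Scope complex_scope.
Notation N := (sip_norm (reip mu)).

Lemma real_scaleE (a : R) (z : R[i]) : (a *: (z : Rcomplex R)) = a%:C * z :> R[i].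
Proof. by case: z => x y; apply: complex_eq => /=; ring. Qed.

Lemma T_semigroup_mod_null :
  @semigroup_mod_null R E (inX2 mu) (reip mu) T.
Proof.
have [sg _] := T_gen.
have XT t f : 0 <= t -> inX2 mu f -> inX2 mu (T t f) by exact: (semigroup_X2 sg).
split.
- exact: XT.
- move=> t a f g t0 Xf Xg; have sip := edge_sip mu_gt0.
  apply/(eqX_norm mu_gt0).
  + by apply: XT => //; apply: (sip_domP sip).
  + by apply: (sip_domP sip) => //; exact: XT.
  have -> : a *: f + g = (fun j x => a%:C * f j x + g j x) :> E.
    by apply/funext => j; apply/funext => x; rewrite -real_scaleE.
  have -> : a *: (T t f : E) + T t g = (fun j x => a%:C * T t f j x + T t g j x) :> E.
    by apply/funext => j; apply/funext => x; rewrite -real_scaleE.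
  exact: (semigroup_linear sg).
- by move=> t t0; exact: (semigroup_bounded sg t0).
- move=> f Xf; apply/(eqX_norm mu_gt0) => //; first exact: XT.
  exact: (semigroup_0 sg).
- move=> s t f s0 t0 Xf; apply/(eqX_norm mu_gt0).
  + by apply: XT => //; rewrite addr_ge0.
  + by apply: (XT) => //; apply: (XT).
  exact: (semigroup_add sg).
- by move=> f Xf; exact: (semigroup_continuous sg Xf).
Qed.

Lemma T_generatorP f k :
  @sg_generator R E (inX2 mu) (reip mu) T f k <-> operator_A G mu c f k.
Proof.
have [_ gA] := T_gen; rewrite -(gA f k).
have e : (fun t => N (t^-1 *: ((T t f : E) - f) - k)) =
    (fun t => normX2 mu (fun j x => (t^-1)%:C * (T t f j x - f j x) - k j x)).
  apply/funext => t; congr (N _).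
  by apply/funext => j; apply/funext => x; rewrite -real_scaleE.
rewrite /sg_generator e /generator; split=> -[Xf Xk h].
  by split; [exact: Xf|exact: Xk|exact: h].
by split; [exact: Xf|exact: Xk|exact: h].
Qed.

Variable M : R.
Hypothesis M0 : 0 <= M.
Notation P := (truncX M).

Definition penaltyX f : R := \sum_j mu j * int01 (fun x => penalty M (Rep (f j) x)).

Lemma penalty_intg01 (f : R -> R) : sqint01 f -> intg01 (fun x => penalty M (f x)).
Proof.
move=> hf; have [mf f2] := hf; apply: (intg01_le _ _ f2).
  apply: measurableT_comp => //; apply: continuous_measurable_fun.
  exact: C1fun_continuous (C1fun_penalty M).
by move=> x _; rewrite ger0_norm ?penalty_ge0// penalty_le_sqr.
Qed.

Lemma norm_truncX_le f : inX2 mu f -> N (P f) <= N f.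
Proof.
move=> Xf; have XP := truncX_inX2 mu_gt0 M0 Xf.
apply: ler_wsqrtr; rewrite !reip_self//; apply: ler_sum => j _.
have [fr fi] := (inX2P mu_gt0 f).1 Xf j; have [pr pi] := (inX2P mu_gt0 _).1 XP j.
rewrite ler_pM2l//; apply: lerD.
  apply: le_int01; [by have [] := pr|by have [] := fr|move=> x _].
  rewrite -(@real_normK _ (Rep _ _)) ?num_real// -(@real_normK _ (Rep (f j) x)) ?num_real//.
  by rewrite ler_pXn2r ?nnegrE//; exact: norm_excess.
apply: le_int01; [by have [] := pi|by have [] := fi|move=> x _].
by rewrite /Imp /= expr0n/= sqr_ge0.
Qed.

(** [penalty_quadratic_upper] integrated over the edges; the imaginary part of [g - f] only enlarges
    the right-hand side. *)
Lemma penaltyX_le f g : inX2 mu f -> inX2 mu g ->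
  penaltyX g <= penaltyX f + reip mu (g - f) (P f) + N (g - f) ^+ 2.
Proof.
move=> Xf Xg; have Xd := domB (edge_sip mu_gt0) Xg Xf.
have XP := truncX_inX2 mu_gt0 M0 Xf.
rewrite (sqr_sip_norm (edge_sip mu_gt0))// reip_self// reipE// /penaltyX -!big_split/=.
apply: ler_sum => j _; rewrite -!mulrDr ler_pM2l//.
have [fr fi] := (inX2P mu_gt0 f).1 Xf j; have [gr gi] := (inX2P mu_gt0 g).1 Xg j.
have [dr di] := (inX2P mu_gt0 _).1 Xd j; have [pr pi] := (inX2P mu_gt0 _).1 XP j.
have i1 := penalty_intg01 fr; have i2 := penalty_intg01 gr.
have i3 := sqint01M dr pr; have i4 := sqint01M di pi.
have [_ i5] := dr; have [_ i6] := di.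
have k1 := intg01D i3 i4; have k2 := intg01D i1 k1; have k3 := intg01D i5 i6.
rewrite -(int01D i3 i4) -(int01D i1 k1) -(int01D i5 i6) -(int01D k2 k3).
apply: le_int01; [exact: i2|exact: intg01D k2 k3|].
move=> x _; have := penalty_quadratic_upper M (Rep (f j) x) (Rep (g j) x).
rewrite RepB [Imp (P f j) x]/Imp /= mulr0 addr0 => /le_trans; apply.
rewrite [Rep (P f j) x]/Rep /= [_ * excess _ _]mulrC lerD2l lerDl sqr_ge0//.
Qed.

Lemma penaltyX_dissipative f k :
  @sg_generator R E (inX2 mu) (reip mu) T f k -> reip mu k (P f) <= 0.
Proof.
move=> /T_generatorP[fV Xk [g [Xg hg kg]]].
have PV := truncX_domV M0 fV.
have := form_truncX_ge0 mu_gt0 c_C1 c_gt0 M0 fV; rewrite hg// -/(reip mu g (P f)).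
suff -> : reip mu k (P f) = - reip mu g (P f) by move=> h; rewrite oppr_le0.
have sip := edge_sip mu_gt0; have XP : inX2 mu (P f).
  by have [PH _] := PV; move=> j; have [+ _] := PH j; rewrite !inL2P.
have Xng : inX2 mu (- g : E) by apply: (domN sip).
rewrite -(ipNl sip)//.
have kg0 : N ((k : E) - - g) = 0.
  by apply/(eqX_norm mu_gt0).
have Xd := domB sip Xk Xng.
(* [k] and [- g] differ by a null vector, which Cauchy-Schwarz makes invisible to the inner
   product. *)
have := cauchy_schwarz sip Xd XP; rewrite kg0 mul0r normr_le0 (ipBl sip)// subr_eq0.
by move/eqP.
Qed.

Lemma penaltyX_mono t f : 0 <= t -> inX2 mu f -> penaltyX (T t f) <= penaltyX f.
Proof.
move=> t0 Xf; apply: (lyapunov_semigroup (edge_sip mu_gt0) T_semigroup_mod_null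
  (P := P) (phi := penaltyX)) => //.
- exact: truncX_inX2.
- exact: norm_truncX_le.
- exact: penaltyX_le.
- exact: penaltyX_dissipative.
- exact: edge_complete.
move=> g Xg e e0; have [h hs gh] := smooth_dense mu_gt0 Xg e0.
have [k hk] := smooth_operator_A G mu_gt0 c_C1 hs.
by exists h, k; split => //; apply/T_generatorP.
Qed.

Lemma half_space_invariant t f : 0 <= t -> inX2 mu f ->
  (forall j, ae01 (fun x => Rep (f j) x <= M)) ->
  forall j, ae01 (fun x => Rep (T t f j) x <= M).
Proof.
move=> t0 Xf fM j; have [sg _] := T_gen.
have XT : inX2 mu (T t f : E) by apply: (semigroup_X2 sg).
have f0 : penaltyX f = 0.
  rewrite /penaltyX big1// => i _; have [fr _] := (inX2P mu_gt0 f).1 Xf i.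
  rewrite (@int01_ae _ _ (fun=> 0 : R)).
  - by rewrite /int01 Rintegral_cst// mul0r mulr0.
  - exact: intg01_mfun (penalty_intg01 fr).
  - exact: measurable_cst.
  - by apply: ae01S (fM i) => x _; exact: penalty_le.
have := penaltyX_mono t0 Xf; rewrite f0 => le0.
have t1 i : 0 <= mu i * int01 (fun x => penalty M (Rep (T t f i) x)).
  rewrite mulr_ge0 ?(ltW (mu_gt0 i))//.
  by apply: int01_ge0 => x _; exact: penalty_ge0.
have /eqP : penaltyX (T t f) = 0 by apply/le_anti; rewrite le0 sumr_ge0.
rewrite /penaltyX psumr_eq0// => /allP/(_ j (mem_index_enum _))/=.
rewrite mulf_eq0 gt_eqF//= => /eqP i0.
have [tr _] := (inX2P mu_gt0 _).1 XT j.
have := int01_eq0_ae (penalty_intg01 tr) (fun x _ => penalty_ge0 M _) i0.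
by apply: ae01S => x _; exact: penalty_eq0.
Qed.

End HalfSpaceInvariance.

(** * Essential suprema and discs *)

Section SupNorm.
Context {R : realType}.
Local Open Scope complex_scope.
Notation normc := ComplexField.Normc.normc.

(** [0 <= k] makes the extension by 0 harmless, and the positive measure of the line selects the
    essential supremum in the definition of the norm. *)
Lemma normLoo_le (f : R -> R[i]) (k : R) : 0 <= k ->
  (normLoo f <= k%:E)%E <-> ae01 (fun x => normc (f x) <= k).
Proof.
move=> k0; rewrite /normLoo unlock.
have mT : (0 < (@lebesgue_measure R) [set: R])%E.
  apply: (@lt_le_trans _ _ ((@lebesgue_measure R) `]0%R, 1%R[%classic)).
    by rewrite mu01 lte_fin.
  by apply: le_measure; rewrite ?inE//; exact: measurable_itv.
have pE x : (abse \o (fun x : R => (normc (f x))%:E) \_ `]0%R, 1%R[%classic) x =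
    if x \in `]0, 1[ then (normc (f x))%:E else 0%E.
  rewrite /= patchE mem_setE; case: ifP => _; last by rewrite abse0.
  by rewrite /= ger0_norm//; case: (f x) => a b; exact: sqrtr_ge0.
case: ifPn => [_|]; last by rewrite mT.
have F := ae_filter_ringOfSetsType (@lebesgue_measure R).
split=> [/ess_supP h|h].
  apply: (@filterS _ _ F) h => x; rewrite pE => + xI.
  by rewrite xI lee_fin.
apply/ess_supP; apply: (@filterS _ _ F) h => x h; rewrite pE.
by case: ifPn => [/h|_]; rewrite lee_fin.
Qed.

Lemma normc_ge0 (z : R[i]) : 0 <= normc z.
Proof. by case: z => a b; exact: sqrtr_ge0. Qed.

Lemma normcD (z1 z2 : R[i]) : normc (z1 + z2) <= normc z1 + normc z2.
Proof. by rewrite -lecR rmorphD /= -!norm_normc ler_normD. Qed.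

(* Countably many half-planes cut out the disc, so null sets can be collected. *)
Lemma normc_le_of_rat (z : R[i]) (k : R) : 0 <= k ->
  (forall a b : rat, complex.Re ((ratr a +i* ratr b) * z) <= normc (ratr a +i* ratr b) * k) ->
  normc z <= k.
Proof.
move=> k0 h; have r0 := normc_ge0 z; set r := normc z in r0 *.
have rr : r ^+ 2 = complex.Re z ^+ 2 + complex.Im z ^+ 2 by exact: sqr_normc.
have rR := ler_normc_Re z; have rI := ler_normc_Im z; rewrite -/r in rR rI.
suff h2 : r ^+ 2 <= r * k.
  rewrite leNgt; apply/negP => rk; move: h2; rewrite leNgt expr2.
  by rewrite ltr_pM2l ?rk// (le_lt_trans k0 rk).
apply/ler_addgt0Pr => e e0.
(* With rationals within [d] of the components of the conjugate of [z], the product [w * z] has real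
   part at least [r ^+ 2 - 2 * d * r] and [w] has modulus at most [r + 2 * d]. The hypothesis then
   gives [r ^+ 2 <= r * k + 2 * d * (r + k)], and the added 1 keeps the denominator positive. *)
pose d := e / (2 * (r + k) + 1).
have D0 : 0 < 2 * (r + k) + 1 by lra.
have d0 : 0 < d by rewrite divr_gt0.
have dE : d * (2 * (r + k) + 1) = e by rewrite divfK// gt_eqF.
have [a ha] : exists a : rat, `|ratr a - complex.Re z| <= d.
  have [|a] := @rat_in_itvoo R (complex.Re z - d) (complex.Re z + d); first by lra.
  by rewrite in_itv/= => /andP[h1 h2]; exists a; rewrite ler_distl; apply/andP; split; lra.
have [b hb] : exists b : rat, `|ratr b + complex.Im z| <= d.
  have [|b] := @rat_in_itvoo R (- complex.Im z - d) (- complex.Im z + d); first by lra.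
  rewrite in_itv/= => /andP[h1 h2]; exists b.
  by rewrite -[complex.Im z]opprK ler_distl; apply/andP; split; lra.
have := h a b; set w := ratr a +i* ratr b => hw.
have wz : w = (z^*)%C + ((ratr a - complex.Re z) +i* (ratr b + complex.Im z)).
  by rewrite /w; case: (z) => x y /=; apply: complex_eq => /=; ring.
have nw : normc w <= r + 2 * d.
  rewrite wz; apply: le_trans (normcD _ _) _; apply: lerD.
    by rewrite /r; case: (z) => x y /=; rewrite sqrrN.
  by apply: le_trans (ler_normcD_Re_Im _) _ => /=; lra.
have lw : r ^+ 2 - 2 * d * r <= complex.Re (w * z).
  have -> : complex.Re (w * z) = r ^+ 2 + (ratr a - complex.Re z) * complex.Re z -
      (ratr b + complex.Im z) * complex.Im z.
    by rewrite rr /w; case: (z) => x y /=; ring.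
  have b1 : `|(ratr a - complex.Re z) * complex.Re z| <= d * r.
    by rewrite normrM ler_pM.
  have b2 : `|(ratr b + complex.Im z) * complex.Im z| <= d * r.
    by rewrite normrM ler_pM.
  move: b1 b2; rewrite !ler_norml => /andP[b1 _] /andP[_ b2]; lra.
have nk : normc w * k <= (r + 2 * d) * k by rewrite ler_wpM2r.
nra.
Qed.

End SupNorm.

(** * Reality, positivity and contractivity *)

Section SubMarkov.
Context {R : realType} {n m : nat} (G : edge_graph n m) (mu : 'I_m -> R) (c : 'I_m -> R -> R).
Hypothesis mu_gt0 : forall j, 0 < mu j.
Hypothesis c_C1 : forall j, C1_01 (c j).
Hypothesis c_gt0 : forall j x, x \in `[0, 1] -> 0 < c j x.
Variable T : R -> edge_fun (R := R) (m := m) -> edge_fun (R := R) (m := m).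
Hypothesis T_gen : generated_by_A G mu c T.
Implicit Types (f g h k : edge_fun (R := R) (m := m)).
Local Open Scope complex_scope.
Notation normc := ComplexField.Normc.normc.

(** By complex linearity [T] commutes almost everywhere with multiplication by [w]. Since
    [semigroup_linear] is about [a * f + g], [w * f] is written as [(w - 1) * f + f]. *)
Lemma rotated_half_space_invariant t f (w : R[i]) M : 0 <= M -> 0 <= t -> inX2 mu f ->
  (forall j, ae01 (fun x => complex.Re (w * f j x) <= M)) ->
  forall j, ae01 (fun x => complex.Re (w * T t f j x) <= M).
Proof.
move=> M0 t0 Xf fM j; have [sg _] := T_gen.
have wE z : (w - 1) * z + z = w * z :> R[i] by rewrite mulrBl mul1r subrK.
have e : (fun i x => (w - 1) * f i x + f i x) = (fun i x => w * f i x).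
  by apply/funext => i; apply/funext => x; exact: wE.
have Xw : inX2 mu (fun i x => w * f i x).
  apply/(inX2P mu_gt0) => i; have [fr fi] := (inX2P mu_gt0 f).1 Xf i; split.
    have := sqint01B (sqint01Z (complex.Re w) fr) (sqint01Z (complex.Im w) fi).
    by congr sqint01; apply/funext => x; rewrite /Rep /Imp; case: (w) => ? ?; case: (f i x).
  have := sqint01D (sqint01Z (complex.Re w) fi) (sqint01Z (complex.Im w) fr).
  by congr sqint01; apply/funext => x; rewrite /Rep /Imp; case: (w) => ? ?; case: (f i x).
have := semigroup_linear sg (w - 1) t0 Xf Xf; rewrite e => /(_ j) Tw.
have := half_space_invariant mu_gt0 c_C1 c_gt0 T_gen M0 t0 Xw fM j.
by apply: ae01S2 Tw => x _; rewrite /Rep wE => ->.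
Qed.

Lemma real_semigroup_T : real_semigroup mu T.
Proof.
move=> t f t0 Xf fr j.
have h1 : ae01 (fun x => complex.Re ('i%C * T t f j x) <= 0).
  apply: rotated_half_space_invariant => // i; apply: ae01S (fr i) => x _.
  by case: (f i x) => a b /= ->; lra.
have h2 : ae01 (fun x => complex.Re (- 'i%C * T t f j x) <= 0).
  apply: rotated_half_space_invariant => // i; apply: ae01S (fr i) => x _.
  by case: (f i x) => a b /= ->; lra.
apply: ae01S2 h1 h2 => x _; case: (T t f j x) => a b /= e1 e2.
by apply/le_anti/andP; split; lra.
Qed.

Lemma positive_semigroup_T : positive_semigroup mu T.
Proof.
move=> t f t0 Xf f0 j.
have fr : real_valued f.
  by move=> i; apply: ae01S (f0 i) => x _; rewrite lecE => /andP[/eqP].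
have h1 : ae01 (fun x => complex.Re (-1 * T t f j x) <= 0).
  apply: rotated_half_space_invariant => // i; apply: ae01S (f0 i) => x _.
  by rewrite lecE => /andP[_]; case: (f i x) => a b /=; lra.
apply: ae01S2 h1 (real_semigroup_T t0 Xf fr j) => x _; rewrite lecE.
case: (T t f j x) => a b /= e1 ->; rewrite eqxx/=; lra.
Qed.

Lemma Xoo_contractive_T : Xoo_contractive T.
Proof.
move=> t f t0 [mf foo].
have n0 : (0 <= normXoo f)%E by apply: bigmax_ge_id.
pose k := fine (normXoo f).
have kE : normXoo f = k%:E by rewrite fineK// ge0_fin_numE.
have k0 : 0 <= k by rewrite fine_ge0.
have fk j : ae01 (fun x => normc (f j x) <= k).
  apply/normLoo_le => //; rewrite -kE; exact: le_bigmax.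
(* On an interval of length 1, bounded functions are square integrable. *)
have Xf : inX2 mu f.
  apply/(inX2P mu_gt0) => j; have [mr mi] := mf j; split.
    apply: (sqint01_le_ae mr _ (sqint01_cst k)); apply: ae01S (fk j) => x _ h.
    by rewrite (le_trans (ler_normc_Re _))// (le_trans h)// ler_norm.
  apply: (sqint01_le_ae mi _ (sqint01_cst k)); apply: ae01S (fk j) => x _ h.
  by rewrite (le_trans (ler_normc_Im _))// (le_trans h)// ler_norm.
rewrite kE; apply: bigmax_le; first by rewrite lee_fin.
move=> j _; apply/normLoo_le => //.
have Tr (a b : rat) : ae01 (fun x => complex.Re ((ratr a +i* ratr b) * T t f j x) <=
    normc (ratr a +i* ratr b) * k).
  apply: rotated_half_space_invariant => //; first by rewrite mulr_ge0// normc_ge0.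
  move=> i; apply: ae01S (fk i) => x _ h.
  apply: le_trans (ler_norm _) _; apply: le_trans (ler_normc_Re _) _.
  rewrite ComplexField.Normc.normcM; apply: ler_wpM2l h; exact: normc_ge0.
(* Pairs of rationals are enumerated by [pickle], so that one null set serves all of them; numbers
   that encode no pair get a trivial condition. *)
pose Q (q : nat) x := x \in `]0, 1[ -> if unpickle q is Some ab then
  let w : R[i] := ratr (ab : rat * rat).1 +i* ratr ab.2 in
  complex.Re (w * T t f j x) <= normc w * k else true.
have : {ae @lebesgue_measure R, forall x q, Q q x}.
  apply: ae_foralln => q; rewrite /Q.
  by case: (unpickle q) => [[a b]|]; [exact: Tr|exact: aeW].
apply: (@filterS _ _ (ae_filter_ringOfSetsType (@lebesgue_measure R))) => x h xI.
apply: normc_le_of_rat => // a b.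
by have := h (pickle (a, b)) xI; rewrite pickleK.
Qed.

End SubMarkov.

Theorem lemma3p1 (R : realType) (n m : nat) (G : edge_graph n m)
  (mu : 'I_m -> R) (c : 'I_m -> R -> R)
  (T : R -> edge_fun (R := R) (m := m) -> edge_fun (R := R) (m := m))
  (G_simple : simple_graph G) (G_connected : connected_graph G)
  (G_degree : forall v : 'I_n, (2 <= degree G v)%N)
  (mu_gt0 : forall j : 'I_m, 0 < mu j)
  (c_C1 : forall j : 'I_m, C1_01 (c j))
  (c_gt0 : forall (j : 'I_m) (x : R), x \in `[0, 1] -> 0 < c j x)
  (T_semigroup : generated_by_A G mu c T) :
  sub_markovian mu T.
Proof.
split.
- exact: (real_semigroup_T mu_gt0 c_C1 c_gt0 T_semigroup).
- exact: (positive_semigroup_T mu_gt0 c_C1 c_gt0 T_semigroup).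
- exact: (Xoo_contractive_T mu_gt0 c_C1 c_gt0 T_semigroup).
Qed.
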